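(* (i) There are exactly four periodic triangulations of $\mathbb{Z}^4$ up to $\mathrm{GL}_4(\mathbb{Z})$-equivalence. (ii) Every periodic partial triangulation $\mathcal{PT}$ of $\mathbb{Z}^4$ is extensible to a full periodic triangulation of $\mathbb{Z}^4$; that is, there is a periodic triangulation $\mathcal{T}$ of $\mathbb{Z}^4$ with $\mathcal{PT}\subseteq\mathcal{T}$.
   Context: A partial triangulation of $\mathbb{Z}^n$ is a collection of $n$-dimensional simplices in $\mathbb{R}^n$ whose set of vertices is $\mathbb{Z}^n$ and such that the intersection of any two simplices of the collection is a (possibly empty) face of both. A triangulation of $\mathbb{Z}^n$ is a partial triangulation whose simplices cover $\mathbb{R}^n$. A (partial) triangulation $\mathcal{T}$ is periodic if $\mathcal{T}+v=\mathcal{T}$ for every $v\in\mathbb{Z}^n$. Two periodic triangulations $\mathcal{T},\mathcal{T}'$ of $\mathbb{Z}^n$ are $\mathrm{GL}_n(\mathbb{Z})$-equivalent if $\mathcal{T}'=g\mathcal{T}$ for some $g\in\mathrm{GL}_n(\mathbb{Z})$. *)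

(* Defs.v *)
From HB Require Import structures.
From mathcomp Require Import all_boot all_order all_algebra.
From mathcomp Require Import boolp classical_sets reals.

Set Implicit Arguments.
Unset Strict Implicit.
Unset Printing Implicit Defensive.

Import GRing.Theory Num.Theory.

Local Open Scope classical_set_scope.
Local Open Scope ring_scope.

Section PeriodicTriangulations.
Variables (R : realType) (n : nat).

Implicit Types (p : 'I_n.+1 -> 'cV[R]_n) (S F : set 'cV[R]_n)
  (T : set (set 'cV[R]_n)).

Definition affinely_independent p :=
  forall c : 'I_n.+1 -> R,
    \sum_i c i = 0 -> \sum_i c i *: p i = 0 -> forall i, c i = 0.

(* The convex hull of {p i | i in I}; it is empty when I is, since an empty
   sum is not 1. *)
Definition hull p (I : {set 'I_n.+1}) : set 'cV[R]_n :=
  [set x | exists c : 'I_n.+1 -> R,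
     [/\ forall i, i \in I -> 0 <= c i,
         \sum_(i in I) c i = 1 &
         x = \sum_(i in I) c i *: p i]].

(* Simplices are subsets of R^n. The family p is determined by S up to a
   permutation of the indices, so the choice of p is immaterial in
   vertices and is_face. *)
Definition spans_simplex p S :=
  affinely_independent p /\ S = hull p finset.setT.

Definition is_simplex S := exists p, spans_simplex p S.

Definition vertices S : set 'cV[R]_n :=
  [set v | exists2 p, spans_simplex p S & exists i, v = p i].

Definition is_face F S :=
  exists2 p, spans_simplex p S & exists I, F = hull p I.

Definition int_vector (z : 'cV[int]_n) : 'cV[R]_n := map_mx intr z.

Definition integer_lattice : set 'cV[R]_n := range int_vector.

Definition partial_triangulation T :=
  [/\ forall S, T S -> is_simplex S,
      \bigcup_(S in T) vertices S = integer_lattice &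
      forall S1 S2, T S1 -> T S2 ->
        is_face (S1 `&` S2) S1 /\ is_face (S1 `&` S2) S2].

Definition triangulation T :=
  partial_triangulation T /\ \bigcup_(S in T) S = setT.

Definition translate (v : 'cV[R]_n) T : set (set 'cV[R]_n) :=
  [set [set x + v | x in S] | S in T].

Definition periodic T :=
  forall v, integer_lattice v -> translate v T = T.

Definition linear_image (g : 'M[int]_n) T : set (set 'cV[R]_n) :=
  [set [set map_mx intr g *m x | x in S] | S in T].

(* GL_n(Z) is the set of integer matrices invertible over the integers. *)
Definition GLZ_equivalent T T' :=
  exists2 g : 'M[int]_n, g \in unitmx & T' = linear_image g T.

End PeriodicTriangulations.

(* Main.v *)
(** For a simplex of a periodic partial triangulation, translates of a
    sub-barycentre of one simplex must be carried by equal faces.  Comparing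
    barycentric residues of lattice points this way shows that every simplex is
    unimodular, that two edges congruent modulo 2 agree up to sign, and that two
    triangles 0, u, v with congruent u + v modulo 3 agree.  Normalise one simplex
    to the standard one.  Its ten edges fill ten of the fifteen nonzero parity
    classes, and an apex argument bounds the edges in the other five: up to sign
    only 45 edge vectors are possible.  A finite search over the simplices made of
    these edges, branching on the edges chosen in the five classes and then on
    conflicting triangles, maps all simplices, by one matrix of GL_4(Z), into one
    of four explicit triangulations of the unit cube.  Each of the four is
    face-to-face, by separating functionals, and covers the cube, by bisecting
    Kuhn's simplices; they are inequivalent because the numbers of simplices
    around their edges differ.  A triangulation contained in a partial
    triangulation equals it. *)

From HB Require Import structures.
From Stdlib Require Import ZArith Lia.
Require Import Defs.
From mathcomp Require Import all_boot all_order all_algebra.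
From mathcomp Require Import boolp classical_sets reals.
From mathcomp Require Import ssrZ ring.

Set Implicit Arguments.
Unset Strict Implicit.
Unset Printing Implicit Defensive.

(* [%Z] denotes the scope of MathComp's integers. *)
Delimit Scope Z_scope with ZZ.

(** * Convex hulls, barycentric coordinates and faces *)

Section ConvexGeometry.
Import Order.TTheory GRing.Theory Num.Theory.
Local Open Scope classical_set_scope.
Local Open Scope ring_scope.

Section ConvexHulls.
Variables (R : realType) (n : nat).
Local Notation V := 'cV[R]_n.
Implicit Types (s : seq V) (c : V -> R) (T : set (set V)).

(** A partial triangulation enters through one rule: if a point is a convex combination of the
    vertices of two of its simplices, then the vertices of positive weight and their weights agree.
    With weights scaled to integers, and translates supplied by periodicity, the rule speaks of
    lattice points alone. It is a field of the record [simplex_family], and everything through the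
    search uses that record only. Covering plays no part there, so partial and full triangulations
    are treated alike. Bounding an edge is the obstacle, since congruences give no size. An edge of
    a simplex is either closed up by a path of at most three edges that are edges of the standard
    simplex, which bounds it, or one of its ends is joined to all four other vertices by edges
    outside the ten standard classes. Only the second case needs the apex argument: the four other
    vertices then form a copy of a facet of the standard simplex or of its negative, and the apex
    over that facet is controlled by residues. The patterns that occur need not form a maximal
    compatible set. They are enlarged to one, so the search enumerates maximal sets only and
    discards a branch as soon as a pattern could be added. *)

Definition comb s c : V := \sum_(p <- s) c p *: p.

Definition conv s : set V :=
  [set x | exists c, [/\ forall p, p \in s -> 0 <= c p,
                         \sum_(p <- s) c p = 1 & x = comb s c]].

Definition indep s :=
  uniq s /\ forall c, \sum_(p <- s) c p = 0 -> comb s c = 0 ->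
                      forall p, p \in s -> c p = 0.

Lemma affinely_independent_inj (p : 'I_n.+1 -> V) :
  affinely_independent p -> injective p.
Proof.
move=> ind i j pij; apply/eqP/negP => /negP nij.
have := ind (fun k => (k == i)%:R - (k == j)%:R).
rewrite sumrB.
have sum1 (k : 'I_n.+1) : \sum_l (l == k)%:R = 1 :> R.
  by rewrite (bigD1 k) //= eqxx big1 ?addr0 // => l /negbTE ->.
have sump (k : 'I_n.+1) : \sum_l (l == k)%:R *: p l = p k.
  rewrite (bigD1 k) //= eqxx scale1r big1 ?addr0 // => l /negbTE ->.
  by rewrite scale0r.
rewrite !sum1 subrr => /(_ erefl).
under eq_bigr => k _ do rewrite scalerBl.
rewrite sumrB !sump pij subrr => /(_ erefl i).
by rewrite eqxx (negbTE nij) subr0 => /eqP; rewrite oner_eq0.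
Qed.

(** Weights are attached to points instead of indices, so that lists with the same elements share
    them. Off the range of [p] the weight is 0. *)
Definition weight_of (p : 'I_n.+1 -> V) (c : 'I_n.+1 -> R) (v : V) : R :=
  if [pick i | p i == v] is Some i then c i else 0.

Lemma weight_ofE (p : 'I_n.+1 -> V) (c : 'I_n.+1 -> R) i : injective p -> weight_of p c (p i) = c i.
Proof.
move=> pI; rewrite /weight_of; case: pickP => [j /eqP /pI -> //|/(_ i)].
by rewrite eqxx.
Qed.

Lemma hull_conv (p : 'I_n.+1 -> V) I :
  injective p -> hull p I = conv [seq p i | i <- enum I].
Proof.
move=> pI; apply/seteqP; split => x [c [c0 c1 ->]].
  exists (weight_of p c); split => [v /mapP[i]||].
  - by rewrite mem_enum => iI ->; rewrite weight_ofE // c0.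
  - by rewrite big_map big_enum /= -c1; apply: eq_bigr => i _; rewrite weight_ofE.
  - rewrite /comb big_map big_enum /=.
    by apply: eq_bigr => i _; rewrite weight_ofE.
exists (c \o p); split => [i iI||].
- by apply: c0; rewrite map_f // mem_enum.
- by rewrite -c1 big_map big_enum.
- by rewrite /comb big_map big_enum.
Qed.

Lemma sum_map_enum (W : nmodType) (p : 'I_n.+1 -> V) (F : V -> W) :
  \sum_(v <- [seq p i | i <- enum 'I_n.+1]) F v = \sum_i F (p i).
Proof. by rewrite big_map big_enum. Qed.

Lemma affinely_independent_indep (p : 'I_n.+1 -> V) :
  affinely_independent p -> indep [seq p i | i <- enum 'I_n.+1].
Proof.
move=> ind; have pI := affinely_independent_inj ind; split.
  by rewrite map_inj_uniq ?enum_uniq.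
rewrite /comb => c; rewrite !sum_map_enum => c0 s0 v /mapP[i _ ->].
exact: (ind (c \o p)).
Qed.

Lemma indep_affinely_independent (p : 'I_n.+1 -> V) :
  indep [seq p i | i <- enum 'I_n.+1] ->
  affinely_independent p /\ injective p.
Proof.
case=> u ind.
have pI : injective p by exact/injectiveP.
split=> // c c0 s0 i; rewrite -(weight_ofE c i pI).
apply: ind (map_f p _); rewrite ?mem_enum //.
  rewrite sum_map_enum -[RHS]c0.
  by apply: eq_bigr => j _; rewrite weight_ofE.
rewrite /comb sum_map_enum -[RHS]s0.
by apply: eq_bigr => j _; rewrite weight_ofE.
Qed.

Definition spans s S := [/\ size s = n.+1, indep s & S = conv s].

Lemma spansP S : is_simplex S <-> exists s, spans s S.
Proof.
split=> [[p [ind ->]]|[s [sz ind ->]]].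
  exists [seq p i | i <- enum 'I_n.+1]; split.
  - by rewrite size_map size_enum_ord.
  - exact: affinely_independent_indep.
  - rewrite hull_conv ?enum_setT ?enumT //; exact: affinely_independent_inj.
have szP : size s == n.+1 by apply/eqP.
pose t := Tuple szP.
have tE : [seq tnth t i | i <- enum 'I_n.+1] = s by rewrite map_tnth_enum.
have [tind tI] : affinely_independent (tnth t) /\ injective (tnth t).
  by apply: indep_affinely_independent; rewrite tE.
exists (tnth t); split=> //.
by rewrite hull_conv // enum_setT -enumT tE.
Qed.

Lemma psum_seq_eq0 (s : seq V) (f : V -> R) :
  (forall p, p \in s -> 0 <= f p) -> \sum_(p <- s) f p = 0 ->
  forall p, p \in s -> f p = 0.
Proof.
move=> f0; rewrite big_seq => /eqP; rewrite psumr_eq0 // => /allP h p ps.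
by have := h _ ps; rewrite ps => /eqP.
Qed.

Lemma psum_seq_gt0 (s : seq V) (f : V -> R) :
  \sum_(p <- s) f p = 1 -> exists2 p, p \in s & f p != 0.
Proof.
move=> s1; apply: contrapT => h.
suff : \sum_(p <- s) f p = 0 by rewrite s1 => /eqP; rewrite oner_eq0.
rewrite big_seq big1 // => p ps; apply/eqP; apply: contrapT => /negP fp.
by apply: h; exists p.
Qed.

Lemma sum_delta s v : uniq s -> v \in s ->
  \sum_(p <- s) ((p == v)%:R : R) = 1 /\
  comb s (fun p => (p == v)%:R) = v.
Proof.
move=> us vs; split; rewrite /comb (bigD1_seq v) //= eqxx ?scale1r big1 ?addr0 //
  => p /negbTE ->//; exact: scale0r.
Qed.

Lemma mem_conv s v : uniq s -> v \in s -> conv s v.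
Proof.
move=> us vs; have [s1 sv] := sum_delta us vs.
by exists (fun p => (p == v)%:R); split=> // p _; rewrite ler0n.
Qed.

(* A vertex of a simplex is an extreme point, hence lies in every finite set
   with the same hull. *)
Lemma indep_conv_mem s s' v :
  indep s -> uniq s' -> conv s = conv s' -> v \in s -> v \in s'.
Proof.
move=> [us ind] us' ss' vs; apply: contrapT => /negP vs'.
have : conv s' v by rewrite -ss'; exact: mem_conv.
case=> c [c0 c1 vE].
have /choice[a aP] q : exists a : V -> R, q \in s' ->
    [/\ forall p, p \in s -> 0 <= a p, \sum_(p <- s) a p = 1 & q = comb s a].
  have [qs'|] := boolP (q \in s'); last by exists (fun=> 0).
  have : conv s q by rewrite ss'; exact: mem_conv.
  by case=> a aP; exists a.
have [d1 dv] := sum_delta us vs.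
(* Writing each point of [s'] in terms of [s] gives [v] the weights [b]. By independence [b] is the
   indicator of [v], so any [q] used with nonzero weight [c q] is itself [v]. *)
pose b p := \sum_(q <- s') c q * a q p.
have b1 : \sum_(p <- s) b p = 1.
  rewrite exchange_big /= -c1 big_seq [RHS]big_seq; apply: eq_bigr => q qs'.
  by rewrite -mulr_sumr; have [_ -> _] := aP _ qs'; rewrite mulr1.
have bv : comb s b = v.
  rewrite [RHS]vE /comb /b; under eq_bigr do rewrite scaler_suml.
  rewrite exchange_big /= big_seq [RHS]big_seq; apply: eq_bigr => q qs'.
  have [_ _ qE] := aP _ qs'; rewrite [X in _ = _ *: X]qE /comb scaler_sumr.
  by apply: eq_bigr => p _; rewrite scalerA.
have bE p : p \in s -> p != v -> b p = 0.
  move=> ps pv; have := ind (fun p => b p - (p == v)%:R).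
  rewrite sumrB b1 d1 subrr => /(_ erefl).
  have -> : comb s (fun p => b p - (p == v)%:R) = 0.
    rewrite /comb; under eq_bigr do rewrite scalerBl.
    by rewrite sumrB -/(comb s b) bv -[X in _ - X]/(comb s _) dv subrr.
  by move=> /(_ erefl p ps); rewrite (negbTE pv) subr0.
have [q qs' cq] := psum_seq_gt0 c1.
have [a0 a1 qE] := aP _ qs'.
have aE p : p \in s -> p != v -> a q p = 0.
  move=> ps pv; apply: (mulfI cq); rewrite mulr0.
  apply: (psum_seq_eq0 (f := fun q => c q * a q p)) (bE _ ps pv) _ qs'.
  move=> q' q's'; apply: mulr_ge0; first exact: c0.
  by have [+ _ _] := aP _ q's'; apply.
have av : a q v = 1.
  by rewrite -a1 (bigD1_seq v) //= big_seq_cond big1 ?addr0 // => p /andP[ps /aE->].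
suff qv : q = v by rewrite -qv qs' in vs'.
rewrite qE /comb (bigD1_seq v) //= av scale1r big_seq_cond big1 ?addr0 //.
by move=> p /andP[ps /aE->] //; rewrite scale0r.
Qed.

Lemma indep_conv_inj s s' : indep s -> indep s' -> conv s = conv s' -> s =i s'.
Proof.
move=> i1 i2 ss' v; apply/idP/idP => h.
  by apply: (indep_conv_mem i1) ss' h; case: i2.
by apply: (indep_conv_mem i2) (esym ss') h; case: i1.
Qed.

Lemma comb_filter s (P : pred V) c :
  comb (filter P s) c = comb s (fun p => if P p then c p else 0).
Proof.
rewrite /comb big_filter big_mkcond /=.
by apply: eq_bigr => p _; case: (P p); rewrite ?scale0r.
Qed.

Lemma sum_filter s (P : pred V) c :
  \sum_(p <- filter P s) c p = \sum_(p <- s) (if P p then c p else 0).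
Proof. by rewrite big_filter big_mkcond. Qed.

Lemma indep_filter s (P : pred V) : indep s -> indep (filter P s).
Proof.
case=> us ind; split=> [|c]; first exact: filter_uniq.
rewrite sum_filter comb_filter => c1 c2 p; rewrite mem_filter => /andP[Pp ps].
by have := ind _ c1 c2 _ ps; rewrite Pp.
Qed.

Lemma indep_comb_eq s c c' : indep s ->
  \sum_(p <- s) c p = \sum_(p <- s) c' p -> comb s c = comb s c' ->
  forall p, p \in s -> c p = c' p.
Proof.
move=> [_ ind] e1 e2 p ps; apply/eqP; rewrite -subr_eq0; apply/eqP.
apply: (ind (fun p => c p - c' p)) ps; first by rewrite sumrB e1 subrr.
rewrite /comb; under eq_bigr do rewrite scalerBl.
by rewrite sumrB -!/(comb _ _) e2 subrr.
Qed.

Lemma conv_eqi s s' : uniq s -> uniq s' -> s =i s' -> conv s = conv s'.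
Proof.
move=> u1 u2 ss'; have ps := uniq_perm u1 u2 ss'.
apply/seteqP; split=> x [c [c0 c1 ->]]; exists c; split.
- by move=> p; rewrite -ss'; apply: c0.
- by rewrite -(perm_big _ ps).
- by rewrite /comb (perm_big _ ps).
- by move=> p; rewrite ss'; apply: c0.
- by rewrite (perm_big _ ps).
- by rewrite /comb -(perm_big _ ps).
Qed.

Lemma indep_eqi s s' : uniq s' -> s =i s' -> indep s -> indep s'.
Proof.
move=> u2 ss' [u1 ind]; have ps := uniq_perm u1 u2 ss'; split=> // c.
rewrite /comb -!(perm_big _ ps) => c1 c2 p; rewrite -ss'; exact: ind.
Qed.

Lemma spans_face s S F : spans s S ->
  is_face F S <-> exists P : pred V, F = conv (filter P s).
Proof.
move=> [sz ind ->]; split.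
  case=> p [pind pS] [I ->]; have pI := affinely_independent_inj pind.
  have pE : indep [seq p i | i <- enum 'I_n.+1] by exact: affinely_independent_indep.
  have ss' : s =i [seq p i | i <- enum 'I_n.+1].
    apply: indep_conv_inj => //.
    by rewrite pS hull_conv // enum_setT -enumT.
  exists (mem [seq p i | i <- enum I]); rewrite hull_conv //; apply: conv_eqi.
  - by rewrite map_inj_uniq ?enum_uniq.
  - by apply: filter_uniq; case: ind.
  - move=> v; rewrite mem_filter ss' andb_idr //= => /mapP[i _ ->].
    by rewrite map_f // mem_enum.
case=> P ->.
have szP : size s == n.+1 by apply/eqP.
pose t := Tuple szP.
have tE : [seq tnth t i | i <- enum 'I_n.+1] = s by rewrite map_tnth_enum.
have [tind tI] : affinely_independent (tnth t) /\ injective (tnth t).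
  by apply: indep_affinely_independent; rewrite tE.
exists (tnth t); first by split=> //; rewrite hull_conv // enum_setT -enumT tE.
exists [set i | P (tnth t i)]%SET; rewrite hull_conv //; apply: conv_eqi.
- by apply: filter_uniq; case: ind.
- by rewrite map_inj_uniq ?enum_uniq.
- move=> v; rewrite mem_filter; apply/andP/mapP => [[Pv]|[i]].
    rewrite -tE => /mapP[i _ vE]; exists i => //.
    by rewrite mem_enum inE -vE.
  by rewrite mem_enum inE => Pi ->; split=> //; rewrite -tE map_f // mem_enum.
Qed.

(** The intersection of the two simplices is the hull of a set of common vertices. The common point
    lies in it, and uniqueness of barycentric coordinates in each simplex puts all its weight on
    these vertices. *)
Lemma carrier T s s' a b : partial_triangulation T ->
  spans s (conv s) -> spans s' (conv s') -> T (conv s) -> T (conv s') ->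
  (forall p, p \in s -> 0 <= a p) -> (forall p, p \in s' -> 0 <= b p) ->
  \sum_(p <- s) a p = 1 -> \sum_(p <- s') b p = 1 -> comb s a = comb s' b ->
  forall p, p \in s -> 0 < a p -> p \in s' /\ b p = a p.
Proof.
move=> [_ _ faces] S1 S2 T1 T2 a0 b0 a1 b1 ab.
have [f1 f2] := faces _ _ T1 T2.
have [P1 F1] := (spans_face _ S1).1 f1.
have [P2 F2] := (spans_face _ S2).1 f2.
have [_ i1 _] := S1; have [_ i2 _] := S2.
have e12 : filter P1 s =i filter P2 s'.
  by apply: indep_conv_inj; rewrite -?F1 //; apply: indep_filter.
have : conv (filter P1 s) (comb s a) by rewrite -F1; split; [exists a|exists b].
case=> c [c0]; rewrite sum_filter comb_filter => c1 cE.
have ac := indep_comb_eq i1 (etrans a1 (esym c1)) cE.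
have bE : forall p, p \in s' -> (if p \in filter P1 s then a p else 0) = b p.
  apply: (indep_comb_eq i2); rewrite -?ab -?b1.
    rewrite -sum_filter b1 -[RHS]a1; transitivity (\sum_(p <- filter P1 s) a p).
      apply: perm_big; apply: uniq_perm => [||v]; rewrite ?filter_uniq //;
        try by [case: i1|case: i2].
      by rewrite mem_filter -/(filter P1 s) e12 !mem_filter; case: (P2 v); rewrite ?andbF ?andbT //= andbb.
    rewrite sum_filter big_seq [RHS]big_seq; apply: eq_bigr => p ps.
    by rewrite ac //; case: (P1 p).
  rewrite -comb_filter /comb; transitivity (comb (filter P1 s) a).
    apply: perm_big; apply: uniq_perm => [||v]; rewrite ?filter_uniq //;
        try by [case: i1|case: i2].
    by rewrite mem_filter -/(filter P1 s) e12 !mem_filter; case: (P2 v); rewrite ?andbF ?andbT //= andbb.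
  rewrite comb_filter /comb big_seq [RHS]big_seq; apply: eq_bigr => p ps.
  by rewrite ac //; case: (P1 p).
move=> p ps ap.
have pF : p \in filter P1 s.
  by rewrite mem_filter ps andbT; move: ap; rewrite ac //; case: (P1 p); rewrite ?ltxx.
have ps' : p \in s' by move: pF; rewrite e12 mem_filter => /andP[].
by split=> //; rewrite -bE // pF.
Qed.
End ConvexHulls.

End ConvexGeometry.

(** * Affine and linear images of simplices and triangulations *)

Section AffineGeometry.
Import Order.TTheory GRing.Theory Num.Theory.
Local Open Scope classical_set_scope.
Local Open Scope ring_scope.

Section AffineImages.
Variables (R : realType) (n : nat).
Local Notation V := 'cV[R]_n.
Variables (A : 'M[R]_n) (v : V).
Hypothesis Au : A \in unitmx.

Let f (x : V) : V := A *m x + v.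
Let h (x : V) : V := invmx A *m (x - v).

Lemma affine_cancel : cancel f h.
Proof. by move=> x; rewrite /h /f addrK mulKmx. Qed.

Let fI : injective f := can_inj affine_cancel.

Lemma comb_affine (s : seq V) (c : V -> R) :
  comb (map f s) c = A *m comb s (c \o f) + (\sum_(p <- s) c (f p)) *: v.
Proof.
rewrite /comb big_map mulmx_sumr scaler_suml -big_split /=.
by apply: eq_bigr => p _; rewrite scalerDr scalemxAr.
Qed.

Lemma conv_affine (s : seq V) : conv (map f s) = f @` conv s.
Proof.
apply/seteqP; split=> [x [c [c0 c1 ->]]|_ [x [c [c0 c1 ->]] <-]].
  move: c1; rewrite big_map => c1.
  exists (comb s (c \o f)); last by rewrite comb_affine c1 scale1r.
  by exists (c \o f); split=> // p ps; rewrite c0 // map_f.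
have E (p : V) : (c \o h \o f) p = c p by rewrite /= affine_cancel.
exists (c \o h); split.
- by move=> _ /mapP[p ps ->] /=; rewrite affine_cancel c0.
- by rewrite big_map -[RHS]c1; apply: eq_bigr => p _; exact: E.
- rewrite comb_affine (_ : comb _ _ = comb s c); last first.
    by apply: eq_bigr => p _; rewrite E.
  by under eq_bigr do rewrite [_ (f _)]E; rewrite c1 scale1r.
Qed.

Lemma indep_affine (s : seq V) : indep s -> indep (map f s).
Proof.
move=> [us ind]; split=> [|c]; first by rewrite map_inj_uniq.
rewrite big_map comb_affine => c0; rewrite c0 scale0r addr0 => e.
have {}e : comb s (c \o f) = 0 by rewrite -(mulKmx Au (comb _ _)) e mulmx0.
by move=> _ /mapP[p ps ->]; exact: (ind (c \o f)).
Qed.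

Lemma spans_affine s S : spans s S -> spans (map f s) (f @` S).
Proof.
by move=> [sz ind ->]; split; [rewrite size_map|exact: indep_affine|rewrite conv_affine].
Qed.

Lemma vertices_spans (s : seq V) S : spans s S -> vertices S = [set` s].
Proof.
move=> [sz ind ->]; apply/seteqP; split=> [x [p [pind pS] [i ->]]|x xs].
  apply: indep_conv_mem (affinely_independent_indep pind) _ _ _.
  - by case: ind.
  - rewrite pS hull_conv ?enum_setT -?enumT //; exact: affinely_independent_inj.
  - by rewrite map_f // mem_enum.
have szP : size s == n.+1 by apply/eqP.
pose t := Tuple szP.
have tE : [seq tnth t i | i <- enum 'I_n.+1] = s by rewrite map_tnth_enum.
have [tind tI] : affinely_independent (tnth t) /\ injective (tnth t).
  by apply: indep_affinely_independent; rewrite tE.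
exists (tnth t); first by split=> //; rewrite hull_conv // enum_setT -enumT tE.
by move: xs; rewrite /= -tE => /mapP[i _ ->]; exists i.
Qed.

Lemma is_face_affine (F S : set V) :
  is_simplex S -> is_face F S -> is_face (f @` F) (f @` S).
Proof.
move=> /spansP[s sS] /(spans_face _ sS)[P ->].
apply/(spans_face _ (spans_affine sS)); exists (P \o h).
rewrite -conv_affine; congr conv; rewrite filter_map.
by congr map; apply: eq_filter => p /=; rewrite affine_cancel.
Qed.

End AffineImages.

Section LinearImages.
Variables (R : realType) (n : nat).
Local Notation V := 'cV[R]_n.
Implicit Types (T : set (set V)) (g : 'M[int]_n).

Lemma intr_unitmx g : g \in unitmx -> map_mx intr g \in (unitmx : pred 'M[R]_n).
Proof. by move=> gu; rewrite unitmxE det_map_mx rmorph_unit // -unitmxE. Qed.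

Lemma int_vectorD (z w : 'cV[int]_n) :
  int_vector R (z + w) = int_vector R z + int_vector R w.
Proof. by rewrite /int_vector map_mxD. Qed.

Lemma int_vector_mul g z :
  int_vector R (g *m z) = map_mx intr g *m int_vector R z.
Proof. by rewrite /int_vector map_mxM. Qed.

Lemma linear_image_comp g h T :
  linear_image g (linear_image h T) = linear_image (g *m h) T.
Proof.
have E (S : set V) : [set map_mx intr g *m x | x in [set map_mx intr h *m x | x in S]]
    = [set map_mx intr (g *m h) *m x | x in S].
  by rewrite image_comp; apply: eq_imagel => x _; rewrite /= map_mxM mulmxA.
rewrite /linear_image image_comp; apply: eq_imagel => S _; exact: E.
Qed.

Lemma linear_image1 T : linear_image 1%:M T = T.
Proof.
rewrite /linear_image map_mx1 -[RHS]image_id; apply: eq_imagel => S _.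
by rewrite -[RHS]image_id; apply: eq_imagel => x _; rewrite mul1mx.
Qed.

Lemma linear_imageK g T : g \in unitmx ->
  linear_image (invmx g) (linear_image g T) = T.
Proof. by move=> gu; rewrite linear_image_comp mulVmx ?linear_image1. Qed.

Lemma linear_image_sub g T T' : T `<=` T' -> linear_image g T `<=` linear_image g T'.
Proof. exact: image_subset. Qed.

Lemma linear_image_affine g (S : set V) :
  [set map_mx intr g *m x | x in S] = (fun x => map_mx intr g *m x + 0) @` S.
Proof. by apply: eq_imagel => x _; rewrite addr0. Qed.

Lemma linear_image_partial g T : g \in unitmx ->
  partial_triangulation T -> partial_triangulation (linear_image g T).
Proof.
move=> gu [simp vert faces]; have Gu := intr_unitmx gu.
have GI : injective (fun x : V => map_mx intr g *m x).
  by move=> x y e; rewrite -(mulKmx Gu x) e mulKmx.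
split.
- move=> _ [S TS <-]; rewrite linear_image_affine; apply/spansP.
  by have /spansP[s sS] := simp _ TS; exists (map (fun x => map_mx intr g *m x + 0) s); apply: spans_affine.
- apply/seteqP; split=> [x [_ [S TS <-]]|_ [z _ <-]].
    have /spansP[s sS] := simp _ TS.
    rewrite linear_image_affine (vertices_spans (spans_affine 0 Gu sS)) /=.
    case/mapP => y ys ->.
    have : (\bigcup_(S in T) vertices S) y by exists S => //; rewrite (vertices_spans sS).
    rewrite vert => -[z _ <-]; exists (g *m z) => //.
    by rewrite addr0 int_vector_mul.
  have : (\bigcup_(S in T) vertices S) (int_vector R (invmx g *m z)).
    by rewrite vert; exists (invmx g *m z).
  case=> S TS; have /spansP[s sS] := simp _ TS; rewrite (vertices_spans sS) => zs.
  exists [set map_mx intr g *m x | x in S]; first by exists S.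
  rewrite linear_image_affine (vertices_spans (spans_affine 0 Gu sS)) /=.
  apply/mapP; exists (int_vector R (invmx g *m z)) => //.
  by rewrite addr0 -int_vector_mul mulKVmx.
- move=> _ _ [S1 T1 <-] [S2 T2 <-].
  have [f1 f2] := faces _ _ T1 T2.
  have -> : [set map_mx intr g *m x | x in S1] `&` [set map_mx intr g *m x | x in S2]
     = [set map_mx intr g *m x | x in S1 `&` S2].
    apply/seteqP; split=> [_ [[x S1x <-] [y S2y /GI yx]]|_ [x [S1x S2x] <-]].
      by exists x => //; split=> //; rewrite -yx.
    by split; exists x.
  by rewrite !linear_image_affine; split; apply: is_face_affine => //; exact: simp.
Qed.

Lemma linear_image_triangulation g T : g \in unitmx ->
  triangulation T -> triangulation (linear_image g T).
Proof.
move=> gu [pT cov]; split; first exact: linear_image_partial.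
apply/seteqP; split=> // x _; have Gu := intr_unitmx gu.
have : (\bigcup_(S in T) S) (invmx (map_mx intr g) *m x) by rewrite cov.
case=> S TS Sx; exists [set map_mx intr g *m x | x in S]; first by exists S.
by exists (invmx (map_mx intr g) *m x) => //; rewrite mulKVmx.
Qed.

Lemma linear_image_periodic g T : g \in unitmx ->
  periodic T -> periodic (linear_image g T).
Proof.
move=> gu per _ [z _ <-].
have E (S : set V) : [set x + int_vector R z | x in [set map_mx intr g *m x | x in S]]
  = [set map_mx intr g *m x | x in [set x + int_vector R (invmx g *m z) | x in S]].
  rewrite !image_comp; apply: eq_imagel => x _ /=.
  by rewrite mulmxDr -int_vector_mul mulKVmx.
have {2}<- := per _ (ex_intro2 _ _ (invmx g *m z) I erefl).
rewrite /translate /linear_image !image_comp.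
by apply: eq_imagel => S _; exact: E.
Qed.

(* A point in the relative interior of a simplex of T lies in no other simplex
   of a partial triangulation containing T. *)
Lemma triangulation_maximal T T' :
  triangulation T -> partial_triangulation T' -> T `<=` T' -> T = T'.
Proof.
move=> [[simp _ _] cov] pT' sub; apply/seteqP; split=> // S T'S.
have [simp' _ _] := pT'.
have /spansP[s [sz ind SE]] := simp' _ T'S.
pose w : V -> R := fun=> (n.+1)%:R^-1.
have w1 : \sum_(p <- s) w p = 1.
  by rewrite /w big_const_seq count_predT sz iter_addr_0 -[X in X = _]mulr_natr mulVf // pnatr_eq0.
have : (\bigcup_(S in T) S) (comb s w) by rewrite cov.
case=> S2 TS2; have /spansP[s2 [sz2 ind2 S2E]] := simp _ TS2.
rewrite S2E => -[b [b0 b1 bE]].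
suff ss2 : s =i s2.
  by rewrite SE (conv_eqi _ _ ss2) -?S2E //; [case: ind|case: ind2].
have sub2 : {subset s <= s2}.
  move=> p ps; have w0 q : 0 < w q by rewrite invr_gt0 ltr0n.
  have [|||||] := carrier (a := w) pT' _ _ _ _ _ b0 w1 b1 bE ps (w0 p) => //.
  - by rewrite -SE.
  - by rewrite -S2E; exact: sub.
  - by move=> q _; rewrite ltW.
have [us _] := ind; have [us2 _] := ind2.
by have [] := uniq_min_size us sub2; rewrite sz sz2.
Qed.

End LinearImages.

End AffineGeometry.

Arguments Z.add : simpl never.
Arguments Z.sub : simpl never.
Arguments Z.mul : simpl never.
Arguments Z.opp : simpl never.

(* Under call by value, as in vm_compute, [&&] and [||] evaluate both sides. *)
Section LazyQuantifiers.
Variables (T : Type) (p : T -> bool).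

Fixpoint lall (s : seq T) : bool :=
  if s is x :: s' then if p x then lall s' else false else true.

Fixpoint lhas (s : seq T) : bool :=
  if s is x :: s' then if p x then true else lhas s' else false.

Lemma lallE s : lall s = all p s. Proof. by elim: s => //= x s ->. Qed.
Lemma lhasE s : lhas s = has p s. Proof. by elim: s => //= x s ->. Qed.
End LazyQuantifiers.

Lemma lallP (T : eqType) (p : pred T) s : reflect {in s, forall x, p x} (lall p s).
Proof. by rewrite lallE; exact: allP. Qed.

Lemma lhasP (T : eqType) (p : pred T) s : reflect (exists2 x, x \in s & p x) (lhas p s).
Proof. by rewrite lhasE; exact: hasP. Qed.

(** * Lattice points as quadruples of binary integers, on which computation is fast *)

Section Points.
Local Open Scope Z_scope.

Definition pt := (Z * Z * Z * Z)%type.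

Definition p0 : pt := (0, 0, 0, 0).

Definition padd (u v : pt) : pt :=
  let: (a, b, c, d) := u in let: (a', b', c', d') := v in
  (a + a', b + b', c + c', d + d').

Definition psub (u v : pt) : pt :=
  let: (a, b, c, d) := u in let: (a', b', c', d') := v in
  (a - a', b - b', c - c', d - d').

Definition pscale (k : Z) (v : pt) : pt :=
  let: (a, b, c, d) := v in (k * a, k * b, k * c, k * d).

Definition peqb (u v : pt) : bool :=
  let: (a, b, c, d) := u in let: (a', b', c', d') := v in
  (a =? a') && (b =? b') && (c =? c') && (d =? d').

Definition memp (v : pt) (l : seq pt) := lhas (peqb v) l.

Definition zsum (a : seq Z) : Z := foldr Z.add 0 a.

Fixpoint zcomb (a : seq Z) (X : seq pt) : pt :=
  match a, X with
  | k :: a', x :: X' => padd (pscale k x) (zcomb a' X')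
  | _, _ => p0
  end.

End Points.

Ltac pt_cases := repeat match goal with v : pt |- _ => destruct v as [[[? ?] ?] ?] end.

Section Coordinates.
Import Order.TTheory GRing.Theory Num.Theory.
Local Open Scope classical_set_scope.
Local Open Scope ring_scope.

Lemma peqbP u v : reflect (u = v) (peqb u v).
Proof.
pt_cases; rewrite /peqb; apply: (iffP idP) => [|[-> -> -> ->]].
  by move=> /andP[/andP[/andP[]]] /Z.eqb_eq -> /Z.eqb_eq -> /Z.eqb_eq -> /Z.eqb_eq ->.
by rewrite !Z.eqb_refl.
Qed.

Lemma mempP v (l : seq pt) : memp v l = (v \in l).
Proof.
rewrite /memp lhasE; elim: l => //= a l IH; rewrite inE IH; congr (_ || _).
by apply/idP/eqP => [/peqbP//|->]; apply/peqbP.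
Qed.

Definition co (v : pt) (i : nat) : Z :=
  let: (a, b, c, d) := v in nth 0%ZZ [:: a; b; c; d] i.

Definition vi (v : pt) : 'cV[int]_4 := \col_i int_of_Z (co v i).

Definition pv (z : 'cV[int]_4) : pt :=
  let f k := Z_of_int (z (inord k) 0) in (f 0%N, f 1%N, f 2%N, f 3%N).

Lemma pvK : cancel pv vi.
Proof.
move=> z; apply/matrixP => i j; rewrite mxE ord1.
case: i => -[|[|[|[|//]]]] Hi; rewrite /pv /= Z_of_intK; congr (z _ _);
  by apply: val_inj; rewrite /= inordK.
Qed.

Lemma viK : cancel vi pv.
Proof. by move=> v; pt_cases; rewrite /pv !mxE !inordK //= !int_of_ZK. Qed.

Lemma vi_inj : injective vi. Proof. exact: can_inj viK. Qed.

Lemma viD u v : vi (padd u v) = vi u + vi v.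
Proof.
apply/matrixP => i j; rewrite !mxE -raddfD; pt_cases.
by case: i => -[|[|[|[|//]]]] Hi.
Qed.

Lemma viB u v : vi (psub u v) = vi u - vi v.
Proof.
apply/matrixP => i j; rewrite !mxE -raddfB; pt_cases.
by case: i => -[|[|[|[|//]]]] Hi.
Qed.

Lemma viZ k v : vi (pscale k v) = int_of_Z k *: vi v.
Proof.
apply/matrixP => i j; rewrite !mxE -rmorphM; pt_cases.
by case: i => -[|[|[|[|//]]]] Hi.
Qed.

Lemma vi0 : vi p0 = 0.
Proof. by apply/matrixP => i j; rewrite !mxE; case: i => -[|[|[|[|//]]]] Hi. Qed.

Lemma paddC u v : padd u v = padd v u.
Proof. by apply: vi_inj; rewrite !viD addrC. Qed.
Lemma paddA u v w : padd u (padd v w) = padd (padd u v) w.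
Proof. by apply: vi_inj; rewrite !viD addrA. Qed.
Lemma psubK u v : padd (psub u v) v = u.
Proof. by apply: vi_inj; rewrite viD viB subrK. Qed.
Lemma paddK u v : psub (padd u v) v = u.
Proof. by apply: vi_inj; rewrite viB viD addrK. Qed.
Lemma paddI t : injective (fun v => padd v t).
Proof. by move=> u v e; rewrite -(paddK u t) e paddK. Qed.

Section RealPoints.
Variable R : realType.
Local Notation V := 'cV[R]_4.

Definition zR (z : Z) : R := (int_of_Z z)%:~R.

Lemma zRD a b : zR (a + b)%ZZ = zR a + zR b.
Proof. by rewrite /zR -intrD -raddfD. Qed.
Lemma zRM a b : zR (a * b)%ZZ = zR a * zR b.
Proof. by rewrite /zR -intrM -rmorphM. Qed.
Lemma zR0 : zR 0 = 0. Proof. by []. Qed.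
Lemma zR_le a b : (zR a <= zR b) = (a <=? b)%ZZ.
Proof.
rewrite /zR ler_int -subr_ge0.
have -> : int_of_Z b - int_of_Z a = int_of_Z (b - a)%ZZ by rewrite -raddfB.
apply/idP/Z.leb_spec0; case E : (b - a)%ZZ => [|p|p] //= h; lia.
Qed.
Lemma zR_lt a b : (zR a < zR b) = (a <? b)%ZZ.
Proof. by rewrite ltNge zR_le Z.ltb_antisym. Qed.
Lemma zR_inj : injective zR.
Proof. by move=> a b /intr_inj e; rewrite -(int_of_ZK a) e int_of_ZK. Qed.

Definition vR (v : pt) : V := int_vector R (vi v).

Lemma vR_inj : injective vR.
Proof.
move=> u v /matrixP e; apply: vi_inj; apply/matrixP => i j.
by have := e i j; rewrite !mxE => /intr_inj.
Qed.
Lemma vRD u v : vR (padd u v) = vR u + vR v.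
Proof. by rewrite /vR viD int_vectorD. Qed.
Lemma vRB u v : vR (psub u v) = vR u - vR v.
Proof. by rewrite /vR viB /int_vector map_mxB. Qed.
Lemma vRZ k v : vR (pscale k v) = zR k *: vR v.
Proof. by apply/matrixP => i j; rewrite /vR viZ !mxE rmorphM. Qed.
Lemma vR0 : vR p0 = 0.
Proof. by rewrite /vR vi0 /int_vector map_mx0. Qed.
Lemma vR_lattice v : @integer_lattice R 4 (vR v).
Proof. by exists (vi v). Qed.
Lemma latticeP (x : V) : integer_lattice x -> exists v, x = vR v.
Proof. by move=> [z _ <-]; exists (pv z); rewrite /vR pvK. Qed.

Lemma big_index (W : nmodType) (s : seq V) (G : nat -> V -> W) : uniq s ->
  \sum_(v <- s) G (index v s) v = \sum_(i < size s) G i (nth 0 s i).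
Proof.
move=> us; rewrite (big_nth 0) big_mkord; apply: eq_bigr => i _.
by rewrite index_uniq.
Qed.

Lemma zR_sum a : zR (zsum a) = \sum_(i < size a) zR (nth 0%ZZ a i).
Proof. by elim: a => [|k a IH]; rewrite ?big_ord0 // big_ord_recl /= zRD IH. Qed.

Lemma vR_comb a X : size a = size X ->
  vR (zcomb a X) = \sum_(i < size X) zR (nth 0%ZZ a i) *: nth 0 (map vR X) i.
Proof.
elim: a X => [|k a IH] [|x X] //=; first by rewrite big_ord0 vR0.
by move=> [sz]; rewrite big_ord_recl /= vRD vRZ IH.
Qed.

Lemma indep_nth (s : seq V) (c : nat -> R) : indep s ->
  \sum_(i < size s) c i = 0 -> \sum_(i < size s) c i *: nth 0 s i = 0 ->
  forall i, (i < size s)%N -> c i = 0.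
Proof.
move=> [us ind] c1 c2 i si; rewrite -{1}(index_uniq 0 si us).
apply: (ind (fun v => c (index v s))) (mem_nth _ si).
  by rewrite (big_index (fun i _ => c i)).
by rewrite /comb (big_index (fun i v => c i *: v)).
Qed.

End RealPoints.

(** * Simplices of a periodic partial triangulation as lists of lattice points *)

Section LatticeSimplices.
Variables (R : realType) (PT : set (set 'cV[R]_4)).
Local Notation vR := (vR R).
Local Notation zR := (zR R).
Hypotheses (pT : partial_triangulation PT) (perT : periodic PT).

Definition inK (X : seq pt) :=
  [/\ size X = 5%N, indep (map vR X) & PT (conv (map vR X))].

Lemma K_cover S : PT S -> exists2 X, inK X & S = conv (map vR X).
Proof.
move=> TS; have [simp vert _] := pT.
have /spansP[s sS] := simp _ TS; have [sz ind SE] := sS.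
have /choice[f fP] x : exists v, x \in s -> x = vR v.
  have [xs|] := boolP (x \in s); last by exists p0.
  have : integer_lattice x.
    by rewrite -vert; exists S => //; rewrite (vertices_spans sS).
  by move=> /latticeP[v ->]; exists v.
have sE : s = map vR (map f s).
  by rewrite -map_comp -[LHS]map_id; apply/eq_in_map => x /fP.
exists (map f s); last by rewrite -sE.
by split; rewrite ?size_map -?sE // -SE.
Qed.

Lemma K_perm X Y : inK X -> perm_eq X Y -> inK Y.
Proof.
move=> [sz ind TX] XY; have us := ind.1.
have uY : uniq (map vR Y) by rewrite -(perm_uniq (perm_map vR XY)).
have e : map vR X =i map vR Y by exact/perm_mem/perm_map.
by split; rewrite -?(perm_size XY) // -?(conv_eqi us uY e) //; apply: indep_eqi e ind.
Qed.

Lemma map_vR_trans t X :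
  map vR (map (padd^~ t) X) = map (fun x => 1%:M *m x + vR t) (map vR X).
Proof. by rewrite -!map_comp; apply: eq_map => x /=; rewrite vRD mul1mx. Qed.

Lemma K_trans t X : inK X -> inK (map (padd^~ t) X).
Proof.
move=> [sz ind TX]; rewrite /inK size_map map_vR_trans; split=> //.
  by apply: indep_affine => //; exact: unitmx1.
rewrite conv_affine ?unitmx1 // -(perT (vR_lattice R t)).
by exists (conv (map vR X)) => //; apply: eq_imagel => x _; rewrite mul1mx.
Qed.

Lemma K_size X : inK X -> size X = 5%N. Proof. by case. Qed.

Lemma K_uniq X : inK X -> uniq X.
Proof. by move=> [_ [u _] _]; exact: map_uniq u. Qed.

Lemma K_indep X c : inK X -> size c = 5%N -> zsum c = 0%ZZ -> zcomb c X = p0 ->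
  forall i, (i < 5)%N -> nth 0%ZZ c i = 0%ZZ.
Proof.
move=> [sz ind TX] sc c0 c1 i i5; apply: (@zR_inj R); rewrite zR0.
apply: (indep_nth (c := fun i => zR (nth 0%ZZ c i)) ind); rewrite size_map sz //.
  by have := zR_sum R c; rewrite c0 sc zR0 => <-.
by have := vR_comb R (etrans sc (esym sz)); rewrite c1 vR0 sz => <-.
Qed.

(** This is [carrier] with both weight lists multiplied by their common sum, so that only integers
    remain. *)
Lemma K_carrier X Y a b : inK X -> inK Y -> size a = 5%N -> size b = 5%N ->
  all (Z.leb 0) a -> all (Z.leb 0) b -> zsum a = zsum b -> (0 < zsum a)%ZZ ->
  zcomb a X = zcomb b Y ->
  forall i, (i < 5)%N -> (0 < nth 0%ZZ a i)%ZZ ->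
  exists j, [/\ (j < 5)%N, nth p0 X i = nth p0 Y j & nth 0%ZZ b j = nth 0%ZZ a i].
Proof.
move=> [szX indX TX] [szY indY TY] sa sb a0 b0 ab aN cab i i5 ai.
set N := zsum a in ab aN.
have Ngt : 0 < zR N by rewrite -zR0 zR_lt; apply/Z.ltb_spec0.
have Nnz : zR N != 0 by rewrite gt_eqF.
pose w (s : seq 'cV[R]_4) (l : seq Z) v := zR (nth 0%ZZ l (index v s)) / zR N.
have ge0 s l v : size l = 5%N -> size s = 5%N -> all (Z.leb 0) l -> v \in s -> 0 <= w s l v.
  move=> sl ss /allP l0 vs; apply: divr_ge0; last exact: ltW.
  by rewrite -zR0 zR_le; apply: l0; rewrite mem_nth // sl -ss index_mem.
have w1 s l : uniq s -> size l = 5%N -> size s = 5%N -> zsum l = N -> \sum_(v <- s) w s l v = 1.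
  move=> us sl ss lN; rewrite /w (big_index (fun i _ => zR (nth 0%ZZ l i) / zR N)) //.
  rewrite -mulr_suml ss; have := zR_sum R l; rewrite lN sl => <-.
  by rewrite divff.
have wc Z l : uniq (map vR Z) -> size l = 5%N -> size Z = 5%N ->
    comb (map vR Z) (w (map vR Z) l) = (zR N)^-1 *: vR (zcomb l Z).
  move=> us sl ss; rewrite /comb /w (big_index (fun i v => (zR (nth 0%ZZ l i) / zR N) *: v)) //.
  rewrite vR_comb ?sl ?ss // scaler_sumr size_map ss; apply: eq_bigr => k _.
  by rewrite scalerA mulrC.
have szX' : size (map vR X) = 5%N by rewrite size_map.
have szY' : size (map vR Y) = 5%N by rewrite size_map.
have uX := indX.1; have uY := indY.1.
have viX : vR (nth p0 X i) \in map vR X by rewrite map_f // mem_nth ?szX.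
have idx : index (vR (nth p0 X i)) (map vR X) = i.
  by rewrite -(nth_map _ 0) ?szX // index_uniq // szX'.
have [] := carrier pT (a := w (map vR X) a) (b := w (map vR Y) b) _ _ TX TY _ _ _ _ _ viX.
- by split.
- by split.
- by move=> v; apply: ge0.
- by move=> v; apply: ge0.
- exact: w1.
- exact: w1.
- by rewrite !wc // cab.
- by rewrite /w idx divr_gt0 // -zR0 zR_lt; apply/Z.ltb_spec0.
rewrite (mem_map (@vR_inj R)) => XY; rewrite /w idx => /(mulIf (invr_neq0 Nnz)) /zR_inj e.
have iY : (index (nth p0 X i) Y < 5)%N by rewrite -szY index_mem.
exists (index (nth p0 X i) Y); split=> //; first by rewrite nth_index.
by rewrite -e index_map //; exact: vR_inj.
Qed.

(** Cramer's rule for the matrix of edges at the first vertex: [D] is the absolute value of its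
    determinant, nonzero by affine independence, and [y] comes from the adjugate, corrected by the
    sign of the determinant. *)
Lemma K_rank X v : inK X ->
  exists D y, [/\ (0 < D)%ZZ, size y = 5%N, zsum y = 0%ZZ & zcomb y X = pscale D v].
Proof.
move=> [szX ind TX].
pose M : 'M[int]_4 := \matrix_(i, j) (vi (nth p0 X j.+1) - vi (nth p0 X 0)) i 0.
have M0 : \det M != 0.
  apply/eqP => dM.
  have : \det (map_mx intr M : 'M[R]_4)^T == 0 by rewrite det_tr det_map_mx dM.
  move=> /det0P[u u0 uM]; case/eqP: u0.
  pose c i := if i is j.+1 then u 0 (inord j) else - \sum_j u 0 j.
  have cE i : (i < 5)%N -> c i = 0.
    have s5 : size (map vR X) = 5%N by rewrite size_map.
    have -> : (5 = size (map vR X))%N by rewrite s5.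
    apply: (indep_nth ind); rewrite s5 big_ord_recl /=.
      by rewrite addrC; apply/eqP; rewrite subr_eq0; apply/eqP; apply: eq_bigr => j _; rewrite inord_val.
    rewrite scaleNr scaler_suml -sumrN -big_split /=.
    apply/matrixP => k l; rewrite ord1 summxE [RHS]mxE.
    have uMk := congr1 (fun m : 'rV_4 => m 0 k) uM; rewrite !mxE in uMk; rewrite -[RHS]uMk.
    apply: eq_bigr => j _; have j4 : (j < 4)%N := ltn_ord j.
    rewrite add0n /bump /= add1n inord_val !(nth_map p0) ?szX //.
    by rewrite !mxE intrD mulrDr mulrNz mulrN addrC.
  apply/matrixP => i j; rewrite ord1 mxE.
  by have := cE j.+1; rewrite ltnS ltn_ord /= inord_val => ->.
have [x0 [x1 [x2 [x3 [x4 XE]]]]] : exists x0 x1 x2 x3 x4, X = [:: x0; x1; x2; x3; x4].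
  by case: X szX {ind TX M M0} => [|? [|? [|? [|? [|? []]]]]] // _; do 5!eexists.
have MK a b c d :
    vi (zcomb [:: (- (a + b + c + d))%ZZ; a; b; c; d] X) = M *m vi (a, b, c, d).
  apply/matrixP => i j; rewrite ord1 XE /= !viD !viZ vi0 !mxE.
  rewrite !big_ord_recl big_ord0 !mxE XE /=.
  have -> : int_of_Z (- (a + b + c + d))%ZZ = - (int_of_Z a + int_of_Z b + int_of_Z c + int_of_Z d).
    by rewrite -!raddfD -raddfN.
  by ring.
have [q qE] : exists q, M *m vi q = `|\det M| *: vi v.
  exists (pv (Num.sg (\det M) *: (\adj M *m vi v))).
  rewrite pvK -scalemxAr mulmxA mul_mx_adj normrEsg.
  by rewrite mul_scalar_mx scalerA.
case: q qE => [[[a b] c] d] qE.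
exists (Z_of_int `|\det M|), [:: (- (a + b + c + d))%ZZ; a; b; c; d]; split=> //.
- have : 0 < `|\det M| by rewrite normr_gt0.
  by case: `|\det M| => -[].
- by rewrite /zsum /=; lia.
- by apply: vi_inj; rewrite MK qE viZ Z_of_intK.
Qed.
End LatticeSimplices.

End Coordinates.

(** * Integer weight lists and abstract families of simplices *)

Definition zadd (a b : seq Z) : seq Z := [seq (p.1 + p.2)%ZZ | p <- zip a b].
Definition zscale (k : Z) (a : seq Z) : seq Z := [seq (k * x)%ZZ | x <- a].
Definition dl (i : nat) : seq Z := mkseq (fun m => if m == i then 1%ZZ else 0%ZZ) 5.

Ltac pt_eq := apply: f_equal2; [apply: f_equal2; [apply: f_equal2|]|].

Lemma padd0 v : padd v p0 = v.
Proof. by pt_cases; rewrite /=; pt_eq; lia. Qed.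
Lemma pt_scale_inj k u v : (0 < k)%ZZ -> pscale k u = pscale k v -> u = v.
Proof.
pt_cases => k0 /= [e1 e2 e3 e4].
by pt_eq; apply: (Z.mul_reg_l _ _ k) (Z.neq_sym _ _ (Z.lt_neq _ _ k0)) _.
Qed.

Lemma size_zadd a b : size a = 5%N -> size b = 5%N -> size (zadd a b) = 5%N.
Proof. by move=> sa sb; rewrite size_map size_zip sa sb. Qed.
Lemma size_zscale k a : size (zscale k a) = size a.
Proof. by rewrite size_map. Qed.
Lemma size_dl i : size (dl i) = 5%N. Proof. by rewrite size_mkseq. Qed.

Lemma zsum_add a b : size a = size b -> zsum (zadd a b) = (zsum a + zsum b)%ZZ.
Proof.
elim: a b => [|x a IH] [|y b] //= [sz]; have := IH _ sz.
by rewrite /zadd /zsum /= => ->; lia.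
Qed.
Lemma zsum_scale k a : zsum (zscale k a) = (k * zsum a)%ZZ.
Proof. by elim: a => [|x a IH] /=; [lia|rewrite IH; lia]. Qed.
Lemma zcomb_add a b X : size a = size b ->
  zcomb (zadd a b) X = padd (zcomb a X) (zcomb b X).
Proof.
elim: a b X => [|x a IH] [|y b] [|v X] //= [sz].
rewrite (IH _ X sz); move: (zcomb a X) (zcomb b X) => u w.
by pt_cases; rewrite /=; pt_eq; lia.
Qed.
Lemma zcomb_scale k a X : zcomb (zscale k a) X = pscale k (zcomb a X).
Proof.
elim: a X => [|x a IH] [|v X] /=; try by pt_eq; lia.
rewrite IH; move: (zcomb a X) => u.
by pt_cases; rewrite /=; pt_eq; lia.
Qed.
Lemma zsum_dl i : (i < 5)%N -> zsum (dl i) = 1%ZZ.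
Proof. by case: i => [|[|[|[|[|]]]]]. Qed.
Lemma zcomb_dl i X : size X = 5%N -> (i < 5)%N -> zcomb (dl i) X = nth p0 X i.
Proof.
case: X => [|x0 [|x1 [|x2 [|x3 [|x4 []]]]]] // _.
by case: i => [|[|[|[|[|]]]]] // _; rewrite /=; pt_cases; rewrite /=; pt_eq; lia.
Qed.
Lemma nth_zadd a b i : size a = 5%N -> size b = 5%N -> (i < 5)%N ->
  nth 0%ZZ (zadd a b) i = (nth 0 a i + nth 0 b i)%ZZ.
Proof.
by move=> sa sb i5; rewrite (nth_map (0, 0)%ZZ) ?size_zip ?sa ?sb // nth_zip ?sa ?sb.
Qed.
Lemma nth_zscale k a i : nth 0%ZZ (zscale k a) i = (k * nth 0 a i)%ZZ.
Proof.
have [ia|ia] := ltnP i (size a); first by rewrite (nth_map 0%ZZ).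
by rewrite !nth_default ?size_map //; lia.
Qed.
Lemma nth_dl i m : (m < 5)%N -> nth 0%ZZ (dl i) m = if m == i then 1%ZZ else 0%ZZ.
Proof. by move=> m5; rewrite nth_mkseq. Qed.

Lemma zcomb_trans a t X : size a = size X ->
  zcomb a (map (padd^~ t) X) = padd (zcomb a X) (pscale (zsum a) t).
Proof.
elim: a X => [|k a IH] [|v X] //=; first by move=> _; pt_cases; rewrite /=; pt_eq; lia.
move=> [sz]; rewrite IH // /zsum /=; move: (zcomb a X) (foldr _ _ _) => u z.
by pt_cases; rewrite /=; pt_eq; lia.
Qed.

Lemma padd_fix u v : u = padd u v -> v = p0.
Proof. by pt_cases => -[*]; pt_eq; lia. Qed.

Ltac pt_lia := clear; intros; pt_cases; cbv [p0]; rewrite /=; pt_eq; lia.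

(** The interface between geometry and combinatorics: [fam_trans] is periodicity, [fam_carrier] the
    face-to-face condition, and [fam_rank] says that a simplex spans the whole space over the
    rationals. *)
Record simplex_family (K : seq pt -> Prop) : Prop := SimplexFamily {
  fam_size : forall X, K X -> size X = 5%N;
  fam_uniq : forall X, K X -> uniq X;
  fam_perm : forall X Y, K X -> perm_eq X Y -> K Y;
  fam_trans : forall t X, K X -> K (map (padd^~ t) X);
  fam_indep : forall X c, K X -> size c = 5%N -> zsum c = 0%ZZ ->
    zcomb c X = p0 -> forall i, (i < 5)%N -> nth 0%ZZ c i = 0%ZZ;
  fam_carrier : forall X Y a b, K X -> K Y ->
    size a = 5%N -> size b = 5%N -> all (Z.leb 0) a -> all (Z.leb 0) b ->
    zsum a = zsum b -> (0 < zsum a)%ZZ -> zcomb a X = zcomb b Y ->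
    forall i, (i < 5)%N -> (0 < nth 0%ZZ a i)%ZZ ->
    exists j, [/\ (j < 5)%N, nth p0 X i = nth p0 Y j & nth 0%ZZ b j = nth 0%ZZ a i];
  fam_rank : forall X v, K X ->
    exists D y, [/\ (0 < D)%ZZ, size y = 5%N, zsum y = 0%ZZ & zcomb y X = pscale D v]
}.

(** * Barycentric residues and unimodularity *)

Section Combinatorics.
Variables (K : seq pt -> Prop) (HK : simplex_family K).
Let Ksize := fam_size HK.
Let Ktrans := fam_trans HK.
Let Kindep := fam_indep HK.
Let Kcarrier := fam_carrier HK.

(** Otherwise x_i + x_l - x_j - x_k = 0 would be a nontrivial affine dependency. *)
Lemma Kparallelogram X i j k l : K X ->
  (i < 5)%N -> (j < 5)%N -> (k < 5)%N -> (l < 5)%N ->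
  padd (nth p0 X i) (nth p0 X l) = padd (nth p0 X j) (nth p0 X k) ->
  i = j \/ i = k.
Proof.
move=> KX i5 j5 k5 l5 e.
pose c := zadd (zadd (dl i) (dl l)) (zscale (-1) (zadd (dl j) (dl k))).
have sc : size c = 5%N by rewrite size_zadd ?size_zscale ?size_zadd ?size_dl.
have := Kindep KX sc; rewrite /c zsum_add ?zsum_scale ?zsum_add ?zsum_dl ?size_zscale ?size_zadd ?size_dl //.
rewrite zcomb_add ?zcomb_scale ?zcomb_add ?zcomb_dl ?size_zscale ?size_zadd ?size_dl ?(Ksize KX) //.
rewrite e => /(_ erefl) h; have {}h : forall i0 : nat, (i0 < 5)%N -> nth 0%ZZ c i0 = 0%ZZ.
  by apply: h; move: (padd (nth p0 X j) _) => u; clear; pt_cases; rewrite /=; pt_eq; lia.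
have := h i i5; rewrite nth_zadd ?nth_zscale ?nth_zadd ?nth_dl ?size_zscale ?size_zadd ?size_dl // eqxx.
by case: eqP => [?|_]; case: eqP => [?|?]; case: eqP => [?|?]; try lia; auto.
Qed.

(** Let B be the set of indices whose flag is true. Moving D x_i for i in B across the relation y X
    = D t expresses one point twice: over X with weights y_i off B, and over the translate X + t'
    with weights D - y_i on B. Both totals are [A]. When A <= D the carriers of the two expressions
    can be compared, and they match only if y = 0. *)
Lemma residue_bound x0 x1 x2 x3 x4 D t y0 y1 y2 y3 y4 (b0 b1 b2 b3 b4 : bool) :
  let X := [:: x0; x1; x2; x3; x4] in let y := [:: y0; y1; y2; y3; y4] in
  let A := ((if b0 then 0 else y0) + (if b1 then 0 else y1) +
    (if b2 then 0 else y2) + (if b3 then 0 else y3) + (if b4 then 0 else y4))%ZZ in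
  K X -> (0 < D)%ZZ ->
  (0 <= y0 < D /\ 0 <= y1 < D /\ 0 <= y2 < D /\ 0 <= y3 < D /\ 0 <= y4 < D)%ZZ ->
  zcomb y X = pscale D t ->
  (y0 + y1 + y2 + y3 + y4 = Z.of_nat (b0 + b1 + b2 + b3 + b4) * D)%ZZ ->
  (A <= D)%ZZ -> (y0 = 0 /\ y1 = 0 /\ y2 = 0 /\ y3 = 0 /\ y4 = 0)%ZZ.
Proof.
move=> X y A KX D0 yD yt ys AD.
pose bs := [:: b0; b1; b2; b3; b4].
pose f (e : bool) (x : pt) := if e then pscale (-1) x else p0.
pose t' := padd t (padd (f b0 x0) (padd (f b1 x1) (padd (f b2 x2) (padd (f b3 x3) (f b4 x4))))).
(* The missing weight D - A is spread evenly over the five vertices on both sides; the factor 5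
   keeps the weights integral, with both sums equal to 5 D. *)
pose ga (e : bool) z := ((if e then 0 else 5 * z) + (D - A))%ZZ.
pose gb (e : bool) z := ((if e then 5 * (D - z) else 0) + (D - A))%ZZ.
pose a := [:: ga b0 y0; ga b1 y1; ga b2 y2; ga b3 y3; ga b4 y4].
pose b := [:: gb b0 y0; gb b1 y1; gb b2 y2; gb b3 y3; gb b4 y4].
have sa : (zsum a = 5 * D)%ZZ.
  by rewrite /a /ga /= /A; clear; case: b0 b1 b2 b3 b4 => -[] [] [] []; lia.
have sb : (zsum b = 5 * D)%ZZ.
  rewrite /b /gb /=; move: ys; rewrite /A; clear.
  by case: b0 b1 b2 b3 b4 => -[] [] [] [] /=; lia.
have ab : zcomb a X = zcomb b (map (padd^~ t') X).
  rewrite zcomb_trans // sb; move: yt; rewrite /a /b /t' /X /y /ga /gb /f.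
  move: (D - A)%ZZ => s; clear; pt_cases; rewrite /= => -[e1 e2 e3 e4].
  by case: b0 b1 b2 b3 b4 => -[] [] [] [] /=; pt_eq; lia.

have [s0 [ge0a ge0b]] : (0 <= D - A)%ZZ /\ all (Z.leb 0) a /\ all (Z.leb 0) b.
  split; first lia.
  have : (0 <= D - A)%ZZ by lia.
  rewrite /a /b /ga /gb; move: (D - A)%ZZ yD; clear => s yD s0.
  by split; rewrite /=; repeat (apply/andP; split); rewrite ?andbT //; apply/Z.leb_spec0;
    case: ifP => _; lia.
have car := Kcarrier KX (Ktrans t' KX) (erefl : size a = 5%N) (erefl : size b = 5%N) ge0a ge0b.
have {}car i : (i < 5)%N -> (0 < nth 0%ZZ a i)%ZZ -> exists j, [/\ (j < 5)%N,
    nth p0 X i = padd (nth p0 X j) t' & nth 0%ZZ b j = nth 0%ZZ a i].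
  have eab : zsum a = zsum b by rewrite sa sb.
  have pab : (0 < zsum a)%ZZ by rewrite sa; lia.
  move=> i5 ai; have [j [j5 jX jb]] := car eab pab ab i i5 ai.
  by exists j; split=> //; rewrite jX (nth_map p0).
have nA i : nth 0%ZZ a i = (if (i < 5)%N then (if nth false bs i then 0 else 5 * nth 0 y i) + (D - A) else 0)%ZZ.
  by case: i => [|[|[|[|[|i]]]]] //; rewrite nth_default.
have nB i : nth 0%ZZ b i = (if (i < 5)%N then (if nth false bs i then 5 * (D - nth 0 y i) else 0) + (D - A) else 0)%ZZ.
  by case: i => [|[|[|[|[|i]]]]] //; rewrite nth_default.
have yi i : (i < 5)%N -> (0 <= nth 0 y i < D)%ZZ.
  by move: yD; case: i => [|[|[|[|[|i]]]]] //=; clear; lia.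
have [sA|sA] : (D - A = 0 \/ 0 < D - A)%ZZ by lia.
  (* Case A = D: each y_i is below D, so at least two vertices off B carry weight. Both are
     translates by t' of vertices of X, and the resulting parallelogram forces index i to be matched
     with itself; but i has weight 0 in [b]. *)
  pose P i := nth false bs i = false /\ (0 < nth 0 y i)%ZZ.
  have PN i : (i < 5)%N -> ~ P i -> (if nth false bs i then 0 else nth 0 y i)%ZZ = 0%ZZ.
    move=> /yi yi0 nP; case E : (nth false bs i) => //.
    have [//|?] : (nth 0 y i = 0 \/ 0 < nth 0 y i)%ZZ by lia.
    by case: nP.
  have [i [i5 Pi]] : exists i, (i < 5)%N /\ P i.
    apply: contrapT => nP; have tm j (j5 : (j < 5)%N) := PN j j5 (fun Pj => nP (ex_intro _ j (conj j5 Pj))).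
    by have := (tm 0 isT, tm 1 isT, tm 2 isT, tm 3 isT, tm 4 isT)%N => /= -[[[[]]]]; rewrite /A in sA *; lia.
  have [j [j5 Pj ij]] : exists j, [/\ (j < 5)%N, P j & i <> j].
    apply: contrapT => nP.
    have tm j : (j < 5)%N -> i != j -> (if nth false bs j then 0 else nth 0 y j)%ZZ = 0%ZZ.
      by move=> j5 /eqP ij; apply: PN => // Pj; apply: nP; exists j.
    rewrite /A in sA.
    have := yi i i5; move: sA (tm 0 isT) (tm 1 isT) (tm 2 isT) (tm 3 isT) (tm 4 isT)%N.
    case: Pi => bi _; move: i5 bi.
    case: i {tm nP} => [|[|[|[|[|i]]]]] // _ /= -> yi0 s t0 t1 t2 t3 t4;
      try specialize (t0 isT); try specialize (t1 isT); try specialize (t2 isT);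
      try specialize (s isT); try specialize (t3 isT); try specialize (t4 isT);
      clear -yi0 s t0 t1 t2 t3 t4; lia.
  have ai k : (k < 5)%N -> P k -> (0 < nth 0%ZZ a k)%ZZ.
    by move=> k5 [kb ky]; rewrite nA k5 kb; lia.
  have [i' [i'5 iX ibE]] := car i i5 (ai _ i5 Pi).
  have [j' [j'5 jX jbE]] := car j j5 (ai _ j5 Pj).
  have [||//] := @Kparallelogram X i i' j j' KX i5 i'5 j5 j'5 _.
    rewrite iX jX; move: (nth p0 X i') (nth p0 X j') t' {ab car iX jX}; pt_lia.
  move=> ii'; have := ai _ i5 Pi; rewrite -ibE -ii' nB i5; case: Pi => -> _.
  by lia.
(* Case A < D: every weight is positive, so every vertex of X is a vertex of X + t'. Following the
   match twice gives a degenerate parallelogram, whence t' = 0, and y with D subtracted on B is an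
   affine dependency. *)
have ap i : (i < 5)%N -> (0 < nth 0%ZZ a i)%ZZ.
  by move=> i5; rewrite nA i5; have := yi i i5; case: ifP => _; lia.
have [j [j5 jX _]] := car 0 isT (ap 0 isT).
have [k [k5 kX _]] := car j j5 (ap j j5).
have j0 : 0%N = j.
  have [||//] := @Kparallelogram X 0 j j k KX isT j5 j5 k5 _ => //.
  rewrite jX {2}kX; move: (nth p0 X j) (nth p0 X k) t' {ab car jX kX}; pt_lia.
have t0 : t' = p0.
  by apply: (@padd_fix (nth p0 X 0)); rewrite {2}j0.
pose gc (e : bool) z := (z - (if e then D else 0))%ZZ.
pose c := [:: gc b0 y0; gc b1 y1; gc b2 y2; gc b3 y3; gc b4 y4].
have c0 : zsum c = 0%ZZ.
  by move: ys; rewrite /c /gc; clear; case: b0 b1 b2 b3 b4 => -[] [] [] [] /=; lia.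
have cX : zcomb c X = p0.
  move: (congr1 (pscale D) t0) yt; rewrite /t' /c /gc /X /y /f /p0; clear.
  by pt_cases; case: b0 b1 b2 b3 b4 => -[] [] [] []; rewrite /=;
    move=> [t1 t2 t3 t4] [e1 e2 e3 e4]; pt_eq; lia.
have ci := Kindep KX (erefl : size c = 5%N) c0 cX.
have := (ci 0 isT, ci 1 isT, ci 2 isT, ci 3 isT, ci 4 isT)%N => /= -[[[[]]]].
move: yD; rewrite /gc; clear.
by case: b0 b1 b2 b3 b4 => -[] [] [] []; lia.
Qed.
End Combinatorics.

Section Unimodular.
Variables (K : seq pt -> Prop) (HK : simplex_family K).

Lemma fam_list X : K X -> exists x0 x1 x2 x3 x4, X = [:: x0; x1; x2; x3; x4].
Proof.
move=> /(fam_size HK); case: X => [|? [|? [|? [|? [|? []]]]]] // _; do 5!eexists; reflexivity.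
Qed.

(* Barycentric residues of lattice points: Lemma residue_bound leaves only the
   levels s = 2, 3, and doubling a residue vector of either level leads out of both. *)
Lemma no_residue x0 x1 x2 x3 x4 D t y0 y1 y2 y3 y4 s :
  let X := [:: x0; x1; x2; x3; x4] in let y := [:: y0; y1; y2; y3; y4] in
  K X -> (0 < D)%ZZ ->
  (0 <= y0 < D /\ 0 <= y1 < D /\ 0 <= y2 < D /\ 0 <= y3 < D /\ 0 <= y4 < D)%ZZ ->
  zcomb y X = pscale D t -> (y0 + y1 + y2 + y3 + y4 = s * D)%ZZ ->
  (y0 = 0 /\ y1 = 0 /\ y2 = 0 /\ y3 = 0 /\ y4 = 0)%ZZ.
Proof.
move=> X y KX D0.
pose R (z : Z * Z * Z * Z * Z) := let: (z0, z1, z2, z3, z4) := z in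
 ((z0 = 0 /\ z1 = 0 /\ z2 = 0 /\ z3 = 0 /\ z4 = 0) \/
  (z0 + z1 + z2 + z3 + z4 = 2 * D /\
   z0 + z1 < D /\ z0 + z2 < D /\ z0 + z3 < D /\ z0 + z4 < D /\ z1 + z2 < D /\
   z1 + z3 < D /\ z1 + z4 < D /\ z2 + z3 < D /\ z2 + z4 < D /\ z3 + z4 < D) \/
  (z0 + z1 + z2 + z3 + z4 = 3 * D /\
   D < z0 + z1 /\ D < z0 + z2 /\ D < z0 + z3 /\ D < z0 + z4 /\ D < z1 + z2 /\
   D < z1 + z3 /\ D < z1 + z4 /\ D < z2 + z3 /\ D < z2 + z4 /\ D < z3 + z4))%ZZ.
have key z0 z1 z2 z3 z4 u s' : 
  (0 <= z0 < D /\ 0 <= z1 < D /\ 0 <= z2 < D /\ 0 <= z3 < D /\ 0 <= z4 < D)%ZZ ->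
  zcomb [:: z0; z1; z2; z3; z4] X = pscale D u -> (z0 + z1 + z2 + z3 + z4 = s' * D)%ZZ ->
  R (z0, z1, z2, z3, z4).
  move=> zD zu zs.
  have rb b0 b1 b2 b3 b4 := @residue_bound K HK x0 x1 x2 x3 x4 D u z0 z1 z2 z3 z4 b0 b1 b2 b3 b4 KX D0 zD zu.
  (* Each entry is below D, so the level is at most 4. Taking B with as many elements as the level,
     [residue_bound] eliminates levels 1 and 4. At levels 2 and 3 it compares D with the sum of a
     pair: B is the pair at level 2, its complement at level 3. *)
  have [sE|[sE|[sE|[sE|sE]]]] : (s' = 0 \/ s' = 1 \/ s' = 2 \/ s' = 3 \/ s' = 4)%ZZ by nia.
  - by left; subst s'; clear -zs zD; lia.
  - subst s'; left; apply: (rb true false false false false zs); rewrite /=; lia.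
  - have nz : ~ (z0 = 0 /\ z1 = 0 /\ z2 = 0 /\ z3 = 0 /\ z4 = 0)%ZZ by subst s'; lia.
    right; left; subst s'.
    have e01 := rb true true false false false zs; have e02 := rb true false true false false zs.
    have e03 := rb true false false true false zs; have e04 := rb true false false false true zs.
    have e12 := rb false true true false false zs; have e13 := rb false true false true false zs.
    have e14 := rb false true false false true zs; have e23 := rb false false true true false zs.
    have e24 := rb false false true false true zs; have e34 := rb false false false true true zs.
    move: e01 e02 e03 e04 e12 e13 e14 e23 e24 e34.
    rewrite /= => e01 e02 e03 e04 e12 e13 e14 e23 e24 e34.
    by repeat split; first lia; apply/Z.nle_gt => h; apply: nz;
      first [apply: e01; lia|apply: e02; lia|apply: e03; lia|apply: e04; lia|apply: e12; lia
            |apply: e13; lia|apply: e14; lia|apply: e23; lia|apply: e24; lia|apply: e34; lia].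
  - have nz : ~ (z0 = 0 /\ z1 = 0 /\ z2 = 0 /\ z3 = 0 /\ z4 = 0)%ZZ by subst s'; lia.
    right; right; subst s'.
    have e01 := rb false false true true true zs; have e02 := rb false true false true true zs.
    have e03 := rb false true true false true zs; have e04 := rb false true true true false zs.
    have e12 := rb true false false true true zs; have e13 := rb true false true false true zs.
    have e14 := rb true false true true false zs; have e23 := rb true true false false true zs.
    have e24 := rb true true false true false zs; have e34 := rb true true true false false zs.
    move: e01 e02 e03 e04 e12 e13 e14 e23 e24 e34.
    rewrite /= => e01 e02 e03 e04 e12 e13 e14 e23 e24 e34.
    by repeat split; first lia; apply/Z.nle_gt => h; apply: nz;
      first [apply: e01; lia|apply: e02; lia|apply: e03; lia|apply: e04; lia|apply: e12; lia
            |apply: e13; lia|apply: e14; lia|apply: e23; lia|apply: e24; lia|apply: e34; lia].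
  - subst s'; left; apply: (rb true true true true false zs); rewrite /=; lia.
move=> yD yt ys.
have /= Ry := key _ _ _ _ _ _ _ yD yt ys.
(* Doubling modulo D. At level 2 at most one entry reaches D/2. If none does, the double has level
   4. If y_i does, the double has level 3 and its pair conditions at i would demand y_i + y_j > D.
   Level 3 is symmetric under replacing each entry by D minus itself. *)
pose e z := if (D <=? 2 * z)%ZZ then 1%ZZ else 0%ZZ.
pose u := psub (pscale 2 t) (zcomb [:: e y0; e y1; e y2; e y3; e y4] X).
have eb z : (0 <= z < D)%ZZ -> (0 <= 2 * z - e z * D < D)%ZZ.
  by rewrite /e; case: Z.leb_spec0; lia.
have e01 z : (e z = 0 \/ e z = 1)%ZZ by rewrite /e; case: ifP; auto.
have zu : zcomb [:: (2 * y0 - e y0 * D); (2 * y1 - e y1 * D); (2 * y2 - e y2 * D);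
    (2 * y3 - e y3 * D); (2 * y4 - e y4 * D)]%ZZ X = pscale D u.
  move: yt; rewrite /u /y /X; move: (e y0) (e y1) (e y2) (e y3) (e y4); clear => f0 f1 f2 f3 f4.
  by pt_cases; rewrite /= => -[*]; pt_eq; lia.
case: yD => [d0 [d1 [d2 [d3 d4]]]].
have /= := key _ _ _ _ _ _ (2 * s - (e y0 + e y1 + e y2 + e y3 + e y4))%ZZ
   (conj (eb _ d0) (conj (eb _ d1) (conj (eb _ d2) (conj (eb _ d3) (eb _ d4))))) zu.
have -> : (2 * y0 - e y0 * D + (2 * y1 - e y1 * D) + (2 * y2 - e y2 * D) +
   (2 * y3 - e y3 * D) + (2 * y4 - e y4 * D) =
   (2 * s - (e y0 + e y1 + e y2 + e y3 + e y4)) * D)%ZZ by lia.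
rewrite /R /= in Ry *.
move=> /(_ erefl); move: Ry (eb _ d0) (eb _ d1) (eb _ d2) (eb _ d3) (eb _ d4).
move: (e01 y0) (e01 y1) (e01 y2) (e01 y3) (e01 y4) ys D0.
move: (e y0) (e y1) (e y2) (e y3) (e y4); clear => f0 f1 f2 f3 f4.
by move=> [->|->] [->|->] [->|->] [->|->] [->|->]; lia.
Qed.

(** The fractional parts of the rational coordinates of [v - x0] form the residue vector of a
    lattice point, so [no_residue] makes them vanish. *)
Lemma unimodular X v : K X ->
  exists c, [/\ size c = 5%N, zsum c = 1%ZZ & zcomb c X = v].
Proof.
move=> KX; have [x0 [x1 [x2 [x3 [x4 XE]]]]] := fam_list KX.
have [D [y [D0 sy y0 yX]]] := fam_rank HK (psub v x0) KX.
have [a [b [c [d [e yE]]]]] : exists a b c d e, y = [:: a; b; c; d; e].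
  by case: y sy {y0 yX} => [|? [|? [|? [|? [|? []]]]]] // _; do 5!eexists.
pose q := [:: (a / D)%ZZ; (b / D)%ZZ; (c / D)%ZZ; (d / D)%ZZ; (e / D)%ZZ].
have D1 : (D <> 0)%ZZ by lia.
have [] := @no_residue x0 x1 x2 x3 x4 D (psub (psub v x0) (zcomb q X))
  (a mod D)%ZZ (b mod D)%ZZ (c mod D)%ZZ (d mod D)%ZZ (e mod D)%ZZ
  (- (a / D + b / D + c / D + d / D + e / D))%ZZ.
- by rewrite -XE.
- by [].
- by do !split; first [apply: (proj1 (Z.mod_pos_bound _ _ D0))|apply: (proj2 (Z.mod_pos_bound _ _ D0))].
- rewrite /q !Z.mod_eq // -XE; move: yX; rewrite yE XE.
  move: (a / D)%ZZ (b / D)%ZZ (c / D)%ZZ (d / D)%ZZ (e / D)%ZZ; clear => qa qb qc qd qe.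
  by pt_cases; rewrite /= => -[*]; pt_eq; lia.
- by move: y0; rewrite yE /zsum /= !Z.mod_eq //; lia.
move=> ra [rb [rc [rd re]]].
exists (zadd q (dl 0)); split; rewrite ?size_zadd ?zsum_add ?zsum_dl //.
  move: y0; rewrite yE /zsum /=.
  rewrite {1}(Z.div_mod a D) // {1}(Z.div_mod b D) // {1}(Z.div_mod c D) // {1}(Z.div_mod d D) // {1}(Z.div_mod e D) //.
  by rewrite ra rb rc rd re; clear -D0; nia.
have x0E : nth p0 X 0 = x0 by rewrite XE.
rewrite zcomb_add // zcomb_dl ?(fam_size HK KX) // x0E.
apply: (@paddI (pscale (-1) x0)); rewrite -paddA.
have -> : padd x0 (pscale (-1) x0) = p0 by clear; pt_cases; rewrite /=; pt_eq; lia.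
rewrite padd0; apply: (pt_scale_inj D0).
have -> : padd v (pscale (-1) x0) = psub v x0 by clear; pt_cases; rewrite /=; pt_eq; lia.
rewrite -yX -zcomb_scale yE; congr zcomb; rewrite /q /zscale /=.
rewrite [in RHS](Z.div_mod a D) // [in RHS](Z.div_mod b D) // [in RHS](Z.div_mod c D) //.
by rewrite [in RHS](Z.div_mod d D) // [in RHS](Z.div_mod e D) // ra rb rc rd re !Z.add_0_r.
Qed.
End Unimodular.

(** * Congruent edges and triangles *)

Section Edges.
Variables (K : seq pt -> Prop) (HK : simplex_family K).

Definition edge (v : pt) := exists r, K [:: p0, v & r].

Lemma psubxx u : psub u u = p0.
Proof. pt_lia. Qed.

Lemma edge_sub X (a b : pt) : K X -> a \in X -> b \in X -> a != b -> edge (psub b a).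
Proof.
move=> KX aX bX ab.
have p1 := perm_to_rem aX.
have bX' : b \in rem a X by rewrite (mem_rem_uniq _ (fam_uniq HK KX)) inE eq_sym ab.
have p2 : perm_eq X [:: a, b & rem b (rem a X)].
  by apply: (perm_trans p1); rewrite perm_cons; exact: perm_to_rem.
have := fam_trans HK (pscale (-1) a) (fam_perm HK KX p2).
have e1 : padd a (pscale (-1) a) = p0 by pt_lia.
have e2 : padd b (pscale (-1) a) = psub b a by pt_lia.
rewrite /= e1 e2.
by move=> KX'; eexists; exact: KX'.
Qed.

Lemma edge_list v : edge v -> exists x2 x3 x4, K [:: p0; v; x2; x3; x4].
Proof.
move=> [r Kr]; have := fam_size HK Kr.
by case: r Kr => [|? [|? [|? []]]] // Kr _; do 3!eexists; exact: Kr.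
Qed.

Lemma edge_neq0 v : edge v -> v <> p0.
Proof. by move=> [r /(fam_uniq HK)] /=; rewrite inE negb_or => /andP[/andP[/eqP]]; auto. Qed.

Lemma carrier2 X Y a b i : K X -> K Y -> size a = 5%N -> size b = 5%N ->
  all (Z.leb 0) a -> all (Z.leb 0) b -> zsum a = zsum b -> (0 < zsum a)%ZZ ->
  forall w, zcomb a X = padd (zcomb b Y) (pscale (zsum b) w) ->
  (i < 5)%N -> (0 < nth 0%ZZ a i)%ZZ ->
  exists j, [/\ (j < 5)%N, nth p0 X i = padd (nth p0 Y j) w & nth 0%ZZ b j = nth 0%ZZ a i].
Proof.
move=> KX KY sa sb a0 b0 ab a1 w e i5 ai.
have szY := fam_size HK KY.
rewrite -zcomb_trans ?sb ?szY // in e.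
have [j [j5 jX jb]] := fam_carrier HK KX (fam_trans HK w KY) sa sb a0 b0 ab a1 e i5 ai.
by exists j; split=> //; rewrite jX (nth_map p0) ?szY.
Qed.

(** Since the residues of k c_i sum to m, they are m times the barycentric coordinates of a point of
    X, and this point differs from k v / m, interior to the edge from 0 to v, by the lattice vector
    [w]. Hence both ends of the edge are vertices of the translate X + w. *)
Lemma edge_residue X v c0 c1 c2 c3 c4 k m : K X -> edge v ->
  v = zcomb [:: c0; c1; c2; c3; c4] X -> (c0 + c1 + c2 + c3 + c4 = 0)%ZZ ->
  (0 < k < m)%ZZ ->
  ((k * c0) mod m + (k * c1) mod m + (k * c2) mod m + (k * c3) mod m + (k * c4) mod m = m)%ZZ ->
  exists i j, [/\ (i < 5)%N, (j < 5)%N, i != j & v = psub (nth p0 X j) (nth p0 X i)].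
Proof.
move=> KX ev vE c00 km sm; have [r KY] := ev.
have szr : size r = 3%N by case: (fam_size HK KY).
pose a := [:: ((k * c0) mod m); ((k * c1) mod m); ((k * c2) mod m); ((k * c3) mod m); ((k * c4) mod m)]%ZZ.
pose q := [:: ((k * c0) / m); ((k * c1) / m); ((k * c2) / m); ((k * c3) / m); ((k * c4) / m)]%ZZ.
pose b := [:: (m - k); k; 0; 0; 0]%ZZ.
have m0 : (0 < m)%ZZ by lia.
have m1 : (m <> 0)%ZZ by lia.
have a0 : all (Z.leb 0) a.
  by rewrite /a /=; repeat (apply/andP; split); rewrite ?andbT //; apply/Z.leb_spec0;
    apply: (proj1 (Z.mod_pos_bound _ _ m0)).
have b0 : all (Z.leb 0) b.
  by rewrite /b /=; repeat (apply/andP; split); rewrite ?andbT //; apply/Z.leb_spec0; lia.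
have sa : zsum a = m by rewrite /a /zsum /=; lia.
have sb : zsum b = m by rewrite /b /zsum /=; lia.
pose w := zcomb q X.
have e : zcomb b [:: p0, v & r] = padd (zcomb a X) (pscale (zsum a) w).
  have -> : zcomb b [:: p0, v & r] = pscale k v.
    by case: r szr {ev KY} => [|r0 [|r1 [|r2 []]]] // _; rewrite /b /=; pt_lia.
  rewrite sa /w /a /q !Z.mod_eq //.
  have [x0 [x1 [x2 [x3 [x4 XE]]]]] := fam_list HK KX.
  rewrite vE XE.
  move: (k * c0 / m)%ZZ (k * c1 / m)%ZZ (k * c2 / m)%ZZ (k * c3 / m)%ZZ (k * c4 / m)%ZZ.
  pt_lia.
have bp i : (i < 5)%N -> (0 < nth 0%ZZ b i)%ZZ -> exists j, [/\ (j < 5)%N,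
    nth p0 [:: p0, v & r] i = padd (nth p0 X j) w & nth 0%ZZ a j = nth 0%ZZ b i].
  by apply: carrier2 => //; rewrite ?sa ?sb //.
have [|i [i5 iX _]] := bp 0 isT; first by rewrite /=; lia.
have [|j [j5 jX _]] := bp 1 isT; first by rewrite /=; lia.
have vE' : v = psub (nth p0 X j) (nth p0 X i).
  move: iX jX; rewrite /=; move: (nth p0 X i) (nth p0 X j) w v {vE e ev KY bp}.
  by clear; move=> u z t s; pt_cases; rewrite /= => -[? ? ? ?] [? ? ? ?]; pt_eq; lia.
exists i, j; split=> //; apply/eqP => ij.
by case: (edge_neq0 ev); rewrite vE' ij psubxx.
Qed.

(** The midpoints differ by the lattice vector [w], so the edges coincide up to translation; the two
    ways of matching their ends give the two signs. *)
Lemma edge_cong2 u v w : edge u -> edge v -> u = padd v (pscale 2 w) ->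
  u = v \/ u = psub p0 v.
Proof.
move=> eu ev uv; have [x2 [x3 [x4 KX]]] := edge_list eu.
have [z2 [z3 [z4 KY]]] := edge_list ev.
have e : zcomb [:: 1; 1; 0; 0; 0]%ZZ [:: p0; u; x2; x3; x4] =
    padd (zcomb [:: 1; 1; 0; 0; 0]%ZZ [:: p0; v; z2; z3; z4]) (pscale 2 w).
  by move: uv; clear; pt_cases; rewrite /= => -[? ? ? ?]; pt_eq; lia.
have car := carrier2 KX KY (erefl : size [:: 1; 1; 0; 0; 0]%ZZ = 5%N)
  (erefl : size [:: 1; 1; 0; 0; 0]%ZZ = 5%N) isT isT erefl erefl e.
have [||i [i5 /= iX ib]] := car 0%N; first by []; first by [].
have [||j [j5 /= jX jb]] := car 1%N; first by []; first by [].
have un0 := edge_neq0 eu; have vn0 := edge_neq0 ev.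
case: i i5 iX ib => [|[|[|[|[|i]]]]] // _ iX _; case: j j5 jX jb => [|[|[|[|[|j]]]]] //= _ jX _.
- by case: un0; rewrite jX.
- left; rewrite jX; move: iX; clear; pt_cases; rewrite /= => -[? ? ? ?]; pt_eq; lia.
- right; rewrite jX; move: iX; clear; pt_cases; rewrite /= => -[? ? ? ?]; pt_eq; lia.
- by case: un0; rewrite jX.
Qed.

(** Otherwise the midpoint of the edge would be the lattice point [w], which is a vertex of a
    translated simplex. *)
Lemma edge_odd u w : edge u -> u <> pscale 2 w.
Proof.
move=> eu uw; have [x2 [x3 [x4 KX]]] := edge_list eu.
have e : zcomb [:: 1; 1; 0; 0; 0]%ZZ [:: p0; u; x2; x3; x4] =
    padd (zcomb [:: 2; 0; 0; 0; 0]%ZZ [:: p0; u; x2; x3; x4]) (pscale 2 w).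
  by move: uw; clear; pt_cases; rewrite /= => -[? ? ? ?]; pt_eq; lia.
have car := carrier2 KX KX (erefl : size [:: 1; 1; 0; 0; 0]%ZZ = 5%N)
  (erefl : size [:: 2; 0; 0; 0; 0]%ZZ = 5%N) isT isT erefl erefl e.
have [||i [i5 /= iX ib]] := car 0%N; first by []; first by [].
by case: i i5 iX ib => [|[|[|[|[|i]]]]].
Qed.

Definition triangle (t : pt * pt) := exists r, K [:: p0, t.1, t.2 & r].

(** The barycentres of the triangles differ by [w]. *)
Lemma triangle_cong3 t t' w : triangle t -> triangle t' ->
  padd t.1 t.2 = padd (padd t'.1 t'.2) (pscale 3 w) ->
  forall x, x \in [:: p0; t.1; t.2] ->
  exists2 x', x' \in [:: p0; t'.1; t'.2] & x = padd x' w.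
Proof.
case: t t' => u v [u' v'] /= [r KX] [r' KY] /= e0 x xX.
have szr : size r = 2%N by case: (fam_size HK KX).
have szr' : size r' = 2%N by case: (fam_size HK KY).
have e : zcomb [:: 1; 1; 1; 0; 0]%ZZ [:: p0, u, v & r] =
    padd (zcomb [:: 1; 1; 1; 0; 0]%ZZ [:: p0, u', v' & r']) (pscale 3 w).
  case: r szr {KX} => [|? [|? []]] //; case: r' szr' {KY} => [|? [|? []]] // _ _.
  by move: e0; clear; pt_cases; rewrite /= => -[? ? ? ?]; pt_eq; lia.
have car := carrier2 KX KY (erefl : size [:: 1; 1; 1; 0; 0]%ZZ = 5%N)
  (erefl : size [:: 1; 1; 1; 0; 0]%ZZ = 5%N) isT isT erefl erefl e.
have {}car i : (i < 3)%N -> exists j, [/\ (j < 3)%N &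
   nth p0 [:: p0; u; v] i = padd (nth p0 [:: p0; u'; v'] j) w].
  move=> i3; have [||j [j5]] := car i; first exact: leq_trans i3 _.
    by case: i i3 => [|[|[|]]].
  by case: i i3 => [|[|[|]]] // _; case: j j5 => [|[|[|[|[|j]]]]] // _ /= e1 e2;
    first [by []|by exists 0%N|by exists 1%N|by exists 2%N].
have [j [j3]] := car (index x [:: p0; u; v]) (etrans (index_mem _ _) xX).
rewrite nth_index // => ->; exists (nth p0 [:: p0; u'; v'] j) => //.
exact: mem_nth.
Qed.
End Edges.

(** * Residues of multiples modulo n *)

Local Open Scope Z_scope.

Lemma mod_flip n k x : (0 < n)%ZZ ->
  ((n - k) * x mod n = if (k * x) mod n =? 0 then 0 else n - (k * x) mod n)%ZZ.
Proof.
move=> n0; have -> : ((n - k) * x = - (k * x) + x * n)%ZZ by lia.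
rewrite Z.mod_add; last lia.
by case: Z.eqb_spec => h; [rewrite Z_mod_zero_opp_full|rewrite Z_mod_nz_opp_full].
Qed.

(** The four residues sum to j n with j = 1, 2 or 3. The hypothesis at [k] excludes j = 1, and at
    [n - k], where every nonzero residue is complemented, it excludes j = 3 and any vanishing
    residue. *)
Lemma balanced_residues n r0 p q s : (1 < n)%ZZ -> (r0 = 1 \/ r0 = -1)%ZZ ->
  ((p + q + s + r0) mod n = 0)%ZZ ->
  (forall k, 0 < k < n -> (k * r0) mod n + (k * p) mod n + (k * q) mod n + (k * s) mod n <> n)%ZZ ->
  forall k, (0 < k < n)%ZZ ->
  (0 < (k * p) mod n /\ 0 < (k * q) mod n /\ 0 < (k * s) mod n /\
   (k * r0) mod n + (k * p) mod n + (k * q) mod n + (k * s) mod n = 2 * n)%ZZ.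
Proof.
move=> n1 r1 pqs H k kn; have n0 : (0 < n)%ZZ by lia.
have rE : (0 < (k * r0) mod n)%ZZ.
  case: r1 => ->; first by rewrite Z.mul_1_r Z.mod_small; lia.
  have -> : (k * -1 = (n - k) + (-1) * n)%ZZ by lia.
  by rewrite Z.mod_add ?Z.mod_small; lia.
have [j jE] : exists j, ((k * r0) mod n + (k * p) mod n + (k * q) mod n + (k * s) mod n = j * n)%ZZ.
  have n2 : (n <> 0)%ZZ by lia.
  exists (k * ((p + q + s + r0) / n) - (k * r0) / n - (k * p) / n - (k * q) / n - (k * s) / n)%ZZ.
  have := Z.div_mod (p + q + s + r0) n n2; rewrite pqs !Z.mod_eq // => e.
  by move: (_ / n)%ZZ e (k * r0 / n)%ZZ (k * p / n)%ZZ (k * q / n)%ZZ (k * s / n)%ZZ => t e *; nia.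
have h1 := H k kn; have h2 := H (n - k)%ZZ ltac:(lia).
move: h1 h2; rewrite !mod_flip //; move: rE jE.
have := Z.mod_pos_bound (k * r0) n n0; have := Z.mod_pos_bound (k * p) n n0.
have := Z.mod_pos_bound (k * q) n n0; have := Z.mod_pos_bound (k * s) n n0.
move: ((k * r0) mod n)%ZZ ((k * p) mod n)%ZZ ((k * q) mod n)%ZZ ((k * s) mod n)%ZZ.
clear H => e x y z zb yb xb eb e0 jE h1 h2.
have j4 : (j = 1 \/ j = 2 \/ j = 3)%ZZ by nia.
move: h2; case: Z.eqb_spec => ?; case: Z.eqb_spec => ?; case: Z.eqb_spec => ?; case: Z.eqb_spec => ?;
  case: j4 => [?|[?|?]]; subst j; lia.
Qed.

(** A common divisor g > 1 of [a] and [n] would make the multiple of [a] by n / g vanish modulo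
    [n]. *)
Lemma inverse_mod n a : (1 < n)%ZZ -> (forall k, 0 < k < n -> 0 < (k * a) mod n)%ZZ ->
  exists2 k, (0 < k < n)%ZZ & ((k * a) mod n = 1)%ZZ.
Proof.
move=> n1 H; have n0 : (0 < n)%ZZ by lia.
pose g := Z.gcd a n.
have g0 : (0 < g)%ZZ.
  by have := Z.gcd_nonneg a n; have := Z.gcd_eq_0_r a n; rewrite -/g; lia.
have [u ua] : (g | a)%ZZ := Z.gcd_divide_l a n.
have [w wn] : (g | n)%ZZ := Z.gcd_divide_r a n.
have g1 : (g = 1)%ZZ.
  have [//|g2] : (g = 1 \/ 1 < g)%ZZ by lia.
  have w0 : (0 < w < n)%ZZ by nia.
  have wa : (w * a = u * n)%ZZ.
    by have := f_equal (Z.mul w) ua; have := f_equal (Z.mul u) wn; lia.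
  have := H w w0; rewrite wa.
  by rewrite Z.mod_mul; lia.
have [x [y xy]] : exists x y, (x * a + y * n = 1)%ZZ.
  have [x [y xy]] := Z.gcd_bezout a n _ (erefl (Z.gcd a n)).
  by exists x, y; rewrite xy -/g g1.
exists (x mod n)%ZZ.
  have := Z.mod_pos_bound x n n0; have [xn|] : (x mod n = 0 \/ x mod n <> 0)%ZZ by lia.
    have := Z.div_mod x n; rewrite xn => /(_ ltac:(lia)) xE; rewrite xE in xy.
    have [t tE] : exists t, (n * t = 1)%ZZ by exists (x / n * a + y)%ZZ; lia.
    have [t0|t0] : (t <= 0 \/ 1 <= t)%ZZ by lia.
      by exfalso; clear -n1 tE t0; nia.
    by exfalso; clear -n1 tE t0; nia.
  by lia.
rewrite Z.mul_mod_idemp_l; last lia.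
have -> : (x * a = 1 + (- y) * n)%ZZ by lia.
by rewrite Z.mod_add ?Z.mod_small; lia.
Qed.

(* Residues modulo n = |d| at a multiplier k with k a = 1: the balancing
   conditions for the edges r - e_a and r - e_b contradict each other. *)
Lemma apex_coefficient n r0 a b c d : (1 < n)%ZZ -> (n = Z.abs d)%ZZ ->
  (r0 = 1 \/ r0 = -1)%ZZ -> (a + b + c + d + r0 = 1)%ZZ ->
  let G (x y z : Z) := (forall k, 0 < k < n ->
     (k * r0) mod n + (k * x) mod n + (k * y) mod n + (k * z) mod n <> n)%ZZ in
  G (a - 1)%ZZ b c -> G a (b - 1)%ZZ c -> G a b (c - 1)%ZZ ->
  (r0 = 1 -> G (- a - 1) (- b) (- c) /\ G (- a) (- b - 1) (- c) /\ G (- a) (- b) (- c - 1))%ZZ ->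
  False.
Proof.
move=> n1 nd r1 sm G Ga Gb Gc G'; have n0 : (0 < n)%ZZ by lia.
have n2 : (n <> 0)%ZZ by lia.
have dn : (d mod n = 0)%ZZ.
  by apply/(Z.mod_divide _ _ n2); rewrite {1}nd; apply/Z.divide_abs_l; exact: Z.divide_refl.
have dn' t : ((d * t) mod n = 0)%ZZ by rewrite Z.mul_comm Z.mul_mod // dn Z.mul_0_r.
have Ba := @balanced_residues n r0 (a - 1) b c n1 r1 _ Ga.
have Bb := @balanced_residues n r0 a (b - 1) c n1 r1 _ Gb.
have Bc := @balanced_residues n r0 a b (c - 1) n1 r1 _ Gc.
have eBa : ((a - 1 + b + c + r0) mod n = 0)%ZZ by rewrite (_ : (a - 1 + b + c + r0 = d * -1)%ZZ) ?dn' //; lia.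
have {}Ba := Ba eBa.
have eBb : ((a + (b - 1) + c + r0) mod n = 0)%ZZ by rewrite (_ : (a + (b - 1) + c + r0 = d * -1)%ZZ) ?dn' //; lia.
have {}Bb := Bb eBb.
have eBc : ((a + b + (c - 1) + r0) mod n = 0)%ZZ by rewrite (_ : (a + b + (c - 1) + r0 = d * -1)%ZZ) ?dn' //; lia.
have {}Bc := Bc eBc.
have [|k kn kA] := @inverse_mod n a n1; first by move=> k /Bb [].
have shift x : ((k * (x - 1)) mod n = if k <=? (k * x) mod n then (k * x) mod n - k else (k * x) mod n - k + n)%ZZ.
  have -> : (k * (x - 1) = (k * x) mod n - k + (k * x / n) * n)%ZZ.
    by rewrite Z.mod_eq //; lia.
  rewrite Z.mod_add //; have := Z.mod_pos_bound (k * x) n n0.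
  case: Z.leb_spec0 => ? ?; first by rewrite Z.mod_small; lia.
  have -> : ((k * x) mod n - k = (k * x) mod n - k + n + (-1) * n)%ZZ by lia.
  by rewrite Z.mod_add // Z.mod_small; lia.
(* Let p, q be the residues of k b, k c, and r that of k r0. [Ba] gives p + q + r = n + k - 1, and
   then [Bb], [Bc] force p, q < k. If r0 = -1, then r = n - k and p + q = 2 k - 1, too large. If r0
   = 1, then p + q = n - 1, while the reflected conditions force p, q < n - k, so that 2 (p + q) <=
   2 n - 4. *)
have := Ba k kn; have := Bb k kn; have := Bc k kn; rewrite !shift kA.
have := Z.mod_pos_bound (k * b) n n0; have := Z.mod_pos_bound (k * c) n n0.
have [k1 _] := kn.
case: r1 => rE; last first.
  have -> : ((k * r0) mod n = n - k)%ZZ.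
    have -> : (k * r0 = n - k + (-1) * n)%ZZ by lia.
    by rewrite Z.mod_add // Z.mod_small; lia.
  by clear -kn n1; case: Z.leb_spec0; case: Z.leb_spec0; case: Z.leb_spec0; lia.
have -> : ((k * r0) mod n = k)%ZZ by rewrite rE Z.mul_1_r Z.mod_small; lia.
have [Ga' [Gb' Gc']] := G' rE.
have B'b := @balanced_residues n r0 (- a) (- b - 1) (- c) n1 (or_introl rE) _ Gb'.
have B'c := @balanced_residues n r0 (- a) (- b) (- c - 1) n1 (or_introl rE) _ Gc'.
have eB'b : ((- a + (- b - 1) + - c + r0) mod n = 0)%ZZ by rewrite (_ : (- a + (- b - 1) + - c + r0 = d * 1)%ZZ) ?dn' //; lia.
have {}B'b := B'b eB'b.
have eB'c : ((- a + - b + (- c - 1) + r0) mod n = 0)%ZZ by rewrite (_ : (- a + - b + (- c - 1) + r0 = d * 1)%ZZ) ?dn' //; lia.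
have {}B'c := B'c eB'c.
have neg x : (0 < (k * x) mod n -> (k * - x) mod n = n - (k * x) mod n)%ZZ.
  move=> x0; have -> : (k * - x = - (k * x))%ZZ by lia.
  by rewrite Z_mod_nz_opp_full; lia.
move=> cb bb hc hb ha; have b0 : (0 < (k * b) mod n)%ZZ by have [] := ha; lia.
have c0 : (0 < (k * c) mod n)%ZZ by have [] := ha; lia.
have := B'b k kn; have := B'c k kn; rewrite !shift !neg ?kA //.
have -> : ((k * r0) mod n = k)%ZZ by rewrite rE Z.mul_1_r Z.mod_small; lia.
move: ha hb hc; clear -kn n1 cb bb.
by case: Z.leb_spec0; case: Z.leb_spec0; case: Z.leb_spec0; case: Z.leb_spec0; case: Z.leb_spec0; lia.
Qed.

Ltac pt_lia' := clear; intros;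
  repeat match goal with H : @eq pt _ _ |- _ => revert H end;
  pt_cases; cbv [p0]; rewrite /=;
  repeat match goal with |- @eq _ _ _ -> _ => let H := fresh in
    intro H; injection H; clear H; do 4 intro end; pt_eq; lia.

(** The failure of the hypothesis of [edge_residue], hence satisfied by every edge that is not an
    edge of X. *)
Definition unbalanced (n k a b c d e : Z) : Prop :=
  ((k * a) mod n + (k * b) mod n + (k * c) mod n + (k * d) mod n + (k * e) mod n <> n)%ZZ.

(** The [r] are barycentric coordinates of the apex over a facet shared with X, and lowering one of
    them by 1 gives the edge to the corresponding vertex of that facet. *)
Definition apex_edges_ok (r0 r1 r2 r3 r4 : Z) : Prop := forall n k, (0 < k < n)%ZZ ->
  [/\ unbalanced n k r0 (r1 - 1) r2 r3 r4, unbalanced n k r0 r1 (r2 - 1) r3 r4,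
      unbalanced n k r0 r1 r2 (r3 - 1) r4 & unbalanced n k r0 r1 r2 r3 (r4 - 1)].

(** If some |r_i| > 1, the modulus n = |r_i| kills the i-th residue, which leaves the situation of
    [apex_coefficient] for the other coordinates. *)
Lemma apex_bound r0 r1 r2 r3 r4 : (r0 = 1 \/ r0 = -1)%ZZ ->
  (r0 + r1 + r2 + r3 + r4 = 1)%ZZ -> apex_edges_ok r0 r1 r2 r3 r4 ->
  (r0 = 1%ZZ -> apex_edges_ok 1 (- r1) (- r2) (- r3) (- r4)) ->
  [/\ (Z.abs r1 <= 1)%ZZ, (Z.abs r2 <= 1)%ZZ, (Z.abs r3 <= 1)%ZZ & (Z.abs r4 <= 1)%ZZ].
Proof.
move=> h0 hs P P'.
have z0 k d : (1 < Z.abs d)%ZZ -> ((k * d) mod (Z.abs d) = 0)%ZZ.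
  move=> d1; have d2 : (Z.abs d <> 0)%ZZ by lia.
  apply/(Z.mod_divide _ _ d2); apply/Z.divide_abs_l; exact: Z.divide_factor_r.
have z0' k d : (1 < Z.abs d)%ZZ -> ((k * - d) mod (Z.abs d) = 0)%ZZ.
  by move=> d1; have := z0 k (- d)%ZZ; rewrite Z.abs_opp; apply.
split; apply/Z.nlt_ge => big.
- apply: (@apex_coefficient (Z.abs r1) r0 r2 r3 r4 r1) => //; first lia.
  + by move=> k kn; have [_ + _ _] := P _ _ kn; rewrite /unbalanced z0 //; lia.
  + by move=> k kn; have [_ _ + _] := P _ _ kn; rewrite /unbalanced z0 //; lia.
  + by move=> k kn; have [_ _ _ +] := P _ _ kn; rewrite /unbalanced z0 //; lia.
  move=> r1E; rewrite r1E; split; last split.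
  + by move=> k kn; have [_ + _ _] := P' r1E _ _ kn; rewrite /unbalanced z0' //; lia.
  + by move=> k kn; have [_ _ + _] := P' r1E _ _ kn; rewrite /unbalanced z0' //; lia.
  + by move=> k kn; have [_ _ _ +] := P' r1E _ _ kn; rewrite /unbalanced z0' //; lia.
- apply: (@apex_coefficient (Z.abs r2) r0 r1 r3 r4 r2) => //; first lia.
  + by move=> k kn; have [+ _ _ _] := P _ _ kn; rewrite /unbalanced z0 //; lia.
  + by move=> k kn; have [_ _ + _] := P _ _ kn; rewrite /unbalanced z0 //; lia.
  + by move=> k kn; have [_ _ _ +] := P _ _ kn; rewrite /unbalanced z0 //; lia.
  move=> r1E; rewrite r1E; split; last split.
  + by move=> k kn; have [+ _ _ _] := P' r1E _ _ kn; rewrite /unbalanced z0' //; lia.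
  + by move=> k kn; have [_ _ + _] := P' r1E _ _ kn; rewrite /unbalanced z0' //; lia.
  + by move=> k kn; have [_ _ _ +] := P' r1E _ _ kn; rewrite /unbalanced z0' //; lia.
- apply: (@apex_coefficient (Z.abs r3) r0 r1 r2 r4 r3) => //; first lia.
  + by move=> k kn; have [+ _ _ _] := P _ _ kn; rewrite /unbalanced z0 //; lia.
  + by move=> k kn; have [_ + _ _] := P _ _ kn; rewrite /unbalanced z0 //; lia.
  + by move=> k kn; have [_ _ _ +] := P _ _ kn; rewrite /unbalanced z0 //; lia.
  move=> r1E; rewrite r1E; split; last split.
  + by move=> k kn; have [+ _ _ _] := P' r1E _ _ kn; rewrite /unbalanced z0' //; lia.
  + by move=> k kn; have [_ + _ _] := P' r1E _ _ kn; rewrite /unbalanced z0' //; lia.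
  + by move=> k kn; have [_ _ _ +] := P' r1E _ _ kn; rewrite /unbalanced z0' //; lia.
- apply: (@apex_coefficient (Z.abs r4) r0 r1 r2 r3 r4) => //.
  + lia.
  + by move=> k kn; have [+ _ _ _] := P _ _ kn; rewrite /unbalanced z0 //; lia.
  + by move=> k kn; have [_ + _ _] := P _ _ kn; rewrite /unbalanced z0 //; lia.
  + by move=> k kn; have [_ _ + _] := P _ _ kn; rewrite /unbalanced z0 //; lia.
  move=> r1E; rewrite r1E; split; last split.
  + by move=> k kn; have [+ _ _ _] := P' r1E _ _ kn; rewrite /unbalanced z0' //; lia.
  + by move=> k kn; have [_ + _ _] := P' r1E _ _ kn; rewrite /unbalanced z0' //; lia.
  + by move=> k kn; have [_ _ + _] := P' r1E _ _ kn; rewrite /unbalanced z0' //; lia.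
Qed.

(** * The apex over a facet of a known simplex *)

Section Apex.
Variables (K : seq pt -> Prop) (HK : simplex_family K).

Definition edge_of (X : seq pt) (v : pt) := exists i j,
  [/\ (i < 5)%N, (j < 5)%N, i != j & v = psub (nth p0 X j) (nth p0 X i)].

Lemma unimodular0 X v : K X -> exists c0 c1 c2 c3 c4,
  v = zcomb [:: c0; c1; c2; c3; c4] X /\ (c0 + c1 + c2 + c3 + c4 = 0)%ZZ.
Proof.
move=> KX; have [x0 [x1 [x2 [x3 [x4 XE]]]]] := fam_list HK KX.
have [c [sc c1 cX]] := unimodular HK (padd v x0) KX.
case: c sc c1 cX => [|a [|b [|c [|d [|e []]]]]] // _ c1 cX.
exists (a - 1)%ZZ, b, c, d, e; split; last by move: c1; rewrite /zsum /=; lia.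
move: cX; rewrite XE; clear; pt_cases; rewrite /= => -[*]; pt_eq; lia.
Qed.

Lemma apex_edges x0 x1 x2 x3 x4 y0 y1 y2 y3 y4 s r0 r1 r2 r3 r4 :
  let X := [:: x0; x1; x2; x3; x4] in let Y := [:: y0; y1; y2; y3; y4] in
  K X -> K Y -> (s = 1 \/ s = -1)%ZZ -> (r0 + r1 + r2 + r3 + r4 = 1)%ZZ ->
  psub y2 y1 = pscale s (psub x2 x1) -> psub y3 y1 = pscale s (psub x3 x1) ->
  psub y4 y1 = pscale s (psub x4 x1) ->
  psub y0 y1 = zcomb [:: s * r0; s * (r1 - 1); s * r2; s * r3; s * r4]%ZZ X ->
  ~ edge_of X (psub y0 y1) -> ~ edge_of X (psub y0 y2) ->
  ~ edge_of X (psub y0 y3) -> ~ edge_of X (psub y0 y4) ->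
  apex_edges_ok r0 r1 r2 r3 r4.
Proof.
move=> X Y KX KY s1 rs e2 e3 e4 e1 n1 n2 n3 n4 n k kn.
have uY := fam_uniq HK KY.
have yE y : y \in [:: y1; y2; y3; y4] -> edge K (psub y0 y).
  move=> yY; have yY' : y \in Y by rewrite in_cons yY orbT.
  have y0Y' : y0 \in Y by rewrite in_cons eqxx.
  apply: (edge_sub HK KY yY' y0Y').
  by move: uY; rewrite /= => /andP[/negP y0Y _]; apply/eqP => yy0; apply: y0Y; rewrite -yy0.
have res v (c0 c1 c2 c3 c4 : Z) : edge K v -> ~ edge_of X v ->
    v = zcomb [:: s * c0; s * c1; s * c2; s * c3; s * c4]%ZZ X ->
    (c0 + c1 + c2 + c3 + c4 = 0)%ZZ -> unbalanced n k c0 c1 c2 c3 c4.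
  move=> ev nv vE cs; rewrite /unbalanced => bad; apply: nv.
  have cs' : (s * c0 + s * c1 + s * c2 + s * c3 + s * c4 = 0)%ZZ by case: s1 => ->; lia.
  have n0 : (n <> 0)%ZZ by lia.
  case: s1 vE cs' => ->; rewrite ?Z.mul_1_l => vE cs'.
    exact: (edge_residue HK KX ev vE cs' kn).
  (* For s = -1 the multiplier [n - k] yields the same residues as [k] does for s = 1. *)
  apply: (@edge_residue K HK X v _ _ _ _ _ (n - k)%ZZ n KX ev vE cs'); first lia.
  have flip z : (((n - k) * (-1 * z)) mod n = (k * z) mod n)%ZZ.
    by rewrite (_ : ((n - k) * (-1 * z) = k * z + (- z) * n)%ZZ) ?Z.mod_add //; lia.
  by rewrite !flip.
split; [apply: (res (psub y0 y1))|apply: (res (psub y0 y2))|apply: (res (psub y0 y3))|apply: (res (psub y0 y4))];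
  rewrite ?yE ?inE ?eqxx ?orbT //; try lia; try (by apply: yE; rewrite !inE eqxx ?orbT).
- by move: e1 e2; rewrite /X; case: s1 => ->; clear; pt_cases; rewrite /= => -[? ? ? ?] [? ? ? ?]; pt_eq; lia.
- by move: e1 e3; rewrite /X; case: s1 => ->; clear; pt_cases; rewrite /= => -[? ? ? ?] [? ? ? ?]; pt_eq; lia.
- by move: e1 e4; rewrite /X; case: s1 => ->; clear; pt_cases; rewrite /= => -[? ? ? ?] [? ? ? ?]; pt_eq; lia.
Qed.

(** The facets opposite x0 and y0 are translates of each other, or of each other's negatives. With r
    the coordinates of y0 in the frame of X carried over to this facet, r0 is 1 or -1 and
    [apex_bound] bounds the rest by 1. Passing to y0 - y1 lowers r1 by 1, so one coefficient may
    reach 2, and the total is at most 6. *)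
Lemma apex x0 x1 x2 x3 x4 y0 y1 y2 y3 y4 s :
  let X := [:: x0; x1; x2; x3; x4] in let Y := [:: y0; y1; y2; y3; y4] in
  K X -> K Y -> (s = 1 \/ s = -1)%ZZ ->
  psub y2 y1 = pscale s (psub x2 x1) -> psub y3 y1 = pscale s (psub x3 x1) ->
  psub y4 y1 = pscale s (psub x4 x1) ->
  ~ edge_of X (psub y0 y1) -> ~ edge_of X (psub y0 y2) ->
  ~ edge_of X (psub y0 y3) -> ~ edge_of X (psub y0 y4) ->
  exists c0 c1 c2 c3 c4, [/\ psub y0 y1 = zcomb [:: c0; c1; c2; c3; c4] X,
    (c0 + c1 + c2 + c3 + c4 = 0)%ZZ,
    (Z.abs c0 + Z.abs c1 + Z.abs c2 + Z.abs c3 + Z.abs c4 <= 6)%ZZ &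
    (Z.abs c0 <= 3 /\ Z.abs c1 <= 3 /\ Z.abs c2 <= 3 /\ Z.abs c3 <= 3 /\ Z.abs c4 <= 3)%ZZ].
Proof.
move=> X Y KX KY s1 e2 e3 e4 n1 n2 n3 n4.
have [c0 [c1 [c2 [c3 [c4 [cX cs]]]]]] := unimodular0 (psub y0 y1) KX.
have ss : (s * s = 1)%ZZ by case: s1 => ->.
have e1 : psub y0 y1 = zcomb [:: s * (s * c0); s * ((s * c1 + 1) - 1); s * (s * c2); s * (s * c3); s * (s * c4)]%ZZ X.
  by rewrite cX; case: s1 => ->; congr zcomb; congr [:: _; _; _; _; _]; lia.
have P : apex_edges_ok (s * c0) (s * c1 + 1) (s * c2) (s * c3) (s * c4).
  by apply: (apex_edges KX KY s1 _ e2 e3 e4 e1 n1 n2 n3 n4); case: s1 => ->; lia.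
have r0 : (s * c0 = 1 \/ s * c0 = -1)%ZZ.
  have [d0 [d1 [d2 [d3 [d4 [dY ds]]]]]] := unimodular0 (psub x0 x1) KY.
  (* Expanding x0 - x1 in Y and substituting the expansions of the edges of Y in X gives an affine
     dependency of X; its first entry says d0 c0 = 1. *)
  pose e := [:: 1 - d0 * c0; - 1 - d0 * c1 + s * (d2 + d3 + d4); - d0 * c2 - s * d2; - d0 * c3 - s * d3; - d0 * c4 - s * d4]%ZZ.
  have eX : zcomb e X = p0.
    have dY' : psub x0 x1 = padd (pscale d0 (psub y0 y1)) (padd (pscale d2 (psub y2 y1))
        (padd (pscale d3 (psub y3 y1)) (pscale d4 (psub y4 y1)))).
      have d1E : (d1 = - (d0 + d2 + d3 + d4))%ZZ by lia.
      by rewrite dY /Y d1E; pt_lia.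
    move: dY'; rewrite e2 e3 e4 cX /e /X; pt_lia'.
  have es : zsum e = 0%ZZ by rewrite /e /zsum /=; lia.
  have := fam_indep HK KX (erefl : size e = 5%N) es eX (isT : (0 < 5)%N); rewrite /= => h.
  have [h1|h1] : (c0 = 1 \/ c0 = -1)%ZZ.
    by apply: (Z.eq_mul_1 _ d0); lia.
  - by rewrite h1; lia.
  - by rewrite h1; lia.
(* Exchange X and Y: when r0 = 1, the coordinates of x0 in the frame of Y are 1, -r1, -r2, -r3,
   -r4. *)
have P' : (s * c0 = 1)%ZZ -> apex_edges_ok 1 (- (s * c1 + 1)) (- (s * c2)) (- (s * c3)) (- (s * c4)).
  move=> c01.
  have f2 : psub x2 x1 = pscale s (psub y2 y1).
    by move: e2; case: s1 => ->; pt_lia'.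
  have f3 : psub x3 x1 = pscale s (psub y3 y1).
    by move: e3; case: s1 => ->; pt_lia'.
  have f4 : psub x4 x1 = pscale s (psub y4 y1).
    by move: e4; case: s1 => ->; pt_lia'.
  have f1 : psub x0 x1 = zcomb [:: s * 1; s * (- (s * c1 + 1) - 1); s * - (s * c2); s * - (s * c3); s * - (s * c4)]%ZZ Y.
    have y2E : y2 = padd y1 (pscale s (psub x2 x1)) by rewrite -e2; pt_lia.
    have y3E : y3 = padd y1 (pscale s (psub x3 x1)) by rewrite -e3; pt_lia.
    have y4E : y4 = padd y1 (pscale s (psub x4 x1)) by rewrite -e4; pt_lia.
    have y0E : y0 = padd y1 (zcomb [:: c0; c1; c2; c3; c4] X) by rewrite -cX; pt_lia.
    rewrite /Y y0E y2E y3E y4E /X.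
    have [c0E c1E] : (c0 = s /\ c1 = - (s + c2 + c3 + c4))%ZZ by case: s1 c01 => ->; lia.
    by rewrite c1E c0E; case: s1 => ->; pt_lia.
  have nY a : (0 < a < 5)%N -> ~ edge_of X (psub y0 (nth p0 Y a)).
    by case: a => [|[|[|[|[|a]]]]].
  have sY a : (0 < a < 5)%N -> psub (nth p0 Y a) y1 = pscale s (psub (nth p0 X a) x1).
    by case: a => [|[|[|[|[|a]]]]] //= _; pt_lia.
  have nX i : (0 < i < 5)%N -> ~ edge_of Y (psub x0 (nth p0 X i)).
    (* If x0 - x_i were an edge of Y through y0, then an edge at y0 would be an edge of X. If it
       were an edge of the common facet, X would contain a parallelogram. *)
    move=> i15 [a [b [a5 b5 ab e]]]; have /andP[i1 i5] := i15.
    have [a0|a0] := posnP a; have [b0|b0] := posnP b.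
    - by rewrite a0 b0 in ab.
    - case: (nY b) => //; first by rewrite b0.
      exists 0%N, i; split=> //; first by rewrite eq_sym -lt0n.
      by move: e; rewrite a0 /=; move: (nth p0 X i) (nth p0 Y b); pt_lia'.
    - case: (nY a) => //; first by rewrite a0.
      exists i, 0%N; split=> //; first by rewrite -lt0n.
      by move: e; rewrite b0 /=.
    - have sa := sY a ltac:(by rewrite a0); have sb := sY b ltac:(by rewrite b0).
      have [u [v [u5 v5 u0 v0 uv]]] : exists u v, [/\ (u < 5)%N, (v < 5)%N, (0 < u)%N, (0 < v)%N &
          padd (nth p0 X 0) (nth p0 X v) = padd (nth p0 X i) (nth p0 X u)].
        case: s1 sa sb => -> sa sb; [exists b, a|exists a, b]; split=> //;
        move: e sa sb; rewrite /=; move: (nth p0 X i) (nth p0 X a) (nth p0 X b) (nth p0 Y a) (nth p0 Y b); pt_lia'.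
      by have [] := @Kparallelogram K HK X 0 i u v KX isT i5 u5 v5 uv => h; [rewrite -h in i1|rewrite -h in u0].
  apply: (apex_edges KY KX s1 _ f2 f3 f4); try lia.
  - exact: f1.
  - exact: (nX 1%N).
  - exact: (nX 2%N).
  - exact: (nX 3%N).
  - exact: (nX 4%N).
have rs : (s * c0 + (s * c1 + 1) + s * c2 + s * c3 + s * c4 = 1)%ZZ by case: s1 => ->; lia.
have [b1 b2 b3 b4] := apex_bound r0 rs P P'.
exists c0, c1, c2, c3, c4; split=> //; case: s1 r0 b1 b2 b3 b4 => ->; lia.
Qed.
End Apex.

(** * Finite data: edge vectors up to sign, parity classes, cube triangulations, search tree *)

Definition positive_edges : seq pt :=
[:: (0,0,0,1); (0,0,1,-1); (0,0,1,0); (0,1,-1,-1); (0,1,-1,0); (0,1,-1,1);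
(0,1,0,-1); (0,1,0,0); (0,1,1,-1); (1,-2,-1,1); (1,-2,1,-1); (1,-2,1,1);
(1,-1,-2,1); (1,-1,-1,-1); (1,-1,-1,0); (1,-1,-1,1); (1,-1,-1,2); (1,-1,0,-1);
(1,-1,0,0); (1,-1,0,1); (1,-1,1,-2); (1,-1,1,-1); (1,-1,1,0); (1,-1,1,1);
(1,-1,2,-1); (1,0,-1,-1); (1,0,-1,0); (1,0,-1,1); (1,0,0,-1); (1,0,0,0);
(1,0,1,-1); (1,1,-2,-1); (1,1,-2,1); (1,1,-1,-2); (1,1,-1,-1); (1,1,-1,0);
(1,1,-1,1); (1,1,0,-1); (1,1,1,-2); (1,1,1,-1); (1,2,-1,-1); (2,-1,-1,-1);
(2,-1,-1,1); (2,-1,1,-1); (2,1,-1,-1)]%ZZ.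

(* The edges that do not have the parity of an edge of the standard simplex,
   up to sign and grouped by residue modulo 2. *)
Definition parity_classes : seq (seq pt) :=
[:: [:: (0,1,-1,-1); (0,1,-1,1); (0,1,1,-1); (2,-1,-1,-1); (2,-1,-1,1);
(2,-1,1,-1); (2,1,-1,-1)]; [:: (1,-2,-1,1); (1,-2,1,-1); (1,-2,1,1);
(1,0,-1,-1); (1,0,-1,1); (1,0,1,-1); (1,2,-1,-1)]; [:: (1,-1,-2,1);
(1,-1,0,-1); (1,-1,0,1); (1,-1,2,-1); (1,1,-2,-1); (1,1,-2,1); (1,1,0,-1)];
[:: (1,-1,-1,0); (1,-1,-1,2); (1,-1,1,-2); (1,-1,1,0); (1,1,-1,-2);
(1,1,-1,0); (1,1,1,-2)]; [:: (1,-1,-1,-1); (1,-1,-1,1); (1,-1,1,-1);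
(1,-1,1,1); (1,1,-1,-1); (1,1,-1,1); (1,1,1,-1)]]%ZZ.

(* A certificate for the search.  Simplices are grouped by their patterns, which
   record the edge used in each of the five classes of parity_classes, or 0.
   [Nd u ts] branches on pattern number u: a maximal set of compatible patterns
   contains it or a pattern incompatible with it.  [Dd u] is a dead end, since
   pattern u could be added.  In a leaf, [Ct i l l'] says that the
   triangulation avoids either all simplices A conflicting with the i-th one, or
   all simplices conflicting with each member of A, and [Tl i e] that all
   remaining simplices lie in the i-th cube triangulation after applying the
   matrix encoded by e. *)
Inductive leaf := Tl of nat & Z | Ct of nat & leaf & leaf.
Inductive tree := Lf of leaf | Dd of nat | Nd of nat & seq tree.

(* Bit k of a vertex number is its k-th coordinate. *)
Definition cube_triangulation_0 : seq (seq nat) :=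
[:: [:: 0; 8; 12; 14; 15]; [:: 0; 8; 12; 13; 15]; [:: 0; 8; 10; 14; 15]; [::
0; 8; 10; 11; 15]; [:: 0; 8; 9; 13; 15]; [:: 0; 8; 9; 11; 15]; [:: 0; 4; 12;
14; 15]; [:: 0; 4; 12; 13; 15]; [:: 0; 4; 6; 14; 15]; [:: 0; 4; 6; 7; 15]; [::
0; 4; 5; 13; 15]; [:: 0; 4; 5; 7; 15]; [:: 0; 2; 10; 14; 15]; [:: 0; 2; 10;
11; 15]; [:: 0; 2; 6; 14; 15]; [:: 0; 2; 6; 7; 15]; [:: 0; 2; 3; 11; 15]; [::
0; 2; 3; 7; 15]; [:: 0; 1; 9; 13; 15]; [:: 0; 1; 9; 11; 15]; [:: 0; 1; 5; 13;
15]; [:: 0; 1; 5; 7; 15]; [:: 0; 1; 3; 11; 15]; [:: 0; 1; 3; 7; 15]]%N.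

Definition cube_triangulation_1 : seq (seq nat) :=
[:: [:: 0; 8; 12; 14; 15]; [:: 0; 8; 12; 9; 15]; [:: 0; 8; 2; 14; 11]; [:: 0;
8; 14; 11; 15]; [:: 0; 8; 9; 11; 15]; [:: 0; 4; 12; 6; 15]; [:: 0; 4; 12; 13;
15]; [:: 0; 4; 6; 7; 15]; [:: 0; 4; 1; 13; 15]; [:: 0; 4; 1; 7; 15]; [:: 0;
12; 6; 14; 15]; [:: 0; 12; 9; 13; 15]; [:: 0; 2; 6; 14; 15]; [:: 0; 2; 6; 3;
15]; [:: 0; 2; 14; 11; 15]; [:: 0; 2; 3; 11; 15]; [:: 0; 6; 3; 7; 15]; [:: 0;
1; 9; 13; 15]; [:: 0; 1; 9; 3; 15]; [:: 0; 1; 3; 7; 15]; [:: 0; 9; 3; 11; 15];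
[:: 8; 2; 10; 14; 11]; [:: 4; 1; 5; 13; 7]; [:: 4; 1; 13; 7; 15]]%N.

Definition cube_triangulation_2 : seq (seq nat) :=
[:: [:: 0; 8; 12; 14; 15]; [:: 0; 8; 12; 13; 15]; [:: 0; 8; 2; 14; 15]; [:: 0;
8; 2; 11; 15]; [:: 0; 8; 9; 13; 15]; [:: 0; 8; 9; 11; 15]; [:: 0; 4; 12; 6;
15]; [:: 0; 4; 12; 13; 15]; [:: 0; 4; 6; 7; 15]; [:: 0; 4; 5; 13; 7]; [:: 0;
4; 13; 7; 15]; [:: 0; 12; 6; 14; 15]; [:: 0; 2; 6; 14; 15]; [:: 0; 2; 6; 7;
15]; [:: 0; 2; 3; 11; 15]; [:: 0; 2; 3; 7; 15]; [:: 0; 1; 9; 13; 15]; [:: 0;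
1; 9; 3; 15]; [:: 0; 1; 5; 13; 7]; [:: 0; 1; 13; 7; 15]; [:: 0; 1; 3; 7; 15];
[:: 0; 9; 3; 11; 15]; [:: 8; 2; 10; 14; 15]; [:: 8; 2; 10; 11; 15]]%N.

Definition cube_triangulation_3 : seq (seq nat) :=
[:: [:: 0; 8; 12; 14; 15]; [:: 0; 8; 12; 9; 15]; [:: 0; 8; 2; 14; 15]; [:: 0;
8; 2; 11; 15]; [:: 0; 8; 9; 11; 15]; [:: 0; 4; 12; 6; 15]; [:: 0; 4; 12; 13;
15]; [:: 0; 4; 6; 7; 15]; [:: 0; 4; 1; 13; 15]; [:: 0; 4; 1; 7; 15]; [:: 0;
12; 6; 14; 15]; [:: 0; 12; 9; 13; 15]; [:: 0; 2; 6; 14; 15]; [:: 0; 2; 6; 3;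
15]; [:: 0; 2; 3; 11; 15]; [:: 0; 6; 3; 7; 15]; [:: 0; 1; 9; 13; 15]; [:: 0;
1; 9; 3; 15]; [:: 0; 1; 3; 7; 15]; [:: 0; 9; 3; 11; 15]; [:: 8; 2; 10; 14;
11]; [:: 8; 2; 14; 11; 15]; [:: 4; 1; 5; 13; 7]; [:: 4; 1; 13; 7; 15]]%N.

Definition clique_tree : tree :=
Nd 0 [:: Nd 3 [:: Nd 31 [:: Lf (Ct 3 (Ct 7 (Tl 3 27229) (Tl 1 28543)) (Ct 7
(Tl 1 27229) (Tl 3 2126829))); Nd 5 [:: Lf (Ct 2 (Ct 8 (Tl 3 6898) (Tl 1
20038)) (Ct 8 (Tl 1 6898) (Tl 3 2132353))); Lf (Tl 2 6898); Lf (Tl 2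
16500916); Dd 139; Dd 140; Dd 140; Dd 140; Dd 139; Dd 139; Lf (Tl 2
16684948)]; Nd 2 [:: Lf (Tl 2 557716); Lf (Tl 2 531796); Dd 139; Dd 138; Dd
138; Dd 139; Dd 139; Dd 138; Lf (Tl 2 7303)]; Dd 36; Nd 80 [:: Lf (Ct 1 (Ct 15
(Tl 1 26518) (Tl 3 26338)) (Ct 15 (Tl 3 2125873) (Tl 1 26338))); Lf (Tl 2
26338); Lf (Tl 2 16474996); Dd 140; Dd 138; Dd 140; Dd 140; Dd 138; Dd 138; Lf
(Tl 2 16503508)]; Dd 2; Dd 70; Dd 70; Dd 70; Dd 36; Dd 70; Dd 36; Dd 2; Nd 138
[:: Lf (Tl 2 741748); Lf (Tl 2 560308); Lf (Tl 2 27229); Dd 139; Dd 140; Dd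
140; Dd 140; Dd 139; Dd 139; Lf (Ct 9 (Tl 1 21901) (Tl 3 7303)); Dd 164; Dd
164; Dd 164]; Dd 137; Dd 137; Dd 70; Dd 70; Dd 137]; Nd 28 [:: Lf (Tl 0 6898);
Lf (Tl 2 16501158); Dd 55; Dd 55; Dd 55; Dd 55; Dd 55]; Lf (Tl 2 20038); Dd 4;
Nd 19 [:: Dd 4; Dd 4; Dd 4; Dd 4]; Lf (Tl 2 16494678); Nd 84 [:: Lf (Tl 0
26338); Lf (Tl 2 26518); Dd 85; Dd 85; Dd 85; Dd 85; Dd 85]; Dd 32; Dd 33; Dd
34; Dd 4; Dd 4; Nd 33 [:: Dd 34; Dd 34; Dd 34; Dd 34]; Dd 34; Dd 34; Dd 19; Dd
4; Dd 4; Lf (Tl 2 16494393); Dd 84; Dd 34; Dd 34; Lf (Tl 2 16474953)]; Nd 4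
[:: Nd 53 [:: Lf (Tl 0 531778); Lf (Tl 2 801265); Dd 67; Dd 67; Dd 67; Dd 67;
Dd 67]; Nd 55 [:: Lf (Tl 2 6916); Lf (Tl 2 531778); Dd 27; Dd 27; Dd 37; Lf
(Ct 5 (Ct 15 (Tl 1 26499) (Tl 3 26353)) (Ct 14 (Tl 3 2125858) (Tl 1 26353)));
Dd 37; Dd 37; Lf (Tl 2 560318); Dd 27]; Lf (Tl 2 617585); Dd 34; Dd 3; Dd 3;
Dd 3; Dd 34; Dd 3; Dd 3; Dd 3; Dd 3; Dd 34; Lf (Tl 2 203673)]; Nd 16 [:: Nd 20
[:: Lf (Tl 0 557698); Lf (Tl 2 557698); Dd 69; Dd 69; Dd 69; Dd 69; Dd 69]; Nd
33 [:: Lf (Tl 2 598145); Lf (Tl 2 600385); Dd 21; Dd 19; Lf (Ct 5 (Ct 12 (Tl 1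
6913) (Tl 3 2132338)) (Ct 11 (Tl 3 6913) (Tl 1 20019))); Dd 19; Dd 21; Dd 21;
Dd 19; Lf (Tl 2 22233)]; Dd 12; Lf (Tl 2 26356); Dd 41; Dd 12; Dd 12; Dd 12;
Dd 12; Dd 41; Dd 12; Dd 12; Lf (Tl 2 741758); Dd 41]; Nd 9 [:: Lf (Ct 7 (Ct 9
(Tl 1 7618) (Tl 3 7618)) (Ct 9 (Tl 3 2134593) (Tl 1 22198))); Lf (Tl 2 22198);
Dd 21; Lf (Tl 2 16494358); Dd 33; Dd 21; Dd 33; Dd 21; Lf (Tl 2 16497513); Dd
33]; Nd 12 [:: Nd 29 [:: Lf (Ct 2 (Ct 10 (Tl 1 531778) (Tl 3 557713)) (Ct 10
(Tl 3 531778) (Tl 1 1594678))); Nd 10 [:: Lf (Ct 3 (Ct 9 (Tl 1 532498) (Tl 3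
532498)) (Ct 9 (Tl 3 559953) (Tl 1 1596838))); Lf (Tl 2 1620598); Lf (Tl 2
1594678); Dd 130; Dd 129; Dd 129; Dd 130; Dd 130; Dd 129; Lf (Tl 2 1621539)];
Nd 14 [:: Lf (Tl 2 1623078); Lf (Tl 2 1596838); Dd 131; Dd 129; Dd 131; Dd
131; Dd 129; Dd 129; Lf (Tl 2 1620579)]; Dd 30; Dd 30; Dd 14; Nd 99 [:: Lf (Ct
1 (Ct 16 (Tl 1 531793) (Tl 3 531793)) (Ct 16 (Tl 3 557698) (Tl 1 1594659)));
Lf (Tl 2 1798038); Lf (Tl 2 1797718); Dd 130; Dd 131; Dd 131; Dd 131; Dd 130;
Dd 130; Lf (Tl 2 1594659)]; Dd 66; Dd 66; Dd 66; Dd 66; Nd 129 [:: Lf (Tl 2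
1596873); Lf (Tl 2 1797753); Lf (Tl 2 1800873); Dd 130; Dd 131; Dd 131; Dd
131; Dd 130; Dd 130; Lf (Ct 9 (Tl 1 532531) (Tl 3 559994)); Dd 165; Dd 165; Dd
165]; Dd 30; Dd 14; Dd 127; Dd 127; Dd 66; Dd 66; Dd 127]; Nd 18 [:: Lf (Tl 0
558738); Lf (Tl 2 558738); Dd 40; Dd 40; Dd 40; Dd 40; Dd 40]; Dd 16; Lf (Tl 2
558779); Nd 27 [:: Dd 16; Dd 16; Dd 16; Dd 16]; Dd 16; Nd 104 [:: Lf (Tl 2
617099); Lf (Tl 0 617058); Dd 105; Dd 105; Dd 105; Dd 105; Dd 105]; Dd 39; Dd
16; Dd 41; Lf (Tl 2 617058); Dd 55; Nd 41 [:: Dd 55; Dd 14; Dd 14; Dd 14]; Dd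
41; Dd 41; Lf (Tl 2 17013028); Dd 16; Dd 27; Dd 16; Lf (Tl 2 17013038); Dd
105; Dd 41; Dd 41]; Nd 17 [:: Nd 37 [:: Lf (Tl 0 532498); Lf (Tl 2 801505); Dd
95; Dd 95; Dd 95; Dd 95; Dd 95]; Nd 39 [:: Dd 7; Nd 7 [:: Lf (Tl 2 16500996);
Lf (Tl 2 7618); Dd 155; Dd 156; Dd 156; Dd 156; Dd 155; Dd 155; Lf (Tl 2
16684708)]; Nd 15 [:: Lf (Ct 6 (Ct 10 (Tl 1 27309) (Tl 3 27309)) (Ct 10 (Tl 3
2126749) (Tl 1 28783))); Lf (Tl 2 560196); Lf (Tl 2 533956); Dd 156; Dd 154;
Dd 156; Dd 156; Dd 154; Dd 154; Lf (Tl 2 7623)]; Dd 32; Nd 76 [:: Lf (Ct 1 (Ct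
12 (Tl 1 28758) (Tl 3 27298)) (Ct 11 (Tl 3 2126739) (Tl 1 27298))); Lf (Tl 2
27298); Lf (Tl 2 16474756); Dd 155; Dd 154; Dd 154; Dd 155; Dd 155; Dd 154; Lf
(Tl 2 16501028)]; Dd 71; Dd 32; Dd 71; Dd 71; Dd 71; Dd 32; Dd 7; Nd 154 [::
Lf (Tl 2 743908); Lf (Tl 2 27309); Lf (Tl 2 560228); Dd 155; Dd 156; Dd 156;
Dd 156; Dd 155; Lf (Ct 9 (Tl 1 22221) (Tl 3 7623)); Dd 155; Dd 174; Dd 174; Dd
174]; Dd 171; Dd 171; Dd 71; Dd 171; Dd 71]; Nd 13 [:: Lf (Tl 2 801499); Dd
15; Dd 15; Dd 15; Dd 15; Dd 15]; Nd 49 [:: Lf (Tl 2 203718); Lf (Tl 0 85618);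
Dd 50; Dd 50; Dd 50; Dd 50; Dd 50]; Dd 42; Dd 42; Dd 37; Nd 15 [:: Lf (Tl 2
203716); Dd 42; Dd 42; Dd 42; Dd 42]; Dd 55; Dd 13; Dd 37; Dd 13; Dd 55; Dd
42; Dd 13; Dd 37; Dd 13; Dd 13; Lf (Tl 2 617463); Dd 55; Dd 42; Dd 42; Lf (Tl
2 617473)]; Nd 8 [:: Lf (Tl 2 561019); Dd 64; Dd 64; Lf (Tl 2 616738); Dd 94;
Dd 94; Lf (Tl 2 17015188); Dd 64; Dd 94]; Nd 13 [:: Nd 94 [:: Lf (Tl 2
532498); Lf (Tl 2 9076); Dd 64; Dd 64; Dd 63; Lf (Ct 2 (Ct 16 (Tl 1 27219) (Tl
3 27219)) (Ct 16 (Tl 3 2126818) (Tl 1 28513))); Dd 63; Lf (Tl 2 561038); Dd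
63; Dd 64]; Nd 31 [:: Lf (Tl 0 7618); Lf (Tl 2 16500918); Dd 76; Dd 76; Dd 76;
Dd 76; Dd 76]; Dd 17; Lf (Tl 2 16474998); Dd 42; Dd 17; Dd 17; Dd 17; Dd 17;
Dd 42; Dd 17; Dd 17; Dd 42; Lf (Tl 2 27219)]; Nd 8 [:: Dd 6; Nd 10 [:: Dd 6;
Dd 6; Dd 6; Dd 6]; Dd 6; Nd 99 [:: Lf (Tl 2 620059); Lf (Tl 0 616738); Dd 100;
Dd 100; Dd 100; Dd 100; Dd 100]; Dd 10; Dd 64; Dd 6; Dd 72; Dd 10; Nd 10 [::
Dd 72; Dd 72; Dd 72; Dd 72]; Dd 72; Dd 72; Dd 10; Dd 10; Dd 6; Dd 10; Dd 6; Lf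
(Tl 2 17015998); Dd 100; Dd 72; Dd 72]; Nd 11 [:: Lf (Tl 2 620065); Dd 9; Dd
35; Dd 35; Dd 9; Dd 9; Dd 9; Dd 9; Dd 9; Dd 9; Dd 35; Lf (Tl 2 206553)]; Dd 8;
Dd 9; Nd 6 [:: Dd 8; Dd 8; Dd 8; Dd 8; Lf (Tl 2 28756); Dd 72; Dd 8; Dd 72; Dd
8; Dd 8; Lf (Tl 2 744718); Dd 72]; Nd 9 [:: Dd 7; Nd 11 [:: Dd 7; Dd 7; Dd 7;
Dd 7]; Dd 7; Nd 46 [:: Lf (Tl 0 27298); Lf (Tl 2 28758); Dd 48; Dd 48; Dd 48;
Dd 48; Dd 48]; Nd 35 [:: Dd 7; Dd 7; Dd 7; Dd 7]; Dd 35; Dd 35; Dd 11; Dd 31;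
Dd 7; Dd 35; Dd 11; Dd 11; Dd 7; Dd 11; Dd 11; Dd 7; Dd 46; Dd 35; Dd 35; Lf
(Tl 2 16477833)]; Dd 8; Dd 6; Lf (Ct 13 (Tl 1 7651) (Tl 3 2134634)); Dd 22; Dd
6; Lf (Ct 13 (Tl 3 590503) (Tl 1 1699635)); Dd 25; Nd 9 [:: Dd 1; Dd 8; Dd 1;
Lf (Tl 2 532183); Dd 8; Dd 1]; Dd 8; Dd 8; Nd 42 [:: Nd 48 [:: Lf (Ct 1 (Ct 13
(Tl 1 203718) (Tl 3 85618)) (Ct 13 (Tl 3 2204499) (Tl 1 85618))); Lf (Tl 2
16481236); Lf (Tl 2 85618); Dd 187; Dd 186; Dd 186; Dd 187; Dd 187; Dd 186; Lf
(Tl 2 16481588)]; Dd 17; Dd 17; Dd 17; Dd 17; Dd 13; Dd 13; Dd 13; Dd 17; Dd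
17; Dd 17; Lf (Tl 2 591553)]; Nd 8 [:: Dd 1; Dd 1; Dd 9; Dd 9; Lf (Tl 2
17209828); Dd 9; Dd 1; Dd 9; Dd 9]; Nd 9 [:: Dd 1; Dd 8; Dd 1; Dd 27; Dd 8; Dd
8; Dd 8; Dd 1]; Dd 16; Nd 72 [:: Dd 8; Dd 6; Nd 108 [:: Lf (Ct 2 (Ct 16 (Tl 1
85629) (Tl 3 85629)) (Ct 16 (Tl 3 2204509) (Tl 1 203743))); Lf (Tl 2 735156);
Lf (Tl 2 734836); Dd 187; Dd 188; Dd 188; Dd 188; Dd 187; Dd 187; Lf (Tl 2
85383)]; Dd 6; Dd 8; Dd 8; Dd 8; Dd 8; Dd 8; Dd 8; Dd 6; Lf (Tl 2 590503)]; Nd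
35 [:: Dd 9; Dd 9; Dd 11; Dd 9; Dd 9; Dd 11; Dd 11; Dd 9; Dd 9; Dd 9; Lf (Tl 2
16730553)]; Dd 8; Dd 35; Dd 42; Dd 9; Dd 17; Dd 35; Dd 1; Dd 37; Lf (Ct 15 (Tl
3 532183) (Tl 1 1596541)); Dd 56; Dd 1; Nd 1 [:: Dd 9; Lf (Tl 2 803038); Dd 8;
Dd 9]; Lf (Ct 15 (Tl 1 85411) (Tl 3 2204782)); Dd 61; Nd 8 [:: Lf (Tl 2
800779); Nd 2 [:: Dd 1; Dd 1; Dd 1; Dd 1]; Dd 3; Dd 11; Lf (Tl 2 17209588); Dd
1; Dd 2; Dd 1; Dd 11]; Dd 9; Dd 8; Dd 1; Dd 9; Dd 6; Dd 9; Nd 41 [:: Dd 16; Dd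
12; Dd 12; Dd 12; Dd 12; Dd 12; Dd 12; Dd 12; Dd 16; Lf (Tl 2 591543)]; Nd 34
[:: Nd 80 [:: Lf (Tl 2 203638); Lf (Tl 0 85378); Dd 82; Dd 82; Dd 82; Dd 82;
Dd 82]; Lf (Tl 2 16474918); Nd 87 [:: Lf (Ct 2 (Ct 15 (Tl 1 85378) (Tl 3
2204739)) (Ct 15 (Tl 3 85378) (Tl 1 203638))); Lf (Tl 2 16481556); Lf (Tl 2
85378); Dd 188; Dd 186; Dd 188; Dd 188; Dd 186; Dd 186; Lf (Tl 2 16483828)];
Dd 4; Dd 4; Dd 3; Dd 3; Dd 3; Dd 3; Dd 3; Dd 3; Dd 3; Dd 4; Lf (Tl 2
16730793)]; Dd 11; Dd 17; Dd 12; Dd 12; Dd 73; Dd 17; Dd 17; Nd 47 [:: Nd 16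
[:: Dd 17; Dd 17]; Nd 73 [:: Dd 41; Dd 41; Dd 41; Dd 41; Dd 35; Dd 41; Dd 35;
Nd 186 [:: Lf (Tl 2 85629); Lf (Tl 2 737428); Lf (Tl 2 735188); Dd 187; Dd
188; Dd 188; Dd 188; Dd 187; Dd 187; Lf (Ct 4 (Tl 1 203661) (Tl 3 85383)); Dd
209; Dd 209; Dd 209]; Dd 208; Dd 208; Dd 208]; Dd 12; Nd 12 [:: Dd 13; Dd 13;
Dd 13]; Dd 12; Dd 13; Dd 12; Dd 100; Dd 12; Dd 46; Dd 17; Dd 17; Dd 72; Dd
35]; Dd 73; Dd 73; Dd 63; Dd 9; Nd 100 [:: Nd 11 [:: Lf (Tl 2 203476); Dd 2;
Dd 2; Lf (Tl 2 800798); Dd 10; Dd 2]; Dd 73; Nd 11 [:: Dd 73; Dd 3; Dd 3]; Dd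
11; Dd 73; Dd 110; Dd 11]; Dd 9; Nd 8 [:: Dd 63; Dd 63; Dd 1; Dd 3; Dd 9; Dd
11; Dd 63; Dd 37; Dd 1; Dd 2; Dd 9; Dd 1; Dd 13; Dd 9]; Dd 8; Dd 12; Nd 94 [::
Dd 12; Dd 9; Dd 9; Dd 12; Dd 88; Dd 13]; Dd 12; Dd 9; Dd 8; Nd 1 [:: Dd 8; Dd
59; Dd 8; Dd 9; Dd 8]; Dd 8; Dd 9; Dd 41; Dd 72; Nd 73 [:: Dd 41; Dd 11; Dd 9;
Dd 41; Dd 42; Dd 9; Dd 41; Dd 42; Dd 42; Dd 88; Dd 88; Dd 88; Dd 88]; Dd 41;
Lf (Ct 16 (Tl 3 532503) (Tl 1 1596861)); Dd 112; Dd 11; Dd 94; Dd 13; Dd 11;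
Lf (Ct 16 (Tl 1 88291) (Tl 3 2207982)); Dd 118; Dd 112; Nd 64 [:: Lf (Tl 2
532503); Dd 112; Dd 63; Dd 94]; Nd 27 [:: Dd 59; Dd 56; Dd 37; Dd 56; Dd 55];
Dd 56; Nd 19 [:: Lf (Tl 2 597793); Lf (Tl 2 598113); Dd 21; Lf (Tl 2 20019);
Dd 33; Dd 21; Dd 33; Dd 22; Dd 21; Dd 22; Dd 33]; Dd 22; Nd 2 [:: Lf (Tl 2
616743); Dd 10; Dd 11]; Dd 8; Dd 8; Dd 97; Dd 97; Dd 8; Dd 8; Dd 12; Dd 12; Nd
39 [:: Dd 59; Dd 1; Dd 9; Nd 1 [:: Dd 8; Dd 9]; Dd 8; Dd 1; Dd 55]; Dd 8; Nd 1
[:: Dd 8; Dd 9; Dd 9; Dd 8]; Dd 146; Dd 8; Dd 9; Dd 9; Dd 17; Nd 6 [:: Nd 16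
[:: Dd 41; Dd 25; Dd 25; Dd 41]; Dd 25; Dd 72; Dd 41]; Dd 8; Nd 11 [:: Dd 9;
Dd 9; Dd 35; Dd 9; Dd 35; Dd 35; Nd 118 [:: Dd 13; Dd 42]; Dd 118]; Dd 8; Dd
9; Dd 9; Dd 9; Dd 9; Dd 9; Dd 9; Dd 17; Nd 72 [:: Dd 6; Dd 6; Dd 6; Dd 6; Dd
8; Dd 161; Dd 25]; Dd 8; Dd 161; Dd 161; Dd 25; Nd 3 [:: Lf (Tl 2 617553); Lf
(Tl 2 26499); Lf (Tl 2 591313); Dd 34; Dd 4; Dd 4; Dd 34; Dd 4; Dd 34; Dd 61;
Dd 61]; Nd 110 [:: Dd 94; Dd 9; Dd 2; Dd 94; Dd 100; Dd 166; Dd 118]; Dd 8; Dd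
9; Dd 88; Dd 110; Dd 88; Dd 61; Nd 35 [:: Dd 9; Dd 9; Dd 11; Dd 11; Dd 9; Dd
9; Dd 9; Dd 9; Dd 166; Dd 118]; Dd 9; Dd 88; Dd 110; Dd 166; Dd 88; Dd 166; Dd
88; Dd 118; Dd 88; Dd 88; Dd 88; Dd 88; Dd 88].

Definition bit (k n : nat) : Z := if odd (iter k half n) then 1%ZZ else 0%ZZ.
Definition cube_point (n : nat) : pt := (bit 0%N n, bit 1%N n, bit 2%N n, bit 3%N n).
Definition cube_simplices (i : nat) : seq (seq pt) :=
  map (map cube_point) (nth [::] [:: cube_triangulation_0; cube_triangulation_1;
    cube_triangulation_2; cube_triangulation_3] i).

(** * Edges in the presence of the standard simplex *)

Definition std : seq pt := [:: p0; (0, 0, 0, 1); (0, 0, 1, 0); (0, 1, 0, 0); (1, 0, 0, 0)]%ZZ.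

Definition cong (n : Z) (u v : pt) : bool :=
  let: (a, b, c, d) := psub u v in
  ((a mod n =? 0) && (b mod n =? 0) && (c mod n =? 0) && (d mod n =? 0))%ZZ.

Lemma congP n u v : (n <> 0)%ZZ -> cong n u v -> exists w, u = padd v (pscale n w).
Proof.
move=> n0; pt_cases; rewrite /cong /= => /andP[/andP[/andP[]]].
move=> /Z.eqb_spec/Z.mod_divide-/(_ n0)[a ea] /Z.eqb_spec/Z.mod_divide-/(_ n0)[b eb].
move=> /Z.eqb_spec/Z.mod_divide-/(_ n0)[c ec] /Z.eqb_spec/Z.mod_divide-/(_ n0)[d ed].
by exists (a, b, c, d); rewrite /=; pt_eq; lia.
Qed.

Definition parity := (bool * bool * bool * bool)%type.
Definition par (v : pt) : parity :=
  let: (a, b, c, d) := v in (Z.odd a, Z.odd b, Z.odd c, Z.odd d).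
Definition pxor (p q : parity) : parity :=
  let: (a, b, c, d) := p in let: (a', b', c', d') := q in
  (xorb a a', xorb b b', xorb c c', xorb d d').
Definition pweight (p : parity) : nat := let: (a, b, c, d) := p in (a + b + c + d)%N.

(* Modulo 2, and completed by the coordinate making the sum even, an edge of
   the standard simplex has two odd barycentric coordinates out of five; the
   remaining five nonzero classes have four. *)
Definition short (p : parity) := (pweight p == 1%N) || (pweight p == 2%N).
Definition long (p : parity) := (pweight p == 3%N) || (pweight p == 4%N).

Lemma par_sub u v : par (psub u v) = pxor (par u) (par v).
Proof. by pt_cases; rewrite /= !Z.odd_sub. Qed.

Lemma par_eq u v : par u = par v -> exists w, u = padd v (pscale 2 w).
Proof.
pt_cases => -[]; have od a b : Z.odd a = Z.odd b -> exists c, a = (b + 2 * c)%ZZ.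
  move=> e; have := Z.div2_odd a; have := Z.div2_odd b; rewrite e => eb ea.
  by exists (Z.div2 a - Z.div2 b)%ZZ; lia.
move=> /od[a ->] /od[b ->] /od[c ->] /od[d ->].
by exists (a, b, c, d).
Qed.

Definition std_edges : seq pt :=
  [seq psub b a | a <- std, b <- [seq x <- std | ~~ peqb x a]].

Lemma std_edgesP v : memp v std_edges -> edge_of std v.
Proof.
have : all (fun v => has (fun i => has (fun j => (i != j) && peqb v (psub (nth p0 std j) (nth p0 std i)))
   (iota 0 5)) (iota 0 5)) std_edges by vm_compute.
move=> /allP h; rewrite mempP => /h /hasP[i] + /hasP[j].
rewrite !mem_iota => /andP[_ i5] /andP[_ j5] /andP[ij /peqbP ->].
by exists i, j.
Qed.

Lemma edge_of_std v : edge_of std v -> memp v std_edges.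
Proof.
have : all (fun i => all (fun j => (i != j) ==> memp (psub (nth p0 std j) (nth p0 std i)) std_edges)
   (iota 0 5)) (iota 0 5) by vm_compute.
move=> /allP h [i [j [i5 j5 ij ->]]].
have := h i; rewrite mem_iota => /(_ i5) /allP/(_ j); rewrite mem_iota => /(_ j5).
by rewrite ij.
Qed.

(** A bound satisfied by sums of k edges of the standard simplex. With the fifth coordinate [e],
    vectors are written in barycentric coordinates, where these edges are differences of two unit
    vectors. *)
Definition small (k : Z) (v : pt) : Prop :=
  let: (a, b, c, d) := v in let e := (- (a + b + c + d))%ZZ in
  (Z.abs a <= k /\ Z.abs b <= k /\ Z.abs c <= k /\ Z.abs d <= k /\ Z.abs e <= k /\
   Z.abs a + Z.abs b + Z.abs c + Z.abs d + Z.abs e <= 2 * k)%ZZ.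

Lemma small_add k m u v : small k u -> small m v -> small (k + m) (padd u v).
Proof.
case: u v => [[[a b] c] d] [[[a' b'] c'] d']; rewrite /small /=.
have -> : (- (a + a' + (b + b') + (c + c') + (d + d')) =
  - (a + b + c + d) + - (a' + b' + c' + d'))%ZZ by lia.
have := Z.abs_triangle a a'; have := Z.abs_triangle b b'; have := Z.abs_triangle c c'.
have := Z.abs_triangle d d'.
have := Z.abs_triangle (- (a + b + c + d)) (- (a' + b' + c' + d')).
move: (Z.abs (_ + _)) (Z.abs (a + a')) (Z.abs (b + b')) (Z.abs (c + c')) (Z.abs (d + d'))%ZZ.
move: (Z.abs (- _)) (Z.abs (- _)) (Z.abs a) (Z.abs b) (Z.abs c) (Z.abs d)%ZZ.
move: (Z.abs a') (Z.abs b') (Z.abs c') (Z.abs d') => *; lia.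
Qed.

Lemma small_le k m v : (k <= m)%ZZ -> small k v -> small m v.
Proof.
pt_cases; rewrite /small; move: (Z.abs _) (Z.abs _) (Z.abs _) (Z.abs _) (Z.abs _) => *.
lia.
Qed.

Lemma std_edges_small v : memp v std_edges -> small 1 v.
Proof.
have : all (fun v : pt => let: (a, b, c, d) := v in let e := (- (a + b + c + d))%ZZ in
  [&& Z.abs a <=? 1, Z.abs b <=? 1, Z.abs c <=? 1, Z.abs d <=? 1, Z.abs e <=? 1 &
   Z.abs a + Z.abs b + Z.abs c + Z.abs d + Z.abs e <=? 2]%ZZ) std_edges by vm_compute.
move=> /allP h; rewrite mempP => /h; case: v => [[[a b] c] d].
by move=> /and5P[/Z.leb_spec0 ? /Z.leb_spec0 ? /Z.leb_spec0 ? /Z.leb_spec0 ? /andP[/Z.leb_spec0 ? /Z.leb_spec0 ?]].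
Qed.

Definition zrange := [:: -3; -2; -1; 0; 1; 2; 3]%ZZ.
Definition oriented (v : pt) := memp v positive_edges || memp (psub p0 v) positive_edges.

(** The alternatives: v is too large, is listed, is even ([edge_odd]), or must be an edge of [std]
    by [edge_residue] with k / m one of 1/2, 1/3, 2/3. The coordinates are reversed because [std]
    lists the last unit vector first. *)
Definition small_edge_test (v : pt) : bool :=
  let: (a, b, c, d) := v in let e := (- (a + b + c + d))%ZZ in
  (6 <? Z.abs a + Z.abs b + Z.abs c + Z.abs d + Z.abs e)%ZZ || oriented v || cong 2 v p0 ||
  has (fun km : Z * Z => let: (k, m) := km in
    (k * e) mod m + (k * d) mod m + (k * c) mod m + (k * b) mod m + (k * a) mod m =? m)%ZZ
    [:: (1, 2); (1, 3); (2, 3)]%ZZ.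

Lemma small_edges_checked : all (fun a => all (fun b => all (fun c => all (fun d =>
  small_edge_test (a, b, c, d)) zrange) zrange) zrange) zrange.
Proof. by vm_compute. Qed.

Lemma zrangeP a : (Z.abs a <= 3)%ZZ -> a \in zrange.
Proof.
move=> h; have : (a = -3 \/ a = -2 \/ a = -1 \/ a = 0 \/ a = 1 \/ a = 2 \/ a = 3)%ZZ by lia.
by do 6?case=> [->//|]; move=> ->.
Qed.

Lemma std_edges_oriented : all oriented std_edges.
Proof. by vm_compute. Qed.

Section StandardFamily.
Variables (K : seq pt -> Prop) (HK : simplex_family K) (Kstd : K std).

Lemma small_edge v : edge K v -> small 3 v -> oriented v.
Proof.
move=> ev; have := ev; case: v => [[[a b] c] d] in ev * => _ [ha [hb [hc [hd [he hs]]]]].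
have /allP/(_ _ (zrangeP ha))/allP/(_ _ (zrangeP hb))/allP/(_ _ (zrangeP hc))/allP/(_ _ (zrangeP hd))
  := small_edges_checked.
move=> /orP[/orP[/orP[/Z.ltb_spec0|//]|]|].
- by lia.
- by move=> /congP[]// w e; case: (edge_odd HK (w := w) ev); rewrite e paddC padd0.
move=> /hasP[[k m] km] /Z.eqb_spec res.
have k0 : (0 < k < m)%ZZ by move: km; rewrite !inE => /or3P[] /eqP[-> ->].
have /edge_of_std : edge_of std (a, b, c, d).
  apply: (edge_residue HK Kstd ev _ _ k0 res); last lia.
  by rewrite /std /=; pt_eq; lia.
by rewrite mempP => vS; have /allP/(_ _ vS) := std_edges_oriented.
Qed.

(** Each short parity is that of an edge of [std], so [edge_cong2] applies. *)
Lemma short_edge v : edge K v -> short (par v) -> memp v std_edges.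
Proof.
move=> ev sv.
have [u uS pu] : exists2 u, memp u std_edges & par u = par v.
  move: sv; case: (par v) => [[[a b] c] d].
  case: a b c d => -[] [] [] //= _;
  first [by exists (1, 0, 0, 0)%ZZ|by exists (0, 1, 0, 0)%ZZ|by exists (0, 0, 1, 0)%ZZ
   |by exists (0, 0, 0, 1)%ZZ|by exists (1, -1, 0, 0)%ZZ|by exists (1, 0, -1, 0)%ZZ
   |by exists (1, 0, 0, -1)%ZZ|by exists (0, 1, -1, 0)%ZZ|by exists (0, 1, 0, -1)%ZZ
   |by exists (0, 0, 1, -1)%ZZ].
have [i [j [i5 j5 ij uE]]] := std_edgesP uS.
have eu : edge K u.
  rewrite uE; apply: (edge_sub HK Kstd); rewrite ?mem_nth //.
  by rewrite nth_uniq // (fam_uniq HK Kstd).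
have [w vw] := par_eq (esym pu).
have [->//|->] := edge_cong2 HK ev eu vw.
apply: edge_of_std; exists j, i; split=> //; first by rewrite eq_sym.
by rewrite uE; move: (nth p0 std i) (nth p0 std j); pt_lia.
Qed.
End StandardFamily.

Definition bools := [:: false; true].
Definition parities : seq parity :=
  flatten [seq flatten [seq flatten [seq [seq (a, b, c, d) | d <- bools]
    | c <- bools] | b <- bools] | a <- bools].
Definition even_parity : parity := (false, false, false, false).

Definition peq (p q : parity) : bool := pweight (pxor p q) == 0%N.

Definition independent (q1 q2 q3 q4 : parity) : bool :=
  all (fun p => ~~ peq p even_parity)
    [:: q1; q2; q3; q4; pxor q1 q2; pxor q1 q3; pxor q1 q4; pxor q2 q3; pxor q2 q4; pxor q3 q4;
        pxor q1 (pxor q2 q3); pxor q1 (pxor q2 q4); pxor q1 (pxor q3 q4); pxor q2 (pxor q3 q4);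
        pxor (pxor q1 q2) (pxor q3 q4)].

(** The vertices 0 and q1 are joined by a path of at most three short edges. *)
Definition short_path (q1 q2 q3 q4 : parity) : bool :=
  short q1 ||
  has (fun q => short q && short (pxor q1 q)) [:: q2; q3; q4] ||
  has (fun q : parity * parity => [&& short q.1, short (pxor q.2 q.1) & short (pxor q1 q.2)])
    [:: (q2, q3); (q2, q4); (q3, q2); (q3, q4); (q4, q2); (q4, q3)].

(** A cut of five vertices has four or six edges, and at most five are long, so long edges can
    separate 0 from q1 only by isolating one vertex. The other six edges are then short, because two
    distinct long classes differ by a short one. *)
Definition apex_at_0 (q1 q2 q3 q4 : parity) : bool :=
  [&& all long [:: q1; q2; q3; q4], short (pxor q2 q1), short (pxor q3 q1), short (pxor q4 q1),
      short (pxor q3 q2), short (pxor q4 q2) & short (pxor q4 q3)].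

Definition apex_at_1 (q1 q2 q3 q4 : parity) : bool :=
  [&& all long [:: q1; pxor q2 q1; pxor q3 q1; pxor q4 q1], short q2, short q3, short q4,
      short (pxor q3 q2), short (pxor q4 q2) & short (pxor q4 q3)].

(* Five affinely independent parities form five vertices joined by at most
   five long edges. *)
Lemma parity_graph : all (fun q1 => all (fun q2 => all (fun q3 => all (fun q4 =>
  if short_path q1 q2 q3 q4 then true else if ~~ independent q1 q2 q3 q4 then true else
  apex_at_0 q1 q2 q3 q4 || apex_at_1 q1 q2 q3 q4)
  parities) parities) parities) parities.
Proof. by vm_compute. Qed.

Lemma mem_parities q : q \in parities.
Proof. by case: q => [[[[] []] []] []]. Qed.

Lemma paddE u v : padd u v = (u + v)%R :> Z * Z * Z * Z.
Proof. by pt_cases. Qed.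

Lemma zcomb_map (f : pt -> Z) X :
  zcomb (map f X) X = (\sum_(x <- X) (pscale (f x) x : Z * Z * Z * Z))%R.
Proof. by elim: X => [|x X IH]; rewrite ?big_nil ?big_cons //= IH paddE. Qed.

Lemma zcomb_perm (c : seq Z) (X X' : seq pt) : uniq X -> size c = size X -> perm_eq X X' ->
  exists2 c', perm_eq c c' & zcomb c X = zcomb c' X'.
Proof.
move=> uX sc XX'; pose f x := nth 0%ZZ c (index x X).
have cE : c = map f X.
  apply: (@eq_from_nth _ 0%ZZ) => [|i ic]; first by rewrite size_map.
  by rewrite (nth_map p0) -?sc // /f index_uniq // -sc.
exists (map f X'); first by rewrite {1}cE perm_map.
by rewrite {1}cE !zcomb_map (perm_big _ XX').
Qed.

Definition zsum_abs (c : seq Z) : Z := zsum (map Z.abs c).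

Lemma zsum_perm c c' : perm_eq c c' -> zsum c = zsum c'.
Proof.
have E l : zsum l = (\sum_(x <- l) (x : Z))%R.
  by elim: l => [|x l IH]; rewrite ?big_nil ?big_cons //= -IH.
by move=> cc; rewrite !E (perm_big _ cc).
Qed.

Lemma small_zcomb_std c k : size c = 5%N -> zsum c = 0%ZZ ->
  all (fun x => Z.abs x <=? k)%ZZ c -> (zsum_abs c <= 2 * k)%ZZ -> small k (zcomb c std).
Proof.
case: c => [|a [|b [|c [|d [|e []]]]]] // _.
have -> : zcomb [:: a; b; c; d; e] std = (e, d, c, b).
  by rewrite /std /p0 /=; pt_eq; lia.
rewrite /zsum_abs /zsum /= => s0.
move=> /and5P[/Z.leb_spec0 ha /Z.leb_spec0 hb /Z.leb_spec0 hc /Z.leb_spec0 hd /andP[/Z.leb_spec0 he _]] hs.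
have aE : a = (- (e + d + c + b))%ZZ by lia.
rewrite -aE; move: ha hb hc hd he hs.
by move: (Z.abs a) (Z.abs b) (Z.abs c) (Z.abs d) (Z.abs e) => *; lia.
Qed.

Lemma smallN k v : small k v -> small k (psub p0 v).
Proof.
case: v => [[[a b] c] d]; rewrite /small /=.
have e x : Z.abs (0 - x)%ZZ = Z.abs x by lia.
have -> : Z.abs (- (0 - a + (0 - b) + (0 - c) + (0 - d)))%ZZ = Z.abs (- (a + b + c + d))%ZZ by lia.
by rewrite !e.
Qed.

Definition facet_test (t2 t3 t4 : pt) : bool :=
  has (fun x1 => has (fun s =>
    let x2 := padd x1 (pscale s t2) in let x3 := padd x1 (pscale s t3) in
    let x4 := padd x1 (pscale s t4) in
    let x0 := head p0 [seq x <- std | ~~ memp x [:: x1; x2; x3; x4]] in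
    all (fun x => memp x [:: x0; x1; x2; x3; x4]) std) [:: 1; -1]%ZZ) std.

Lemma facets_checked : all (fun t2 => all (fun t3 =>
  if memp (psub t3 t2) std_edges then
    all (fun t4 => if memp (psub t4 t2) std_edges then
      if memp (psub t4 t3) std_edges then facet_test t2 t3 t4 else true else true) std_edges
  else true) std_edges) std_edges.
Proof. by vm_compute. Qed.

Lemma sign_diff s (x t : pt) : (s = 1 \/ s = -1)%ZZ ->
  t = pscale s (psub (padd x (pscale s t)) x).
Proof. by case=> ->; pt_lia. Qed.

(** The edges of [std] are the roots of A_4. Four points whose six differences are all roots form a
    translate of a facet of the simplex or of its negative; [s] is the sign. *)
Lemma facetP t2 t3 t4 : memp t2 std_edges -> memp t3 std_edges -> memp t4 std_edges ->
  memp (psub t3 t2) std_edges -> memp (psub t4 t2) std_edges -> memp (psub t4 t3) std_edges ->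
  exists x0 x1 x2 x3 x4 s, [/\ perm_eq std [:: x0; x1; x2; x3; x4], (s = 1 \/ s = -1)%ZZ,
    t2 = pscale s (psub x2 x1), t3 = pscale s (psub x3 x1) & t4 = pscale s (psub x4 x1)].
Proof.
rewrite (mempP t2) (mempP t3) (mempP t4) => h2 h3 h4 h32 h42 h43.
have /allP/(_ _ h2)/allP/(_ _ h3) := facets_checked.
rewrite h32 => /allP/(_ _ h4); rewrite h42 h43 => /hasP[x1 _ /hasP[s hs h]].
have s1 : (s = 1 \/ s = -1)%ZZ by move: hs; rewrite !inE => /orP[] /eqP->; auto.
pose x2 := padd x1 (pscale s t2); pose x3 := padd x1 (pscale s t3).
pose x4 := padd x1 (pscale s t4).
pose x0 := head p0 [seq x <- std | ~~ memp x [:: x1; x2; x3; x4]].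
have {}h : all (fun x => memp x [:: x0; x1; x2; x3; x4]) std := h.
move: h => /allP h; exists x0, x1, x2, x3, x4, s.
split; [|exact: s1|exact: sign_diff|exact: sign_diff|exact: sign_diff].
have sub : {subset std <= [:: x0; x1; x2; x3; x4]} by move=> x /h; rewrite mempP.
have [|_ e] := uniq_min_size (isT : uniq std) sub; first by [].
by apply: uniq_perm => //; exact: (leq_size_uniq (isT : uniq std) sub).
Qed.

Lemma edge_of_short v : edge_of std v -> short (par v).
Proof.
move=> /edge_of_std; rewrite mempP.
have : all (fun v => short (par v)) std_edges by vm_compute.
by move=> /allP h /h.
Qed.

Lemma short_long q : short q -> long q -> False.
Proof. by case: q => [[[[] []] []] []]. Qed.

Section StandardFamily.
Variables (K : seq pt -> Prop) (HK : simplex_family K) (Kstd : K std).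

(** The facet opposite [a] has only short edges, hence is a copy of a facet of [std] up to sign,
    while the long edges at [a] are not edges of [std]. So [apex] applies. *)
Lemma apex_small a b y2 y3 y4 : K [:: a; b; y2; y3; y4] ->
  long (par (psub a b)) -> long (par (psub a y2)) -> long (par (psub a y3)) -> long (par (psub a y4)) ->
  short (par (psub y2 b)) -> short (par (psub y3 b)) -> short (par (psub y4 b)) ->
  short (par (psub y3 y2)) -> short (par (psub y4 y2)) -> short (par (psub y4 y3)) ->
  small 3 (psub a b).
Proof.
move=> KY l1 l2 l3 l4 s2 s3 s4 s32 s42 s43.
have uY := fam_uniq HK KY.
have ed i j : (i < 5)%N -> (j < 5)%N -> i != j ->
    edge K (psub (nth p0 [:: a; b; y2; y3; y4] j) (nth p0 [:: a; b; y2; y3; y4] i)).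
  by move=> i5 j5 ij; apply: (edge_sub HK KY); rewrite ?mem_nth ?nth_uniq.
have m2 := short_edge HK Kstd (ed 1 2 isT isT isT)%N s2.
have m3 := short_edge HK Kstd (ed 1 3 isT isT isT)%N s3.
have m4 := short_edge HK Kstd (ed 1 4 isT isT isT)%N s4.
have m32 := short_edge HK Kstd (ed 2 3 isT isT isT)%N s32.
have m42 := short_edge HK Kstd (ed 2 4 isT isT isT)%N s42.
have m43 := short_edge HK Kstd (ed 3 4 isT isT isT)%N s43.
have bb (u v : pt) : psub (psub u b) (psub v b) = psub u v by pt_lia.
have [||| x0 [x1 [x2 [x3 [x4 [s [px s1 e2 e3 e4]]]]]]] := @facetP _ _ _ m2 m3 m4;
  rewrite ?bb //.
have KX := fam_perm HK Kstd px.
have nX v : long (par v) -> ~ edge_of [:: x0; x1; x2; x3; x4] v.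
  move=> lv [i [j [i5 j5 ij vE]]].
  have lS k : (k < 5)%N -> (index (nth p0 [:: x0; x1; x2; x3; x4] k) std < 5)%N.
    by move=> k5; rewrite -[5%N]/(size std) index_mem (perm_mem px) mem_nth.
  apply: (@short_long (par v)) => //; apply: edge_of_short.
  exists (index (nth p0 [:: x0; x1; x2; x3; x4] i) std), (index (nth p0 [:: x0; x1; x2; x3; x4] j) std).
  have inS k : (k < 5)%N -> nth p0 [:: x0; x1; x2; x3; x4] k \in std.
    by move=> k5; rewrite (perm_mem px) mem_nth.
  split; rewrite ?lS //; last by rewrite !nth_index ?inS.
  apply/eqP => e; have := congr1 (nth p0 std) e; rewrite !nth_index ?inS //.
  by move/eqP; rewrite nth_uniq ?(negbTE ij) //; exact: (fam_uniq HK KX).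
have [c0 [c1 [c2 [c3 [c4 [cX cs ca cb]]]]]] :=
  apex HK KX KY s1 e2 e3 e4 (nX _ l1) (nX _ l2) (nX _ l3) (nX _ l4).
rewrite cX; have px' := px; rewrite perm_sym in px'.
have [c' cc ->] := zcomb_perm (fam_uniq HK KX) (erefl : size [:: c0; c1; c2; c3; c4] = 5%N) px'.
apply: small_zcomb_std.
- by rewrite -(perm_size cc).
- by rewrite -(zsum_perm cc) /zsum /=; move: cs; clear; lia.
- rewrite -(perm_all _ cc) /=; case: cb => ? [? [? [? ?]]].
  by repeat (apply/andP; split); rewrite ?andbT //; apply/Z.leb_spec0.
- rewrite /zsum_abs -(zsum_perm (perm_map _ cc)) /zsum /=; move: ca; clear.
  by move: (Z.abs c0) (Z.abs c1) (Z.abs c2) (Z.abs c3) (Z.abs c4) => *; lia.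
Qed.

(** If a nonempty partial sum of the vertices were 2 w, writing w in integral coordinates by
    unimodularity would give a dependency with an odd coefficient. *)
Lemma par_independent y1 y2 y3 y4 : K [:: p0; y1; y2; y3; y4] ->
  independent (par y1) (par y2) (par y3) (par y4).
Proof.
move=> KY.
pose f (b : bool) (y : pt) := if b then y else p0.
have key (b1 b2 b3 b4 : bool) : b1 || b2 || b3 || b4 ->
    ~~ peq (par (padd (f b1 y1) (padd (f b2 y2) (padd (f b3 y3) (f b4 y4))))) even_parity.
  move=> bb; apply/negP => e.
  have [w wE] : exists w, padd (f b1 y1) (padd (f b2 y2) (padd (f b3 y3) (f b4 y4))) = padd p0 (pscale 2 w).
    apply: par_eq; move: e; rewrite /peq; move: (par _) => [[[[] []] []] []] //=.
  have [c0 [c1 [c2 [c3 [c4 [wY cs]]]]]] := unimodular0 HK w KY.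
  pose z (b : bool) : Z := if b then 1%ZZ else 0%ZZ.
  pose c := [:: (z b1 + z b2 + z b3 + z b4) * -1 - 2 * c0; z b1 - 2 * c1; z b2 - 2 * c2; z b3 - 2 * c3; z b4 - 2 * c4]%ZZ.
  have sc : zsum c = 0%ZZ by rewrite /c /zsum /=; lia.
  have cY : zcomb c [:: p0; y1; y2; y3; y4] = p0.
    move: wE; rewrite wY /c /f /z; clear; case: b1 b2 b3 b4 => -[] [] []; pt_lia'.
  have ci := fam_indep HK KY (erefl : size c = 5%N) sc cY.
  have := ci 1%N isT; have := ci 2%N isT; have := ci 3%N isT; have := ci 4%N isT.
  by rewrite /c /= /z; move: bb; clear; case: b1 b2 b3 b4 => -[] [] [] //= _; lia.
have px u v : par (padd u v) = pxor (par u) (par v).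
  by clear; pt_cases; rewrite /= !Z.odd_add.
have p00 : par p0 = even_parity by [].
rewrite /independent /= !andbT.
move: (key true false false false isT) (key false true false false isT) (key false false true false isT)
  (key false false false true isT) (key true true false false isT) (key true false true false isT)
  (key true false false true isT) (key false true true false isT) (key false true false true isT)
  (key false false true true isT) (key true true true false isT) (key true true false true isT)
  (key true false true true isT) (key false true true true isT) (key true true true true isT).
have x0 q : pxor q even_parity = q by case: q => [[[[] []] []] []].
have x0' q : pxor even_parity q = q by case: q => [[[[] []] []] []].
have xA p q r : pxor p (pxor q r) = pxor (pxor p q) r.
  by case: p q r => [[[? ?] ?] ?] [[[? ?] ?] ?] [[[? ?] ?] ?]; rewrite /= !Bool.xorb_assoc.
cbv beta iota delta [f]; rewrite !px !p00 !x0' !x0 -xA.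
by do 15!move=> ->.
Qed.
End StandardFamily.

(* An injective linear form on small vectors; it orients the edges. *)
Definition code (v : pt) : Z :=
  let: (a, b, c, d) := v in (((a * 5 + b) * 5 + c) * 5 + d)%ZZ.

Lemma code_add u v : code (padd u v) = (code u + code v)%ZZ.
Proof. by pt_cases; rewrite /code /=; lia. Qed.
Lemma code_sub u v : code (psub u v) = (code u - code v)%ZZ.
Proof. by pt_cases; rewrite /code /=; lia. Qed.
Lemma code_p0 : code p0 = 0%ZZ. Proof. by []. Qed.

Definition positive (v : pt) : bool := memp v positive_edges.

Lemma positive_code v : positive v -> (0 < code v)%ZZ.
Proof.
have : all (fun v => 0 <? code v)%ZZ positive_edges by vm_compute.
by rewrite /positive mempP => /allP h /h /Z.ltb_spec0.
Qed.

Lemma oriented_positive v : oriented v -> (0 <= code v)%ZZ -> positive v.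
Proof.
move=> /orP[//|/positive_code]; rewrite code_sub code_p0; lia.
Qed.

(** * Normal forms of simplices, their patterns and conflicts *)

Fixpoint cliques (k : nat) (l : seq pt) : seq (seq pt) :=
  if k is k'.+1 then
    flatten [seq map (cons v) (cliques k' [seq w <- l | positive (psub w v)]) | v <- l]
  else [:: [::]].

Lemma mem_cliques k l s : size s = k -> {subset s <= l} ->
  pairwise (fun u v => positive (psub v u)) s -> s \in cliques k l.
Proof.
elim: k l s => [|k IH] l [|v s] //= [sz] sub /andP[vs ps].
apply/flattenP; exists (map (cons v) (cliques k [seq w <- l | positive (psub w v)])).
  by apply: map_f; apply: sub; rewrite mem_head.
apply: map_f; apply: IH => // w ws.
by rewrite mem_filter (allP vs _ ws) sub // in_cons ws orbT.
Qed.

Definition candidates := map (cons p0) (cliques 4 positive_edges).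

Fixpoint diffs (x : seq pt) : seq pt :=
  if x is a :: r then map (fun b => psub b a) r ++ diffs r else [::].
Fixpoint pairs (x : seq pt) : seq (pt * pt) :=
  if x is a :: r then map (fun b => (a, b)) r ++ pairs r else [::].
Fixpoint triangles (x : seq pt) : seq (pt * pt) :=
  if x is a :: r then pairs (map (fun b => psub b a) r) ++ triangles r else [::].

Section StandardFamily.
Variables (K : seq pt -> Prop) (HK : simplex_family K) (Kstd : K std).

(** By [parity_graph], either v is a sum of at most three short edges, or one end of v is an apex
    and [apex_small] applies. In both cases v is small enough for [small_edge]. *)
Lemma edge_oriented v : edge K v -> oriented v.
Proof.
move=> ev; have [y2 [y3 [y4 KY]]] := edge_list HK ev.
have uY := fam_uniq HK KY.
have ed i j : (i < 5)%N -> (j < 5)%N -> i != j ->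
    edge K (psub (nth p0 [:: p0; v; y2; y3; y4] j) (nth p0 [:: p0; v; y2; y3; y4] i)).
  by move=> i5 j5 ij; apply: (edge_sub HK KY); rewrite ?mem_nth ?nth_uniq.
have sub0 (u : pt) : psub u p0 = u by pt_lia.
have shortS i j : (i < 5)%N -> (j < 5)%N -> i != j -> 
    short (par (psub (nth p0 [:: p0; v; y2; y3; y4] j) (nth p0 [:: p0; v; y2; y3; y4] i))) ->
    small 1 (psub (nth p0 [:: p0; v; y2; y3; y4] j) (nth p0 [:: p0; v; y2; y3; y4] i)).
  by move=> i5 j5 ij sh; apply: std_edges_small; apply: (short_edge HK Kstd) => //; apply: ed.
have xC p q : pxor p q = pxor q p.
  by case: p q => [[[[] []] []] []] [[[[] []] []] []].
have parN u : par (psub p0 u) = par u.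
  by rewrite par_sub; case: (par u) => [[[[] []] []] []].
have path2 i : (1 < i < 5)%N -> short (par (nth p0 [:: p0; v; y2; y3; y4] i)) ->
    short (pxor (par v) (par (nth p0 [:: p0; v; y2; y3; y4] i))) -> small 3 v.
  move=> /andP[i1 i5] s1 s2; apply: (@small_le 2) => //.
  have -> : v = padd (psub (nth p0 [:: p0; v; y2; y3; y4] i) p0)
                     (psub v (nth p0 [:: p0; v; y2; y3; y4] i)).
    by move: (nth p0 _ i); pt_lia.
  apply: (@small_add 1 1).
    by apply: (shortS 0%N i) => //; rewrite ?sub0 // eq_sym -lt0n ltnW.
  by apply: (shortS i 1%N) => //; rewrite ?par_sub // gtn_eqF.
have path3 i j : (1 < i < 5)%N -> (1 < j < 5)%N -> i != j ->
    short (par (nth p0 [:: p0; v; y2; y3; y4] i)) ->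
    short (pxor (par (nth p0 [:: p0; v; y2; y3; y4] j)) (par (nth p0 [:: p0; v; y2; y3; y4] i))) ->
    short (pxor (par v) (par (nth p0 [:: p0; v; y2; y3; y4] j))) -> small 3 v.
  move=> /andP[i1 i5] /andP[j1 j5] ij s1 s2 s3.
  have -> : v = padd (padd (psub (nth p0 [:: p0; v; y2; y3; y4] i) p0)
       (psub (nth p0 [:: p0; v; y2; y3; y4] j) (nth p0 [:: p0; v; y2; y3; y4] i)))
                     (psub v (nth p0 [:: p0; v; y2; y3; y4] j)).
    by move: (nth p0 _ i) (nth p0 _ j); pt_lia.
  apply: (@small_add 2 1); first apply: (@small_add 1 1).
  - by apply: (shortS 0%N i) => //; rewrite ?sub0 // eq_sym -lt0n ltnW.
  - by apply: (shortS i j) => //; rewrite ?par_sub.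
  - by apply: (shortS j 1%N) => //; rewrite ?par_sub // gtn_eqF.
apply: (small_edge HK Kstd ev).
have /allP/(_ _ (mem_parities (par v)))/allP/(_ _ (mem_parities (par y2))) := parity_graph.
move=> /allP/(_ _ (mem_parities (par y3)))/allP/(_ _ (mem_parities (par y4))).
rewrite (par_independent HK KY) /=; case: ifP => [|_].
  move=> /orP[/orP[sv|h]|h] _.
  - apply: (@small_le 1) => //; rewrite -(sub0 v).
    by apply: (shortS 0%N 1%N) => //=; rewrite sub0.
  - move: h; rewrite /= orbF => /or3P[] /andP[a b].
    + exact: (path2 2%N).
    + exact: (path2 3%N).
    + exact: (path2 4%N).
  - move: h; rewrite /= orbF => /orP[|/orP[|/orP[|/orP[|/orP[]]]]] /and3P[a b c].
    + exact: (path3 2%N 3%N).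
    + exact: (path3 2%N 4%N).
    + exact: (path3 3%N 2%N).
    + exact: (path3 3%N 4%N).
    + exact: (path3 4%N 2%N).
    + exact: (path3 4%N 3%N).
move=> /orP[] /and5P[/and5P[l1 l2 l3 l4 _] s2 s3 s4 /and3P[s32 s42 s43]].
  have -> : v = psub p0 (psub p0 v) by pt_lia.
  by apply: smallN; apply: (apex_small HK Kstd KY); rewrite ?parN // par_sub.
rewrite -(sub0 v).
have KY' : K [:: v; p0; y2; y3; y4].
  by apply: (fam_perm HK KY); rewrite (perm_catCA [:: p0] [:: v] [:: y2; y3; y4]).
by apply: (apex_small HK Kstd KY'); rewrite ?sub0 // par_sub // xC.
Qed.
End StandardFamily.

Definition pattern (x : seq pt) : seq nat :=
  let d := diffs x in
  [seq let i := find (memp^~ d) ol in if (i < 7)%N then i.+1 else 0%N | ol <- parity_classes].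

Definition self_compatible (x : seq pt) : bool :=
  let d := diffs x in all (fun ol => (count (memp^~ d) ol < 2)%N) parity_classes.

Definition compatible (p q : seq nat) : bool :=
  all2 (fun a b => [|| a == 0%N, b == 0%N | a == b]) p q.

(* Triangles whose barycentres differ by a lattice vector are translates of each
   other. *)
Definition triangle_conflict (x y : seq pt) : bool :=
  let ty := triangles y in
  has (fun t => has (fun t' : pt * pt => cong 3 (padd t.1 t.2) (padd t'.1 t'.2) &&
    ~~ (peqb t.1 t'.1 && peqb t.2 t'.2)) ty) (triangles x).

Lemma all2_map_diag (S T : Type) (r : T -> T -> bool) (f g : S -> T) C :
  all2 r (map f C) (map g C) = all (fun c => r (f c) (g c)) C.
Proof. by elim: C => //= c C ->. Qed.

Lemma all_diffs P x : all P (diffs x) = pairwise (fun u v => P (psub v u)) x.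
Proof. by elim: x => //= a r IH; rewrite all_cat all_map IH. Qed.

Lemma padd_shift k (u v w : pt) : u = padd v (pscale k w) -> v = padd u (pscale k (psub p0 w)).
Proof. by move=> ->; pt_lia. Qed.

Lemma pairs_subseq r t : t \in pairs r -> subseq [:: t.1; t.2] r.
Proof.
elim: r => //= a r IH; rewrite mem_cat => /orP[/mapP[b br ->]|/IH h] /=.
  by rewrite eqxx sub1seq.
by case: ifP => // _; rewrite sub1seq (mem_subseq h) // !inE eqxx orbT.
Qed.

Lemma triangles_subseq x (t : pt * pt) : t \in triangles x ->
  exists a b c, subseq [:: a; b; c] x /\ t = (psub b a, psub c a).
Proof.
elim: x => //= a r IH; rewrite mem_cat => /orP[/pairs_subseq h|/IH[a' [b [c [h ->]]]]].
  have : exists s, subseq s r /\ [:: t.1; t.2] = [seq psub b a | b <- s].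
    have /subseqP[m sm ->] := h; exists (mask m r); rewrite mask_subseq map_mask; split=> //.
  case=> [[|b [|c [|d s]]] [h' //]]; case=> e1 e2; exists a, b, c.
  by rewrite /= eqxx -e1 -e2; split=> //; exact: surjective_pairing.
exists a', b, c; split; last by [].
exact: subseq_trans h (subseq_cons _ _).
Qed.

Definition code_le (u v : pt) := (code u <=? code v)%ZZ.

Lemma parity_classes_size ol : ol \in parity_classes -> size ol = 7%N.
Proof. by move=> h; apply/eqP; move: ol h; apply/allP. Qed.

Lemma parity_classes_uniq ol : ol \in parity_classes -> uniq ol.
Proof. by move: ol; apply/allP; vm_compute. Qed.

Lemma parity_classes_cong ol (u v : pt) : ol \in parity_classes -> u \in ol -> v \in ol ->
  cong 2 u v.
Proof.
have : all (fun ol => all (fun u => all (cong 2 u) ol) ol) parity_classes by vm_compute.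
by move=> /allP h /h /allP h' /h' /allP; apply.
Qed.

Section StandardFamily.
Variables (K : seq pt -> Prop) (HK : simplex_family K) (Kstd : K std).

Definition normal (x : seq pt) : Prop :=
  [/\ K x, pairwise (fun u v => positive (psub v u)) x & x \in candidates].

Lemma positive_edge u v : edge K (psub v u) -> code_le u v -> positive (psub v u).
Proof.
move=> /(edge_oriented HK Kstd) o /Z.leb_spec0 h; apply: oriented_positive => //.
by rewrite code_sub; lia.
Qed.

Lemma ordered_candidate x : K x -> head p0 x = p0 ->
  pairwise (fun u v => positive (psub v u)) x -> normal x.
Proof.
move=> Kx; have := fam_size HK Kx; case: x Kx => // a s Kx [s4] a0.
have {}a0 : a = p0 by [].
rewrite a0 in Kx * => px; split; [exact: Kx|exact: px|].
have /andP[p0s ps] := px.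
apply: map_f; apply: mem_cliques; [exact: s4| |exact: ps] => v vs.
have := allP p0s _ vs; rewrite /positive mempP.
suff -> : psub v p0 = v by [].
by move: (v : pt) => {vs} w; pt_lia.
Qed.

(** Sort the vertices by [code] and translate the first one to the origin; every difference is then
    an edge of positive code. *)
Lemma normal_form Y : K Y -> exists t y, perm_eq (map (padd^~ t) Y) y /\ normal y.
Proof.
move=> KY; pose Z := sort code_le Y.
have YZ : perm_eq Y Z by rewrite perm_sym perm_sort.
have KZ : K Z := fam_perm HK KY YZ.
have tr : transitive code_le by move=> v u w /Z.leb_spec0 ? /Z.leb_spec0 ?; apply/Z.leb_spec0; lia.
have to : total code_le.
  move=> u v; rewrite /code_le; case: Z.leb_spec0 => //= h; apply/Z.leb_spec0; lia.
pose t := psub p0 (head p0 Z).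
exists t, (map (padd^~ t) Z); split; first exact: perm_map.
apply: ordered_candidate; first exact: (fam_trans HK).
  by rewrite /t; case: (Z) (fam_size HK KZ) => //= a s _; pt_lia.
rewrite pairwise_map; have := sort_sorted to Y; rewrite (sorted_pairwise tr) -/Z => pZ.
have uZ := fam_uniq HK KZ; rewrite uniq_pairwise in uZ.
have: pairwise (fun u v => code_le u v && (u != v)) Z by rewrite pairwise_relI pZ.
apply: (sub_in_pairwise (P := mem Z)); last exact/allP.
move=> u v uin vin /andP[cuv uv] /=.
have -> : psub (padd v t) (padd u t) = psub v u.
  by move: t => t; move: (u : pt) (v : pt) {uin vin cuv uv} => u' v'; pt_lia.
by apply: positive_edge => //; apply: (edge_sub HK KZ).
Qed.

Lemma normal_std : normal std.
Proof. by apply: ordered_candidate => //; vm_compute. Qed.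

Lemma normal_diffs x (v : pt) : normal x -> v \in diffs x -> edge K v /\ positive v.
Proof.
move=> [Kx px _] vx.
have /allP/(_ _ vx) -> : all positive (diffs x) by rewrite all_diffs.
split=> //; apply/asboolP; move: v vx; apply/allP; rewrite all_diffs.
have := fam_uniq HK Kx; rewrite uniq_pairwise.
apply: (sub_in_pairwise (P := mem x)); last exact/allP.
by move=> u v uin vin uv; apply/asboolP; apply: (edge_sub HK Kx).
Qed.

Lemma positive_cong2 (u v : pt) : edge K u -> positive u -> edge K v -> positive v ->
  cong 2 u v -> u = v.
Proof.
move=> eu pu ev pv /congP[//|w e].
have [//|uN] := edge_cong2 HK eu ev e.
by have := positive_code pu; have := positive_code pv; rewrite uN code_sub code_p0; lia.
Qed.

Lemma normal_self_compatible x : normal x -> self_compatible x.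
Proof.
move=> nx; apply/allP => ol olC; rewrite ltnNge; apply/negP => c2.
have uf := filter_uniq (memp^~ (diffs x)) (parity_classes_uniq olC).
rewrite -size_filter in c2; case E : (filter _ _) c2 uf => [|u [|v r]] //= _.
have m : {subset [:: u; v] <= filter (memp^~ (diffs x)) ol}.
  by move=> w; rewrite E !inE => /orP[]->; rewrite ?orbT.
have /m := mem_head u [:: v]; rewrite mem_filter mempP => /andP[ux uo].
have /m : v \in [:: u; v] by rewrite !inE eqxx orbT.
rewrite mem_filter mempP => /andP[vx vo].
have [eu pu] := normal_diffs nx ux; have [ev pv] := normal_diffs nx vx.
by rewrite (positive_cong2 eu pu ev pv (parity_classes_cong olC uo vo)) inE eqxx.
Qed.

Lemma normal_compatible x y : normal x -> normal y -> compatible (pattern x) (pattern y).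
Proof.
move=> nx ny; rewrite /compatible /pattern all2_map_diag.
apply/allP => ol olC; cbv zeta; case: ifP => // i7; case: ifP => // j7.
have s7 := parity_classes_size olC; rewrite -s7 -!has_find in i7 j7.
have := nth_find p0 i7; have := nth_find p0 j7; rewrite /= !mempP.
set v := nth p0 ol _; set u := nth p0 ol _ => vy ux.
have uo : u \in ol by rewrite mem_nth // -has_find.
have vo : v \in ol by rewrite mem_nth // -has_find.
have [eu pu] := normal_diffs nx ux; have [ev pv] := normal_diffs ny vy.
have uv := positive_cong2 eu pu ev pv (parity_classes_cong olC uo vo).
rewrite eqSS; apply/eqP/eqP.
by rewrite -(nth_uniq p0 _ _ (parity_classes_uniq olC)) -?has_find //; apply/eqP.
Qed.

Lemma normal_triangle x (t : pt * pt) : normal x -> t \in triangles x ->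
  [/\ triangle K t, (0 < code t.1)%ZZ & (code t.1 < code t.2)%ZZ].
Proof.
move=> [Kx px _] /triangles_subseq[a [b [c [abc ->]]]].
have := subseq_uniq abc (fam_uniq HK Kx).
have := subseq_pairwise abc px; rewrite /= !andbT => /andP[/andP[pab pac] pbc] uabc.
have := positive_code pab; have := positive_code pbc; rewrite !code_sub => ? ?.
split; try lia; have /subseqP[m sm abcE] := abc.
exists (map (padd^~ (psub p0 a)) (mask (map negb m) x)).
have -> : [:: p0, psub b a, psub c a & map (padd^~ (psub p0 a)) (mask (map negb m) x)] =
    map (padd^~ (psub p0 a)) ([:: a; b; c] ++ mask (map negb m) x).
  rewrite /=; congr [:: _, _, _ & _]; move: (a : pt) (b : pt) (c : pt) {abc px pab pac pbc uabc abcE} => a' b' c'; pt_lia.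
apply: (fam_trans HK); apply: (fam_perm HK Kx); rewrite abcE.
elim: x m sm {abc abcE px Kx} => [|z x IH] [|[] m] //= [sm]; rewrite ?perm_cons ?IH //.
by rewrite -[z :: mask (map _ _) _]cat1s perm_sym perm_catCA /= perm_cons perm_sym IH.
Qed.

(** Congruent barycentres make the triangles translates of each other. Both have their vertex of
    least code at the origin, so the translation is zero, and the order by code matches the
    remaining vertices. *)
Lemma normal_no_conflict x y : normal x -> normal y -> triangle_conflict x y = false.
Proof.
move=> nx ny; apply/negP => /hasP[t tx /hasP[t' ty /andP[/congP[//|w e] neq]]].
have [T p1 p2] := normal_triangle nx tx; have [T' q1 q2] := normal_triangle ny ty.
have E := triangle_cong3 HK T T' e.
have [w' [e' cw']] : exists w', padd t'.1 t'.2 = padd (padd t.1 t.2) (pscale 3 w') /\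
    code w' = (- code w)%ZZ.
  by exists (psub p0 w); split; [exact: padd_shift|rewrite code_sub code_p0; lia].
have E' := triangle_cong3 HK T' T e'.
case: t t' => [u v] [u' v'] /= in tx ty neq T p1 p2 T' q1 q2 e E e' E' *.
have in3 (z a b : pt) : z \in [:: p0; a; b] -> z = p0 \/ z = a \/ z = b.
  by rewrite !inE => /or3P[] /eqP; auto.
have w0 : w = p0.
  have [x' /in3 h1 h2] := E p0 (mem_head _ _).
  have [x'' /in3 h3 h4] := E' p0 (mem_head _ _).
  have c1 := congr1 code h2; have c2 := congr1 code h4.
  rewrite !code_add code_p0 in c1 c2.
  have p3 : (0 < code v)%ZZ by lia.
  have q3 : (0 < code v')%ZZ by lia.
  have cx : (0 <= code x'')%ZZ by case: h3 => [->|[->|->]]; rewrite ?code_p0; lia.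
  have cw : (code w = code x'')%ZZ by lia.
  case: h1 h2 c1 => [->|[->|->]] h2 c1.
  - by rewrite h2; clear; case: w => [[[a b] c] d]; rewrite /=; pt_eq; lia.
  - by exfalso; clear -c1 cw cx q1 q3; lia.
  - by exfalso; clear -c1 cw cx q1 q3; lia.
have u3 : u \in [:: p0; u; v] by rewrite !inE eqxx orbT.
have v3 : v \in [:: p0; u; v] by rewrite !inE eqxx !orbT.
have [a /in3 ha] := E u u3; have [b /in3 hb] := E v v3.
rewrite w0 !padd0 => vb ua; subst a b.
have n0 z : (0 < code z)%ZZ -> z <> p0 by move=> h zE; rewrite zE code_p0 in h; lia.
case: ha => [/n0|[ha|ha]]; first lia.
  case: hb => [/n0|[hb|hb]]; first lia.
    by rewrite ha hb in p2; lia.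
  by move: neq; rewrite ha hb; case/negP; apply/andP; split; apply/peqbP.
case: hb => [/n0|[hb|hb]]; first lia.
  by rewrite ha hb in p2; lia.
by rewrite ha hb in p2; lia.
Qed.
End StandardFamily.

(* The base 3 digits of e, shifted to -1, 0, 1, are the entries of a matrix. *)
Definition ternary_digit (e : Z) (k : nat) : Z := ((e / 3 ^ Z.of_nat k) mod 3 - 1)%ZZ.
Definition ternary_column (e : Z) (k : nat) : pt :=
  (ternary_digit e (k + 3), ternary_digit e (k + 2), ternary_digit e (k + 1), ternary_digit e k).
Definition ternary_matrix (e : Z) : seq pt :=
  [:: ternary_column e 12; ternary_column e 8; ternary_column e 4; ternary_column e 0].

Definition apply_columns (h : seq pt) (v : pt) : pt :=
  let: (a, b, c, d) := v in
  padd (padd (pscale a (nth p0 h 0)) (pscale b (nth p0 h 1)))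
       (padd (pscale c (nth p0 h 2)) (pscale d (nth p0 h 3))).

Definition pmin (u v : pt) : pt :=
  let: (a, b, c, d) := u in let: (a', b', c', d') := v in
  (Z.min a a', Z.min b b', Z.min c c', Z.min d d').

(** A full-dimensional simplex with vertices in the unit cube has coordinatewise minimum 0, so only
    the translation by [m] has to be tried. Inclusion suffices, both sides having five points. *)
Definition in_cube_simplices (i : nat) (x : seq pt) : bool :=
  let m := psub p0 (foldr pmin (head p0 x) x) in
  let y := map (padd^~ m) x in
  has (fun Y => all (memp^~ y) Y) (cube_simplices i).

(** * The certified search and its soundness *)

Definition refines (p q : seq nat) : bool := all2 (fun a b => (a == 0%N) || (a == b)) p q.
Definition join (p q : seq nat) : seq nat := [seq maxn ab.1 ab.2 | ab <- zip p q].

Fixpoint check_leaf (l : leaf) (X : seq (seq pt)) : bool :=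
  match l with
  | Tl i e => let h := ternary_matrix e in
      all (fun x => in_cube_simplices i (map (apply_columns h) x)) X
  | Ct i l1 l2 =>
      let x := nth [::] X i in
      let A := filter (triangle_conflict x) X in
      if check_leaf l1 (filter (fun y => ~~ triangle_conflict x y) X) then
        check_leaf l2 (filter (fun y => ~~ all (triangle_conflict y) A) X)
      else false
  end.

Section Search.
Variables (patterns : seq (seq nat)) (simplices : seq (seq nat * seq pt)).

Fixpoint check_tree (t : tree) (P : seq (seq nat)) : bool :=
  match t with
  | Lf l =>
      let a := foldr join (nseq 5 0%N) P in
      if all (refines^~ a) P then
        check_leaf l (map snd (filter (fun px => refines px.1 a) simplices))
      else false
  | Dd u =>
      let p := nth [::] patterns u in
      [&& (u < size patterns)%N, all (compatible p) P & ~~ has (fun q => q == p) P]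
  | Nd u ch =>
      let p := nth [::] patterns u in
      if (u < size patterns)%N then
        (fix go (ch : seq tree) (B Q : seq (seq nat)) : bool :=
          match ch, B with
          | _, [::] => true
          | c :: ch', q :: B' =>
              (* If q belongs to the maximal set, only patterns compatible with q remain; otherwise
                 q is dropped from all later branches. *)
              if check_tree c (filter (compatible q) Q)
              then go ch' B' (filter (fun r => r != q) Q) else false
          | _, _ => false
          end) ch (filter (fun q => (q == p) || ~~ compatible p q) P) P
      else false
  end.

Variables (N : seq pt -> Prop) (M : seq (seq nat)).
Hypotheses (N_simplices : forall x, N x -> (pattern x, x) \in simplices)
  (N_M : forall x, N x -> pattern x \in M)
  (N_conflict : forall x y, N x -> N y -> triangle_conflict x y = false)
  (M_compatible : forall p q, p \in M -> q \in M -> compatible p q)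
  (M_maximal : forall p, p \in patterns -> (forall q, q \in M -> compatible p q) -> p \in M).

Lemma check_leaf_sound l X : (forall x, N x -> x \in X) -> check_leaf l X ->
  exists i e, forall x, N x -> in_cube_simplices i (map (apply_columns (ternary_matrix e)) x).
Proof.
elim: l X => [i e|i l1 IH1 l2 IH2] X NX.
  by move=> /allP h; exists i, e => x /NX /h.
cbn [check_leaf]; cbv zeta; case: ifP => // c1 c2.
set x := nth [::] X i in c1 c2; set A := filter (triangle_conflict x) X in c2.
have [NA|[a aA Na]] : (forall y, N y -> y \notin A) \/ exists2 a, a \in A & N a.
  have [h|h] := pselect (exists2 a, a \in A & N a); [by right|left => y Ny].
  by apply/negP => yA; apply: h; exists y.
- apply: IH1 c1 => y Ny; rewrite mem_filter NX // andbT.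
  by have := NA y Ny; rewrite mem_filter NX // andbT.
- apply: IH2 c2 => y Ny; rewrite mem_filter NX // andbT.
  by apply/negP => /allP/(_ a aA); rewrite N_conflict.
Qed.

Lemma check_tree_sound t P : {subset M <= P} -> check_tree t P ->
  exists i e, forall x, N x -> in_cube_simplices i (map (apply_columns (ternary_matrix e)) x).
Proof.
move: t P; fix IH 1 => -[l|u|u ch] P MP.
- cbn [check_tree]; cbv zeta; case: ifP => // /allP h.
  apply: check_leaf_sound => x Nx; apply/mapP; exists (pattern x, x) => //.
  by rewrite mem_filter N_simplices // andbT; apply: h; apply: (MP); exact: N_M.
- move=> /and3P[u1 /allP h /negP[]]; apply/hasP; exists (nth [::] patterns u) => //.
  apply: (MP); apply: M_maximal; first exact: mem_nth.
  by move=> q /MP /h.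
- cbn [check_tree]; cbv zeta; case: ifP => // u1.
  set p := nth [::] patterns u; set B := filter _ P.
  have : exists2 q, q \in M & q \in B.
    apply: contrapT => nB; have pM : p \in M.
      apply: M_maximal => [|q qM]; first exact: mem_nth.
      apply: contrapT => /negP pq; apply: nB; exists q => //.
      by rewrite mem_filter pq orbT MP.
    by apply: nB; exists p => //; rewrite mem_filter eqxx MP.
  clearbody B; move: B P MP; elim: ch => [|c ch IHch] [|q B] Q MQ [r rM rB] //.
  case: ifP => // cc go.
  have [qM|qM] := boolP (q \in M).
    by apply: (IH c _ _ cc) => v vM; rewrite mem_filter MQ // M_compatible.
  apply: (IHch B _ _ _ go).
    by move=> v vM; rewrite mem_filter MQ // andbT; apply: contraNneq qM => <-.
  exists r => //; move: rB; rewrite inE => /orP[/eqP rq|//].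
  by rewrite -rq rM in qM.
Qed.
End Search.

Definition pruned := filter self_compatible candidates.
Definition patterns := undup (map pattern pruned).
(** The standard simplex is present from the start, so simplices that conflict with it are removed
    before the search. *)
Definition simplices :=
  map (fun x => (pattern x, x)) (filter (fun x => ~~ triangle_conflict std x) pruned).

Lemma search_checked :
  (let P := patterns in let S := simplices in check_tree P S clique_tree P).
Proof. by vm_compute. Qed.

(** Elements of [S] are added greedily. This supplies the maximal compatible set that the search
    tree requires. *)
Lemma maximal_extension (T : eqType) (r : rel T) (S s : seq T) : reflexive r -> symmetric r ->
  {subset s <= S} -> {in s &, forall p q, r p q} ->
  exists M : seq T, [/\ {subset s <= M}, {subset M <= S}, {in M &, forall p q, r p q} &
    forall p, p \in S -> (forall q, q \in M -> r p q) -> p \in M].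
Proof.
move=> rr sr sS rs.
have : {subset S <= S} by [].
elim: {1 4}S => [|a l IH] aS; first by exists s; split.
have [|M [sM MS rM mM]] := IH; first by move=> p pl; apply: aS; rewrite inE pl orbT.
have [ra|nra] := boolP (all (r a) M); last first.
  exists M; split=> // p; rewrite inE => /orP[/eqP ->|/mM//] h.
  by case/negP: nra; apply/allP.
exists (a :: M); split.
- by move=> p /sM h; rewrite inE h orbT.
- by move=> p; rewrite inE => /orP[/eqP ->|/MS//]; apply: aS; rewrite mem_head.
- move=> p q; rewrite !inE => /orP[/eqP ->|pM] /orP[/eqP ->|qM] //.
  + exact: (allP ra).
  + by rewrite sr; apply: (allP ra).
  + exact: rM.
- move=> p; rewrite inE => /orP[/eqP ->|pl h]; first by rewrite mem_head.
  by rewrite inE mM ?orbT // => q qM; apply: h; rewrite inE qM orbT.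
Qed.

Lemma compatible_refl : reflexive compatible.
Proof. by elim=> //= a p ->; rewrite eqxx !orbT. Qed.

Lemma compatible_sym : symmetric compatible.
Proof.
elim=> [|a p IH] [|b q] //=; rewrite /compatible /= -/(compatible p q) -/(compatible q p) IH.
by rewrite orbCA [b == a]eq_sym.
Qed.

Lemma search_sound P S t (N : seq pt -> Prop) :
  (forall x, N x -> pattern x \in P) -> (forall x, N x -> (pattern x, x) \in S) ->
  (forall x y, N x -> N y -> compatible (pattern x) (pattern y)) ->
  (forall x y, N x -> N y -> triangle_conflict x y = false) ->
  check_tree P S t P ->
  exists i e, forall x, N x -> in_cube_simplices i (map (apply_columns (ternary_matrix e)) x).
Proof.
move=> NP NS Nc Nt.
pose s := [seq p <- P | `[< exists2 x, N x & p = pattern x >]].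
have sP x : N x -> pattern x \in s.
  by move=> nx; rewrite mem_filter NP // andbT; apply/asboolP; exists x.
have [|p q|M [sM MP rM mM]] := @maximal_extension _ compatible P s compatible_refl compatible_sym.
- by move=> p; rewrite mem_filter => /andP[].
- rewrite !mem_filter => /andP[/asboolP[x nx ->] _] /andP[/asboolP[y ny ->] _].
  exact: Nc.
apply: (@check_tree_sound P S N M) => //.
by move=> x /sP /sM.
Qed.

Lemma normal_pruned K x : simplex_family K -> normal K x -> x \in pruned.
Proof. by move=> HK nx; rewrite mem_filter (normal_self_compatible HK nx); case: nx. Qed.

Lemma cube_classification K : simplex_family K -> K std ->
  exists i e, forall x, normal K x ->
    in_cube_simplices i (map (apply_columns (ternary_matrix e)) x).
Proof.
move=> HK Kstd; apply: (search_sound _ _ _ _ search_checked).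
- by move=> x /(normal_pruned HK) h; rewrite mem_undup; apply: map_f.
- move=> x nx; apply: map_f; rewrite mem_filter (normal_pruned HK nx).
  by rewrite (normal_no_conflict HK (normal_std HK Kstd) nx).
- by move=> x y; apply: (normal_compatible HK).
- by move=> x y; apply: (normal_no_conflict HK).
Qed.

(** * Common points of lattice simplices, by separating functionals *)

Section Separation.
Import Order.TTheory GRing.Theory Num.Theory.
Local Open Scope classical_set_scope.
Local Open Scope ring_scope.

Section Weights.
Variables (R : realType) (n : nat).
Local Notation V := 'cV[R]_n.
Implicit Types (s : seq V) (b : V -> R) (u : 'rV[R]_n).

(** Weights vanish off the list, so that agreement of barycentric coordinates over two different
    lists is equality of functions. *)
Definition weights s b (x : V) :=
  [/\ forall v, v \notin s -> b v = 0, forall v, 0 <= b v,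
      \sum_(v <- s) b v = 1 & x = comb s b].

Lemma sum_support (W : nmodType) s s' (F : V -> W) : uniq s -> uniq s' ->
  (forall v, F v <> 0 -> v \in s /\ v \in s') -> \sum_(v <- s) F v = \sum_(v <- s') F v.
Proof.
move=> us us' h.
have E t : \sum_(v <- t) F v = \sum_(v <- filter (fun v => F v != 0) t) F v.
  rewrite big_filter [RHS]big_mkcond; apply: eq_bigr => v _.
  by case: eqP => // ->.
rewrite E [RHS]E; apply: perm_big; apply: uniq_perm; rewrite ?filter_uniq // => v.
by rewrite !mem_filter; case: eqP => // /h[-> ->].
Qed.

Lemma weights_support s b x v : weights s b x -> b v <> 0 -> v \in s.
Proof. by move=> [b0 _ _ _] bv; apply: contrapT => /negP /b0. Qed.

Lemma weights_sub s s' b x : uniq s -> uniq s' -> weights s b x ->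
  (forall v, b v <> 0 -> v \in s') -> weights s' b x.
Proof.
move=> us us' w h; have [b0 bp b1 ->] := w.
have ss v : b v <> 0 -> v \in s /\ v \in s' by move=> bv; split; [exact: weights_support w bv|exact: h].
split=> //.
- by move=> v /negP vs'; apply: contrapT => /h.
- by rewrite -(sum_support us us' ss).
- apply: sum_support => // v bv; apply: ss => bv0; apply: bv.
  by rewrite bv0 scale0r.
Qed.

Lemma convP s x : conv s x <-> exists b, weights s b x.
Proof.
split=> [[c [c0 c1 ->]]|[b [_ bp b1 ->]]]; last by exists b; split.
exists (fun v => if v \in s then c v else 0); split.
- by move=> v /negbTE ->.
- by move=> v; case: ifP => // /c0.
- by rewrite -c1 big_seq [RHS]big_seq; apply: eq_bigr => v ->.
- by rewrite /comb big_seq [RHS]big_seq; apply: eq_bigr => v ->.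
Qed.

(* Common points have the same barycentric coordinates. *)
Definition agree s s' := forall b b' x, weights s b x -> weights s' b' x -> b = b'.

Lemma agree_conv s s' : uniq s -> uniq s' -> agree s s' ->
  conv s `&` conv s' = conv (filter (mem s') s).
Proof.
move=> us us' a; have uf : uniq (filter (mem s') s) by rewrite filter_uniq.
apply/seteqP; split=> [x [/convP[b w] /convP[b' w']]|x /convP[b w]].
  apply/convP; exists b; apply: (weights_sub us uf w) => v bv.
  rewrite mem_filter (weights_support w bv) andbT.
  by rewrite (a _ _ _ w w') in bv; exact: weights_support w' bv.
have sup v : b v <> 0 -> v \in s' /\ v \in s.
  by move=> /(weights_support w); rewrite mem_filter => /andP[].
split; apply/convP; exists b.
  by apply: (weights_sub uf us w) => v /sup[].
by apply: (weights_sub uf us' w) => v /sup[].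
Qed.

Definition ev u (x : V) : R := (u *m x) 0 0.

Lemma ev_comb u s b : ev u (comb s b) = \sum_(v <- s) b v * ev u v.
Proof.
rewrite /ev /comb mulmx_sumr summxE; apply: eq_bigr => v _.
by rewrite -scalemxAr mxE.
Qed.

Lemma weights_le u s b x m : weights s b x -> (forall v, v \in s -> ev u v <= m) ->
  ev u x <= m.
Proof.
move=> [_ bp b1 ->] h; rewrite ev_comb -[m]mul1r -b1 mulr_suml big_seq [leRHS]big_seq.
by apply: ler_sum => v vs; rewrite ler_wpM2l // h.
Qed.

Lemma weights_max u s b x m : weights s b x -> (forall v, v \in s -> ev u v <= m) ->
  ev u x = m -> forall v, b v <> 0 -> ev u v = m.
Proof.
move=> w h xm v bv; have [_ bp b1 xE] := w.
have h0 : \sum_(v <- s) b v * (m - ev u v) = 0.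
  under eq_bigr do rewrite mulrBr.
  by rewrite sumrB -mulr_suml b1 mul1r -ev_comb -xE xm subrr.
have hp p : p \in s -> 0 <= b p * (m - ev u p).
  by move=> ps; rewrite mulr_ge0 // subr_ge0 h.
have /eqP := psum_seq_eq0 hp h0 (weights_support w bv).
by rewrite mulf_eq0 subr_eq0 => /orP[/eqP/bv//|/eqP->].
Qed.

Lemma ev_opp u x : ev (- u) x = - ev u x.
Proof. by rewrite /ev mulNmx mxE. Qed.

(** The common point attains the maximum of [u] over one hull and the minimum over the other, so all
    its weight lies on the hyperplane where [u] equals [m]. *)
Lemma separation u s s' b b' x m : weights s b x -> weights s' b' x ->
  (forall v, v \in s -> ev u v <= m) -> (forall v, v \in s' -> m <= ev u v) ->
  (forall v, b v <> 0 -> ev u v = m) /\ (forall v, b' v <> 0 -> ev u v = m).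
Proof.
move=> w w' h h'.
have hN v : v \in s' -> ev (- u) v <= - m by move=> /h'; rewrite ev_opp lerN2.
have xm : ev u x = m.
  apply/eqP; rewrite eq_le (weights_le w h) /= -lerN2 -ev_opp.
  exact: weights_le w' hN.
split=> v bv; first exact: weights_max w h xm v bv.
by apply: oppr_inj; rewrite -ev_opp; apply: (weights_max w' hN _ bv); rewrite ev_opp xm.
Qed.

Lemma agree_indep s b b' x : indep s -> weights s b x -> weights s b' x -> b = b'.
Proof.
move=> ind w w'; have [b0 _ b1 xE] := w; have [b0' _ b1' xE'] := w'.
apply/funext => v; have [vs|vs] := boolP (v \in s); last by rewrite b0 // b0'.
by apply: (indep_comb_eq ind _ _ vs); rewrite ?b1 ?b1' // -xE -xE'.
Qed.

(** A functional constant on all vertices but one isolates the coefficient of that vertex in a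
    dependency. *)
Lemma indep_ev s : uniq s ->
  (forall v, v \in s -> exists u m, ev u v <> m /\ forall v', v' \in s -> v' != v -> ev u v' = m) ->
  indep s.
Proof.
move=> us h; split=> // c c0 cs v vs; have [u [m [um um']]] := h v vs.
have : \sum_(p <- s) c p * (ev u p - m) = 0.
  under eq_bigr do rewrite mulrBr.
  by rewrite sumrB -mulr_suml c0 mul0r -ev_comb cs /ev mulmx0 mxE subr0.
rewrite (bigD1_seq v) //= big_seq_cond big1 ?addr0.
  by move=> /eqP; rewrite mulf_eq0 subr_eq0 => /orP[/eqP//|/eqP].
by move=> p /andP[ps pv]; rewrite um' // subrr mulr0.
Qed.

End Weights.

Definition dot (w v : pt) : Z :=
  let: (a, b, c, d) := w in let: (a', b', c', d') := v in (a * a' + b * b' + c * c' + d * d')%ZZ.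

Lemma dot_add w u v : dot w (padd u v) = (dot w u + dot w v)%ZZ.
Proof. by pt_cases; rewrite /dot /padd; lia. Qed.

Section LatticePolytopes.
Variable R : realType.
Local Notation vR := (vR R).
Local Notation zR := (zR R).

Lemma ev_vR (w v : pt) : ev (vR w)^T (vR v) = zR (dot w v).
Proof.
rewrite /ev mxE !big_ord_recl big_ord0 !mxE /=; pt_cases; rewrite /= /dot !zRD !zRM /zR.
by rewrite addr0 !addrA.
Qed.

Definition signs : seq Z := [:: -1; 0; 1]%ZZ.
(** These are also the differences of points of the unit cube, so the same list serves for the
    translations and the edge vectors to be inspected. *)
Definition functionals : seq pt :=
  flatten [seq flatten [seq flatten [seq [seq (a, b, c, d) | d <- signs]
    | c <- signs] | b <- signs] | a <- signs].

Lemma mem_functionals a b c d : a \in signs -> b \in signs -> c \in signs -> d \in signs ->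
  (a, b, c, d) \in functionals.
Proof.
move=> ha hb hc hd; apply/flattenP; eexists; first by apply: map_f; exact: ha.
apply/flattenP; eexists; first by apply: map_f; exact: hb.
apply/flattenP; eexists; first by apply: map_f; exact: hc.
exact: map_f.
Qed.

Definition isolated (Y : seq pt) : bool :=
  lall (fun y => lhas (fun w =>
    let o := filter (fun v => ~~ peqb v y) Y in
    let m := dot w (head p0 o) in
    if dot w y =? m then false else lall (fun v => dot w v =? m) o)%ZZ functionals) Y.

(* Every vertex of X outside Y lies strictly on one side of a hyperplane weakly
   separating X from Y, hence has weight zero at common points. *)
Definition separated (X Y : seq pt) : bool :=
  let W := filter (fun w => let m := foldr Z.min (dot w (head p0 Y)) (map (dot w) Y) in
     lall (fun x => dot w x <=? m)%ZZ X) functionals in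
  lall (fun x => if memp x Y then true else
     lhas (fun w => lall (fun y => dot w x <? dot w y)%ZZ Y) W) X.

Definition in_cube (v : pt) : bool :=
  let: (a, b, c, d) := v in
  [&& 0 <=? a, a <=? 1, 0 <=? b, b <=? 1, 0 <=? c, c <=? 1, 0 <=? d & d <=? 1]%ZZ.

(* A face of a translated simplex lying in the cube is a face of the triangulation. *)
Definition translation_ok (L : seq (seq pt)) : bool :=
  lall (fun t => lall (fun Y => let Y' := filter in_cube (map (padd^~ t) Y) in
    lhas (fun Z => lall (memp^~ Z) Y') L) L) functionals.

Lemma indep_isolated Y : uniq Y -> isolated Y -> indep (map vR Y).
Proof.
move=> uY /lallP h; apply: indep_ev => [|_ /mapP[y yY ->]].
  by rewrite map_inj_uniq //; exact: vR_inj.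
have /lhasP[w _] := h y yY; cbv zeta; case: (Z.eqb_spec (dot w y)) => // ne /lallP e.
exists (vR w)^T, (zR (dot w (head p0 [seq v <- Y | ~~ peqb v y]))); split.
  by rewrite ev_vR => /zR_inj.
move=> _ /mapP[v vY ->] vy; rewrite ev_vR; congr zR; apply/Z.eqb_spec; apply: e.
rewrite mem_filter vY andbT; apply: contraNN vy => /peqbP vy.
by apply/eqP; congr vR.
Qed.

Lemma foldr_min_le (a : Z) (l : seq Z) x : x \in a :: l -> (foldr Z.min a l <= x)%ZZ.
Proof.
elim: l => [|b l IH]; first by rewrite inE => /eqP -> /=; lia.
rewrite !inE => /or3P[/eqP xa|/eqP ->|xl] /=; [|lia|].
  by have := IH; rewrite xa mem_head => /(_ isT); lia.
by have := IH; rewrite inE xl orbT => /(_ isT); lia.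
Qed.

Lemma separated_weights X Y b b' x : separated X Y ->
  weights (map vR X) b x -> weights (map vR Y) b' x ->
  forall v, b v <> 0 -> v \in map vR Y.
Proof.
move=> /lallP sep w w' v bv; have /mapP[u uX vu] := weights_support w bv.
have := sep u uX; rewrite mempP; case: ifP => [uY _|_]; first by rewrite vu map_f.
move=> /lhasP[f]; rewrite mem_filter => /andP[/lallP fX _] /lallP fY.
set m := foldr _ _ _ in fX.
have [||h1 h2] := @separation _ _ (vR f)^T _ _ _ _ _ (zR m) w w'.
- by move=> _ /mapP[z /fX zX ->]; rewrite ev_vR zR_le.
- move=> _ /mapP[z zY ->]; rewrite ev_vR zR_le; apply/Z.leb_spec0.
  by apply: foldr_min_le; rewrite inE map_f ?orbT.
have [v'' bv''] : exists v', b' v' <> 0.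
  have [_ _ b1 _] := w'; have [v'' _ /eqP] := psum_seq_gt0 b1; by exists v''.
have /mapP[z' z'Y v''z] := weights_support w' bv''.
have := h1 v bv; have := h2 v'' bv''; rewrite vu v''z !ev_vR => <- /zR_inj e.
by have /Z.ltb_spec0 := fY z' z'Y; rewrite e; lia.
Qed.

Lemma agree_separated X Y : uniq X -> uniq Y -> indep (map vR X) ->
  separated X Y -> separated Y X -> agree (map vR X) (map vR Y).
Proof.
move=> uX uY iX sXY sYX b b' x w w'.
have uVX := iX.1; have uVY : uniq (map vR Y) by rewrite map_inj_uniq //; exact: vR_inj.
by apply: (agree_indep iX w); apply: (weights_sub uVY uVX w'); exact: (separated_weights sYX w' w).
Qed.

(** If f t >= 1 the hyperplane f = 1 separates X from Y + t, and if f t <= -1 the hyperplane f = 0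
    does; a common point has all its weight there. *)
Lemma unit_interval_translate f t X Y b b' x :
  (forall v, v \in X -> (0 <= dot f v <= 1)%ZZ) -> (forall v, v \in Y -> (0 <= dot f v <= 1)%ZZ) ->
  weights (map vR X) b x -> weights (map vR (map (padd^~ t) Y)) b' x ->
  (-1 <= dot f t <= 1)%ZZ /\ forall v, b' (vR v) <> 0 -> (0 <= dot f v <= 1)%ZZ.
Proof.
move=> fX fY w w'.
have Yt v : v \in map (padd^~ t) Y -> (dot f t <= dot f v <= dot f t + 1)%ZZ.
  by move=> /mapP[y /fY yY ->]; rewrite dot_add; lia.
have sY (v : pt) : b' (vR v) <> 0 -> v \in map (padd^~ t) Y.
  by move=> /(weights_support w'); rewrite mem_map //; exact: vR_inj.
have [v bv] : exists v : pt, b' (vR v) <> 0.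
  have [_ _ b1 _] := w'; have [v /mapP[u _ ->] /eqP bu] := psum_seq_gt0 b1; by exists u.
have [t1|[t1|t0]] : (1 <= dot f t \/ dot f t <= -1 \/ dot f t = 0)%ZZ by lia.
- have [||_ h] := @separation _ _ (vR f)^T _ _ _ _ _ (zR 1) w w'.
  + by move=> _ /mapP[z /fX zX ->]; rewrite ev_vR zR_le; apply/Z.leb_spec0; lia.
  + by move=> _ /mapP[z /Yt zY ->]; rewrite ev_vR zR_le; apply/Z.leb_spec0; lia.
  have {}h v' : b' (vR v') <> 0 -> dot f v' = 1%ZZ.
    by move=> /h; rewrite ev_vR => /zR_inj.
  by split=> [|v' /h ->]; [have := h v bv; have := Yt v (sY v bv); lia|lia].
- have [||h _] := @separation _ _ (vR f)^T _ _ _ _ _ (zR 0) w' w.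
  + by move=> _ /mapP[z /Yt zY ->]; rewrite ev_vR zR_le; apply/Z.leb_spec0; lia.
  + by move=> _ /mapP[z /fX zX ->]; rewrite ev_vR zR_le; apply/Z.leb_spec0; lia.
  have {}h v' : b' (vR v') <> 0 -> dot f v' = 0%ZZ.
    by move=> /h; rewrite ev_vR => /zR_inj.
  by split=> [|v' /h ->]; [have := h v bv; have := Yt v (sY v bv); lia|lia].
- by split=> [|v' bv']; [lia|have := Yt v' (sY v' bv'); lia].
Qed.

(** By the four coordinate functionals, a common point has positive weight only at vertices of Y + t
    in the cube. Some Z in [L] contains these, so the weights are also weights over Z, which agrees
    with X. *)
Lemma agree_translate L X Y t : (forall Y, Y \in L -> uniq Y) ->
  (forall X Y, X \in L -> Y \in L -> agree (map vR X) (map vR Y)) ->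
  all (all in_cube) L -> translation_ok L ->
  X \in L -> Y \in L -> agree (map vR X) (map vR (map (padd^~ t) Y)).
Proof.
move=> uL aL /allP cL tL XL YL b b' x w w'.
have co f Z : Z \in L -> f \in [:: (1,0,0,0); (0,1,0,0); (0,0,1,0); (0,0,0,1)]%ZZ ->
    forall v : pt, v \in Z -> (0 <= dot f v <= 1)%ZZ.
  move=> /cL /allP h + v /h; clear; case: v => [[[a b] c] d].
  rewrite !inE /in_cube => /or4P[] /eqP ->; rewrite /dot;
  by move=> /and5P[/Z.leb_spec0 ? /Z.leb_spec0 ? /Z.leb_spec0 ? /Z.leb_spec0 ? /and4P[/Z.leb_spec0 ? /Z.leb_spec0 ? /Z.leb_spec0 ? /Z.leb_spec0 ?]]; lia.
have U f (hf : f \in [:: (1,0,0,0); (0,1,0,0); (0,0,1,0); (0,0,0,1)]%ZZ) :=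
  unit_interval_translate (co f X XL hf) (co f Y YL hf) w w'.
have [t1 h1] := U (1,0,0,0)%ZZ isT; have [t2 h2] := U (0,1,0,0)%ZZ isT.
have [t3 h3] := U (0,0,1,0)%ZZ isT; have [t4 h4] := U (0,0,0,1)%ZZ isT.
have tW : t \in functionals.
  case: t t1 t2 t3 t4 {w' U h1 h2 h3 h4} => [[[a c] d] e]; rewrite /dot => t1 t2 t3 t4.
  have S z : (-1 <= z <= 1)%ZZ -> z \in signs.
    move=> hz; have : (z = -1 \/ z = 0 \/ z = 1)%ZZ by lia.
    by rewrite !inE; move=> [->|[->|->]].
  by apply: mem_functionals; apply: S; lia.
have [Z ZL /lallP hZ] := lhasP _ _ (lallP _ _ (lallP _ _ tL t tW) Y YL).
have uY : uniq (map vR (map (padd^~ t) Y)).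
  by rewrite !map_inj_uniq ?uL //; [exact: paddI|exact: vR_inj].
have uZ : uniq (map vR Z) by rewrite map_inj_uniq ?uL //; exact: vR_inj.
apply: (aL X Z XL ZL _ _ x w); apply: (weights_sub uY uZ w') => v bv.
have /mapP[u uY' vu] := weights_support w' bv; rewrite vu in bv *; apply: map_f.
rewrite -mempP; apply: hZ; rewrite mem_filter uY' andbT.
move: (h1 u bv) (h2 u bv) (h3 u bv) (h4 u bv); clear; case: (u : pt) => [[[a c] d] e].
rewrite /dot /in_cube => ? ? ? ?.
by apply/and5P; split; [| | | |apply/and4P; split]; apply/Z.leb_spec0; lia.
Qed.
End LatticePolytopes.

End Separation.

(** * Covering the unit cube by bisection *)

Section Covering.
Import Order.TTheory GRing.Theory Num.Theory.
Local Open Scope classical_set_scope.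
Local Open Scope ring_scope.

Fixpoint select (V : seq pt) : seq (pt * seq pt) :=
  if V is v :: V' then (v, V') :: [seq (p.1, v :: p.2) | p <- select V'] else [::].

Definition halve (v : pt) : pt := let: (a, b, c, d) := v in (a / 2, b / 2, c / 2, d / 2)%ZZ.

(* Bisects edges until all vertices are midpoints of vertices of one simplex of L. *)
Fixpoint covered (L : seq (seq pt)) (depth : nat) (V : seq pt) : bool :=
  if lhas (fun Y => lall (fun v => lhas (fun y => lhas (fun y' => peqb v (padd y y')) Y) Y) V) L
  then true
  else if depth is d.+1 then
    lhas (fun p => lhas (fun q =>
      let m := halve (padd p.1 q.1) in
      if peqb (padd p.1 q.1) (padd m m) then
        if covered L d [:: m, p.1 & q.2] then covered L d [:: m, q.1 & q.2] else false
      else false) (select p.2)) (select V)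
  else false.

(* All coordinates are doubled, so that midpoints of cube vertices are integral. *)
Definition double_unit (i : nat) : pt :=
  nth p0 [:: (2, 0, 0, 0); (0, 2, 0, 0); (0, 0, 2, 0); (0, 0, 0, 2)]%ZZ i.

(** The vertices of Kuhn's simplex of the permutation [s]: a monotone path from [b] along the
    coordinate directions. *)
Fixpoint kuhn (b : pt) (s : seq nat) : seq pt :=
  b :: (if s is i :: s' then kuhn (padd b (double_unit i)) s' else [::]).

Definition cube_covered (L : seq (seq pt)) : bool :=
  all (fun s => covered L 2 (kuhn p0 s)) (permutations (iota 0 4)).

Section Cones.
Variable R : realType.
Local Notation vR := (vR R).
Local Notation V := 'cV[R]_4.

(** Nonnegative combinations of total weight [s], one coefficient peeled off at a time; this suits
    bisection, where points may repeat. *)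
Fixpoint cone (X : seq pt) (s : R) (x : V) : Prop :=
  if X is v :: X' then exists2 a, 0 <= a & cone X' (s - a) (x - a *: vR v)
  else s = 0 /\ x = 0.

Lemma cone_add X s s' x x' : cone X s x -> cone X s' x' -> cone X (s + s') (x + x').
Proof.
elim: X s s' x x' => [|v X IH] s s' x x' /=; first by move=> [-> ->] [-> ->]; rewrite !addr0.
move=> [a a0 h] [a' a0' h']; exists (a + a'); first exact: addr_ge0.
by rewrite scalerDl !opprD (addrACA s) (addrACA x); exact: IH.
Qed.

Lemma cone_scale X k s x : 0 <= k -> cone X s x -> cone X (k * s) (k *: x).
Proof.
move=> k0; elim: X s x => [|v X IH] s x /=; first by move=> [-> ->]; rewrite mulr0 scaler0.
move=> [a a0 h]; exists (k * a); first exact: mulr_ge0.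
by rewrite -mulrBr -scalerA -scalerBr; exact: IH.
Qed.

Lemma cone0 X : cone X 0 0.
Proof. by elim: X => //= v X IH; exists 0; rewrite ?scale0r ?subr0. Qed.

Lemma cone_mem X v : v \in X -> cone X 1 (vR v).
Proof.
elim: X => //= u X IH; rewrite inE => /orP[/eqP <-|/IH h].
  by exists 1; rewrite ?scale1r ?subrr //; exact: cone0.
by exists 0; rewrite ?scale0r ?subr0.
Qed.

Lemma cone_sub X Y k s x : (forall v, v \in X -> cone Y k (vR v)) -> cone X s x ->
  cone Y (k * s) x.
Proof.
elim: X s x => [|v X IH] s x XY /=; first by move=> [-> ->]; rewrite mulr0; exact: cone0.
move=> [a a0 h].
have -> : k * s = k * (s - a) + a * k by ring.
have -> : x = (x - a *: vR v) + a *: vR v by rewrite subrK.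
apply: cone_add; last by apply: cone_scale => //; apply: XY; rewrite mem_head.
by apply: IH h => w wX; apply: XY; rewrite inE wX orbT.
Qed.

Lemma cone_swap u v X s x : cone [:: u, v & X] s x -> cone [:: v, u & X] s x.
Proof.
move=> [a a0 [b b0 h]]; exists b => //; exists a => //.
by rewrite addrAC [X in cone _ _ X]addrAC.
Qed.

Lemma cone_select X p s x : p \in select X -> cone X s x -> cone (p.1 :: p.2) s x.
Proof.
elim: X p s x => //= v X IH p s x; rewrite inE => /orP[/eqP -> //|/mapP[q qX ->]] [a a0 h].
by apply: cone_swap; exists a => //; exact: (IH q _ _ qX h).
Qed.

(** For b <= a, a u + b v = 2 b m + (a - b) u; otherwise symmetrically. *)
Lemma cone_split u v m X s x : padd u v = padd m m -> cone [:: u, v & X] s x ->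
  cone [:: m, u & X] s x \/ cone [:: m, v & X] s x.
Proof.
move=> /(congr1 vR); rewrite !vRD => uv [a a0 [b b0 h]].
have [ab|/ltW ba] := lerP b a; [left|right].
  exists (b + b); first exact: addr_ge0.
  exists (a - b); first by rewrite subr_ge0.
  have -> : s - (b + b) - (a - b) = s - a - b by ring.
  suff -> : x - (b + b) *: vR m - (a - b) *: vR u = x - a *: vR u - b *: vR v by [].
  have -> : (b + b) *: vR m = b *: vR u + b *: vR v.
    by rewrite -scalerDr uv scalerDl scalerDr.
  by rewrite scalerBl; apply/matrixP => i j; rewrite !mxE; ring.
exists (a + a); first exact: addr_ge0.
exists (b - a); first by rewrite subr_ge0.
have -> : s - (a + a) - (b - a) = s - a - b by ring.
suff -> : x - (a + a) *: vR m - (b - a) *: vR v = x - a *: vR u - b *: vR v by [].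
have -> : (a + a) *: vR m = a *: vR u + a *: vR v.
  by rewrite -scalerDr uv scalerDl scalerDr.
by rewrite scalerBl; apply/matrixP => i j; rewrite !mxE; ring.
Qed.

(** A midpoint in doubled coordinates is the sum of two vertices, which doubles the total weight. *)
Lemma midpoints_cone X Y s x :
  lall (fun v => lhas (fun y => lhas (fun y' => peqb v (padd y y')) Y) Y) X ->
  cone X s x -> cone Y (2 * s) x.
Proof.
move=> /lallP h; apply: cone_sub => v /h /lhasP[y yY /lhasP[y' yY' /peqbP ->]].
by rewrite vRD -[2]/(1 + 1); apply: cone_add; apply: cone_mem.
Qed.

Lemma covered_cone L d X s x : covered L d X -> cone X s x ->
  exists2 Y, Y \in L & cone Y (2 * s) x.
Proof.
elim: d X s x => [|d IH] X s x /=; case: ifP => [/lhasP[Y YL m] _ h|_] //.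
- by exists Y => //; exact: midpoints_cone h.
- by exists Y => //; exact: midpoints_cone h.
move=> /lhasP[p pX /lhasP[q qp]]; case: ifP => // /peqbP e; case: ifP => // c1 c2 h.
have {}h := cone_select pX h.
have {}h : cone [:: p.1, q.1 & q.2] s x by case: h => a a0 h; exists a => //; exact: cone_select h.
by have [|] := cone_split e h; apply: IH.
Qed.

(** Summation by parts: the weights are the successive differences of the nonincreasing
    coefficients. *)
Lemma kuhn_cone (f : nat -> R) b s m : 0 <= m -> path (fun i j => j <= i) m (map f s) ->
  (forall i, i \in s -> 0 <= f i) ->
  cone (kuhn b s) m (m *: vR b + \sum_(i <- s) f i *: vR (double_unit i)).
Proof.
elim: s b m => [|i s IH] b m m0 /=.
  by move=> _ _; exists m => //; rewrite big_nil addr0 !subrr.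
move=> /andP[fm ps] f0; exists (m - f i); first by rewrite subr_ge0.
rewrite opprB addrC subrK big_cons.
have -> : m *: vR b + (f i *: vR (double_unit i) + \sum_(j <- s) f j *: vR (double_unit j)) -
    (m - f i) *: vR b =
    f i *: vR (padd b (double_unit i)) + \sum_(j <- s) f j *: vR (double_unit j).
  rewrite vRD scalerBl scalerDr; apply/matrixP => k l; rewrite !mxE; ring.
apply: IH => //; first by apply: f0; rewrite mem_head.
by move=> j js; apply: f0; rewrite inE js orbT.
Qed.

Lemma cone_conv X x : uniq X -> cone X 1 x -> conv (map vR X) x.
Proof.
suff E s : uniq X -> cone X s x -> exists c, [/\ forall p, p \in map vR X -> 0 <= c p,
    \sum_(p <- map vR X) c p = s & x = comb (map vR X) c] by apply: E.
rewrite /comb; elim: X s x => [|v X IH] s x /=.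
  by move=> _ [-> ->]; exists (fun=> 0); split=> //; rewrite big_nil.
move=> /andP[vX uX] [a a0 /(IH _ _ uX)[c [c0 c1 xE]]].
have vX' : vR v \notin map vR X by rewrite mem_map //; exact: vR_inj.
exists (fun p => if p == vR v then a else c p); split.
- by move=> p; rewrite inE; case: eqP => //= _; exact: c0.
- rewrite big_cons eqxx -[RHS](subrK a) addrC -c1; congr (_ + _).
  rewrite big_seq [RHS]big_seq; apply: eq_bigr => p pX.
  by case: eqP => // pv; rewrite -pv pX in vX'.
- rewrite big_cons eqxx -[LHS](subrK (a *: vR v)) addrC xE; congr (_ + _).
  rewrite big_seq [RHS]big_seq; apply: eq_bigr => p pX.
  by case: eqP => // pv; rewrite -pv pX in vX'.
Qed.

Lemma cube_covered_conv L (x : V) : all uniq L -> cube_covered L ->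
  (forall i, 0 <= x i 0 <= 1) -> exists2 Y, Y \in L & conv (map vR Y) x.
Proof.
move=> /allP uL /allP cL x01; pose f i := x (inord i) 0.
(* Sorting the coordinates of x in decreasing order selects a Kuhn simplex that contains it. *)
pose s := sort (fun i j => f j <= f i) (iota 0 4).
have ps : perm_eq s (iota 0 4) by rewrite perm_sort.
have sE : \sum_(i <- s) f i *: vR (double_unit i) = 2 *: x.
  have e2 : (Posz (Pos.to_nat 2))%:~R = 2 :> R by [].
  rewrite (perm_big _ ps) /= !big_cons big_nil /f.
  apply/matrixP => i j; rewrite ord1 !mxE /=.
  have [->|[->|[->|->]]] : i = inord 0 \/ i = inord 1 \/ i = inord 2 \/ i = inord 3.
    by case: i => -[|[|[|[|//]]]] hi; [left|right; left|right; right; left|right; right; right];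
      apply: val_inj; rewrite /= inordK.
  1-4: by rewrite ?(@inordK 3) //= ?e2 ?mulr0 ?addr0 ?add0r mulrC.
have kc : cone (kuhn p0 s) 1 (1 *: vR p0 + \sum_(i <- s) f i *: vR (double_unit i)).
  apply: kuhn_cone => // [|i _]; last by case/andP: (x01 (inord i)).
  have : sorted (fun i j => f j <= f i) s by apply: sort_sorted => i j; exact: le_total.
  case: s {ps sE} => //= i s; rewrite path_map => ->.
  by case/andP: (x01 (inord i)) => _ ->.
rewrite vR0 scaler0 add0r sE in kc.
have [|Y YL h] := covered_cone (L := L) (d := 2) _ kc.
  by apply: cL; rewrite mem_permutations.
exists Y => //; apply: cone_conv; first exact: uL.
have := cone_scale (k := 2^-1) _ h; rewrite mulr1 scalerA mulVf ?pnatr_eq0 // scale1r.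
by apply; rewrite invr_ge0 ler0n.
Qed.
End Cones.

End Covering.

(** * From a triangulation of the cube to a periodic triangulation *)

Section CubeTriangulations.
Import Order.TTheory GRing.Theory Num.Theory.
Local Open Scope classical_set_scope.
Local Open Scope ring_scope.

Definition triangulates_cube (L : seq (seq pt)) : bool :=
  [&& all (fun Y => size Y == 5%N) L, all uniq L, all isolated L,
      all (fun X => all (separated X) L) L, all (all in_cube) L, translation_ok L &
      cube_covered L].

Section Families.
Variable R : realType.
Local Notation vR := (vR R).
Local Notation V := 'cV[R]_4.

Definition lattice_family (L : seq (seq pt)) : set (set V) :=
  [set S | exists Y t, Y \in L /\ S = conv (map vR (map (padd^~ t) Y))].

Lemma map_vR_shift t X : map vR (map (padd^~ t) X) = map (fun x => x + vR t) (map vR X).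
Proof. by rewrite -!map_comp; apply: eq_map => x /=; rewrite vRD. Qed.

Lemma weights_shift s b x (u : V) : weights (map (fun y => y + u) s) b x ->
  weights s (fun v => b (v + u)) (x - u).
Proof.
move=> [b0 bp b1 ->]; rewrite big_map in b1; split=> //.
- by move=> v vs; apply: b0; apply: contra vs => /mapP[y ys /addIr ->].
- rewrite /comb big_map.
  under eq_bigr do rewrite scalerDr.
  by rewrite big_split /= -scaler_suml b1 scale1r addrK.
Qed.

Lemma agree_shift s s' (u : V) : agree s s' ->
  agree (map (fun y => y + u) s) (map (fun y => y + u) s').
Proof.
move=> a b b' x /weights_shift w /weights_shift w'; apply/funext => v.
by have /(congr1 (fun f => f (v - u))) := a _ _ _ w w'; rewrite subrK.
Qed.

Section Triangulation.
Variable L : seq (seq pt).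
Hypothesis tL : triangulates_cube L.

Lemma family_uniq Y : Y \in L -> uniq Y.
Proof. by have /and5P[_ /allP h _ _ _] := tL; exact: h. Qed.

Lemma family_indep Y t : Y \in L -> indep (map vR (map (padd^~ t) Y)).
Proof.
move=> YL; have /and5P[_ _ /allP h _ _] := tL.
rewrite map_vR_trans; apply: indep_affine; first exact: unitmx1.
by apply: indep_isolated; [exact: family_uniq|exact: h].
Qed.

Lemma family_spans Y t : Y \in L ->
  spans (map vR (map (padd^~ t) Y)) (conv (map vR (map (padd^~ t) Y))).
Proof.
move=> YL; split=> //; last exact: family_indep.
by have /and5P[/allP/(_ Y YL)/eqP h _ _ _ _] := tL; rewrite !size_map.
Qed.

Lemma family_agree0 X Y : X \in L -> Y \in L -> agree (map vR X) (map vR Y).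
Proof.
move=> XL YL; have /and5P[_ _ _ /allP h _] := tL.
have e0 (Z : seq pt) : map (padd^~ p0) Z = Z.
  by rewrite -[RHS]map_id; apply: eq_map => z; exact: padd0.
apply: agree_separated; [exact: family_uniq|exact: family_uniq|..].
- by rewrite -(e0 X); exact: family_indep.
- exact: (allP (h X XL)).
- exact: (allP (h Y YL)).
Qed.

Lemma family_agree X Y t t' : X \in L -> Y \in L ->
  agree (map vR (map (padd^~ t) X)) (map vR (map (padd^~ t') Y)).
Proof.
move=> XL YL; have /and5P[_ _ _ _ /and3P[cL trL _]] := tL.
have -> : map (padd^~ t') Y = map (padd^~ t) (map (padd^~ (psub t' t)) Y).
  by rewrite -map_comp; apply: eq_map => y /=; rewrite -paddA psubK.
rewrite !(map_vR_shift t); apply: agree_shift.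
exact: (agree_translate family_uniq family_agree0 cL trL).
Qed.

Lemma family_periodic : periodic (lattice_family L).
Proof.
have sub (u : pt) : translate (vR u) (lattice_family L) `<=` lattice_family L.
  move=> _ [_ [Y [t [YL ->]]] <-]; exists Y, (padd t u); split=> //.
  have -> : map (padd^~ (padd t u)) Y = map (padd^~ u) (map (padd^~ t) Y).
    by rewrite -map_comp; apply: eq_map => y /=; rewrite paddA.
  rewrite [in RHS]map_vR_trans conv_affine ?unitmx1 //.
  by apply: eq_imagel => x _; rewrite mul1mx.
move=> _ /latticeP[u ->]; apply/seteqP; split; first exact: sub.
move=> S LS; exists [set x + vR (psub p0 u) | x in S].
  by apply: (sub (psub p0 u)); exists S.
rewrite image_comp -[RHS]image_id; apply: eq_imagel => x _.
by rewrite -[LHS]/(x + vR (psub p0 u) + vR u) vRB vR0 sub0r subrK.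
Qed.

Lemma family_triangulation : triangulation (lattice_family L).
Proof.
have /and5P[_ uL _ _ /and3P[_ _ covL]] := tL.
have cov : \bigcup_(S in lattice_family L) S = setT.
  apply/seteqP; split=> // x _.
  pose t := pv (\col_i Num.floor (x i 0)).
  have tE i : vR t i 0 = (Num.floor (x i 0))%:~R by rewrite /vR pvK !mxE.
  have [|Y YL cY] := @cube_covered_conv R L (x - vR t) uL covL.
    move=> i; rewrite mxE [(- vR t) i 0]mxE tE subr_ge0 real_floor_le ?num_real //=.
    by rewrite lerBlDl -[1]/(1%:~R) -intrD ltW // real_floorD1_gt ?num_real.
  exists (conv (map vR (map (padd^~ t) Y))); first by exists Y, t.
  rewrite map_vR_trans conv_affine ?unitmx1 //; exists (x - vR t) => //.
  by rewrite mul1mx subrK.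
split=> //; split.
- by move=> _ [Y [t [YL ->]]]; apply/spansP; exists (map vR (map (padd^~ t) Y)); exact: family_spans.
- apply/seteqP; split=> x.
    move=> [_ [Y [t [YL ->]]]]; rewrite (vertices_spans (family_spans t YL)).
    by move=> /mapP[v _ ->]; exact: vR_lattice.
  move=> /latticeP[v ->].
  have [S [Y [t [YL ->]]] _] : (\bigcup_(S in lattice_family L) S) 0 by rewrite cov.
  have /and5P[/allP/(_ Y YL)/eqP sY _ _ _ _] := tL.
  pose t' := psub v (head p0 Y).
  exists (conv (map vR (map (padd^~ t') Y))); first by exists Y, t'.
  rewrite (vertices_spans (family_spans t' YL)) /=; apply: map_f.
  case: Y sY {YL} @t' => //= y Y _; rewrite inE; apply/orP; left.
  by rewrite paddC psubK.
- have F S1 S2 : lattice_family L S1 -> lattice_family L S2 -> is_face (S1 `&` S2) S1.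
    move=> [X [t [XL ->]]] [Y [t' [YL ->]]]; apply/(spans_face _ (family_spans t XL)).
    exists (mem (map vR (map (padd^~ t') Y))); apply: agree_conv.
    + by case: (family_indep t XL).
    + by case: (family_indep t' YL).
    + exact: family_agree.
  by move=> S1 S2 L1 L2; split; [|rewrite setIC]; exact: F.
Qed.
End Triangulation.
End Families.

Lemma cube_simplices_checked : all (fun i => triangulates_cube (cube_simplices i)) (iota 0 4).
Proof. vm_cast_no_check (erefl true). Qed.

End CubeTriangulations.

(** * Moving a partial triangulation into one of the four *)

Section Assembly.
Import Order.TTheory GRing.Theory Num.Theory.
Local Open Scope classical_set_scope.
Local Open Scope ring_scope.

Lemma cube_triangulates i : (i < 4)%N -> triangulates_cube (cube_simplices i).
Proof. by move=> i4; apply: (allP cube_simplices_checked); rewrite mem_iota. Qed.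

Lemma in_cube_simplicesP i x : size x = 5%N -> in_cube_simplices i x ->
  (i < 4)%N /\ exists Y m, Y \in cube_simplices i /\ perm_eq (map (padd^~ m) x) Y.
Proof.
move=> sx; rewrite /in_cube_simplices; cbv zeta; set m := psub _ _ => h.
have i4 : (i < 4)%N.
  by rewrite ltnNge; apply/negP => i4; move: h; rewrite /cube_simplices nth_default.
split=> //; have /and5P[/allP sL /allP uL _ _ _] := cube_triangulates i4.
have /hasP[Y YL /allP YS] := h; exists Y, m; split=> //.
have sub : {subset Y <= map (padd^~ m) x} by move=> v /YS; rewrite mempP.
have sz : (size (map (padd^~ m) x) <= size Y)%N by rewrite size_map sx (eqP (sL Y YL)).
have uY := uL Y YL; have [_ e] := uniq_min_size uY sub sz.
by rewrite perm_sym; apply: uniq_perm => //; exact: leq_size_uniq uY sub sz.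
Qed.

Definition act (g : 'M[int]_4) (v : pt) : pt := pv (g *m vi v).

Lemma act_add g u v : act g (padd u v) = padd (act g u) (act g v).
Proof. by apply: vi_inj; rewrite /act [RHS]viD !pvK viD mulmxDr. Qed.

Lemma actK g : g \in unitmx -> cancel (act g) (act (invmx g)).
Proof. by move=> gu v; rewrite /act pvK mulKmx // viK. Qed.

Lemma actVK g : g \in unitmx -> cancel (act (invmx g)) (act g).
Proof. by move=> gu v; rewrite /act pvK mulKVmx // viK. Qed.

Definition column_matrix (h : seq pt) : 'M[int]_4 :=
  \matrix_(i, j) vi (nth p0 h j) i 0.

Lemma apply_columnsE h v : apply_columns h v = act (column_matrix h) v.
Proof.
apply: vi_inj; rewrite /act pvK; case: v => [[[a b] c] d].
rewrite /apply_columns !viD !viZ; apply/matrixP => i j; rewrite ord1 !mxE.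
by rewrite !big_ord_recl big_ord0 !mxE /= addr0 !addrA ![_ * int_of_Z (co _ _)]mulrC.
Qed.

Lemma surjective_unitmx h : (forall v, exists w, apply_columns h w = v) ->
  column_matrix h \in unitmx.
Proof.
move=> /choice[f fP].
pose N : 'M[int]_4 := \matrix_(i, j) vi (f (pv (col j 1%:M))) i 0.
suff /mulmx1_unit[] : column_matrix h *m N = 1%:M by [].
apply/matrixP => i j.
have := congr1 (fun w => vi w i 0) (fP (pv (col j 1%:M))).
rewrite apply_columnsE /act !pvK => e.
transitivity ((col j 1%:M : 'cV[int]_4) i 0); last by rewrite mxE.
rewrite -e !mxE.
by apply: eq_bigr => k _; rewrite !mxE.
Qed.

(** The columns of [h] are the edges at a vertex of a simplex of K, and unimodularity makes them
    generate the lattice. *)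
Lemma simplex_basis K h m : simplex_family K ->
  K (map (padd^~ m) (map (apply_columns h) std)) -> column_matrix h \in unitmx.
Proof.
move=> HK KX; apply: surjective_unitmx => v.
have [c0 [c1 [c2 [c3 [c4 [-> cs]]]]]] := unimodular0 HK v KX.
exists (c4, c3, c2, c1); have -> : c0 = (- (c1 + c2 + c3 + c4))%ZZ by lia.
rewrite /std /= /apply_columns; move: (nth p0 h 0) (nth p0 h 1) (nth p0 h 2) (nth p0 h 3).
by clear; intros; pt_cases; rewrite /=; pt_eq; lia.
Qed.

Lemma shift_back u v w : padd (padd (padd u v) w) (psub p0 (padd v w)) = u.
Proof. by pt_lia. Qed.

Section Classification.
Variable R : realType.
Local Notation vR := (vR R).

Lemma vR_act g v : vR (act g v) = map_mx intr g *m vR v.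
Proof. by rewrite /vR /act pvK int_vector_mul. Qed.

Lemma map_vR_act g X : map vR (map (act g) X) = map (fun x => map_mx intr g *m x + 0) (map vR X).
Proof. by rewrite -!map_comp; apply: eq_map => v /=; rewrite vR_act addr0. Qed.

Lemma conv_act g X : g \in unitmx ->
  [set map_mx intr g *m x | x in conv (map vR X)] = conv (map vR (map (act g) X)).
Proof.
by move=> gu; rewrite linear_image_affine map_vR_act conv_affine // intr_unitmx.
Qed.

Lemma inK_family PT : partial_triangulation PT -> periodic PT -> simplex_family (@inK R PT).
Proof.
move=> pT perT; split.
- exact: K_size.
- exact: K_uniq.
- exact: K_perm.
- exact: K_trans.
- exact: K_indep.
- exact: K_carrier.
- exact: K_rank.
Qed.

Lemma inK_act PT g X : g \in unitmx -> @inK R PT X ->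
  inK (linear_image g PT) (map (act g) X).
Proof.
move=> gu [sX iX TX]; split; first by rewrite size_map.
  by rewrite map_vR_act; apply: indep_affine => //; exact: intr_unitmx.
by exists (conv (map vR X)) => //; exact: conv_act.
Qed.

Lemma linear_image_cube (PT : set (set 'cV[R]_4)) : partial_triangulation PT -> periodic PT ->
  exists i g, [/\ (i < 4)%N, g \in unitmx &
    linear_image g PT `<=` @lattice_family R (cube_simplices i)].
Proof.
move=> pT perT; have HK := inK_family pT perT.
have [X0 KX0] : exists X, @inK R PT X.
  have [_ vert _] := pT.
  have : integer_lattice (vR p0) by exact: vR_lattice.
  by rewrite -vert => -[S TS _]; have [X] := K_cover pT TS; exists X.
have [x0 [x1 [x2 [x3 [x4 XE]]]]] := fam_list HK KX0.
pose h0 := [:: psub x4 x0; psub x3 x0; psub x2 x0; psub x1 x0].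
have XE' : X0 = map (padd^~ x0) (map (apply_columns h0) std).
  rewrite XE /= /apply_columns /h0 /=; clear.
  by pt_cases; rewrite /=; do 5?[congr (_ :: _)]; pt_eq; lia.
rewrite XE' in KX0; have Bu := simplex_basis HK KX0.
set B := column_matrix h0 in Bu; have Bu' : invmx B \in unitmx by rewrite unitmx_inv.
set PT' := linear_image (invmx B) PT.
have pT' : partial_triangulation PT' by exact: linear_image_partial.
have perT' : periodic PT' by exact: linear_image_periodic.
have HK' := inK_family pT' perT'.
have Kstd : @inK R PT' std.
  have -> : std = map (act (invmx B)) (map (apply_columns h0) std).
    rewrite -map_comp -[LHS]map_id; apply: eq_map => v /=.
    by rewrite apply_columnsE actK.
  apply: inK_act => //.
  have -> : map (apply_columns h0) std =
      map (padd^~ (psub p0 x0)) (map (padd^~ x0) (map (apply_columns h0) std)).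
    rewrite -[RHS]map_comp -[LHS]map_id; apply: eq_map => v /=.
    by pt_lia.
  exact: (fam_trans HK).
have [i [e cl]] := cube_classification HK' Kstd.
set h := ternary_matrix e in cl.
have nstd := normal_std HK' Kstd.
have [||i4 [Y [m [YL pY]]]] := @in_cube_simplicesP i (map (apply_columns h) std).
- by [].
- exact: cl.
have tL := cube_triangulates i4.
have [pF _] := family_triangulation R tL; have perF := @family_periodic R (cube_simplices i).
have HF := inK_family pF perF.
have KF Z t : Z \in cube_simplices i ->
    @inK R (@lattice_family R (cube_simplices i)) (map (padd^~ t) Z).
  move=> ZL; have [sz ind _] := family_spans R tL t ZL; split=> //.
    by rewrite size_map in sz.
  by exists Z, t.
(* The certificate does not assert that its matrix is invertible. This follows because the image of
   [std] is, up to translation, a simplex of the cube triangulation, to which [unimodular] applies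
   as well. *)
have Hu : column_matrix h \in unitmx.
  apply: (simplex_basis (m := m) HF); apply: (fam_perm HF) (_ : perm_eq Y _); last by rewrite perm_sym.
  have e0 : map (padd^~ p0) Y = Y.
    by rewrite -[RHS]map_id; apply: eq_map => z; exact: padd0.
  by rewrite -e0; exact: KF.
exists i, (column_matrix h *m invmx B); split=> //; first by rewrite unitmx_mul Hu.
rewrite -linear_image_comp -/PT' => _ [S TS <-].
have [X KX ->] := K_cover pT' TS; rewrite conv_act //.
have [t [y [Xy ny]]] := normal_form HK' Kstd KX.
have sy : size (map (apply_columns h) y) = 5%N by case: ny => /(fam_size HK') sy _ _; rewrite size_map.
have [_ [Z [m' [ZL pZ]]]] := in_cube_simplicesP sy (cl y ny).
pose u := psub p0 (padd (act (column_matrix h) t) m').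
exists Z, u; split=> //.
have pX : perm_eq (map (act (column_matrix h)) X) (map (padd^~ u) Z).
  rewrite perm_sym; have -> : map (act (column_matrix h)) X = map (padd^~ u)
      (map (padd^~ m') (map (apply_columns h) (map (padd^~ t) X))).
    rewrite -!map_comp; apply: eq_map => v.
    rewrite -[RHS]/(padd (padd (apply_columns h (padd v t)) m') u).
    by rewrite apply_columnsE act_add shift_back.
  apply: perm_map; rewrite perm_sym; apply: perm_trans pZ; apply: perm_map; exact: perm_map.
have uX : uniq (map vR (map (act (column_matrix h)) X)).
  rewrite !map_inj_uniq ?(fam_uniq HK' KX) //; first exact: can_inj (actK Hu).
  exact: vR_inj.
apply: conv_eqi => //; first by rewrite -(perm_uniq (perm_map _ pX)).
exact/perm_mem/perm_map.
Qed.
End Classification.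

(** * Inequivalence of the four triangulations *)

Definition has_edge (e : pt) (Y : seq pt) : bool := lhas (fun a => memp (padd a e) Y) Y.
(* The number of simplices around the edge e, modulo translation; it is an
   invariant under GL_4(Z). *)
Definition degree (L : seq (seq pt)) (e : pt) : nat := count (has_edge e) L.
Definition degrees (L : seq (seq pt)) : seq nat := undup (map (degree L) functionals).

(** No two members of the list are translates of each other, so counting members counts simplices
    modulo translation. *)
Definition translation_unique (L : seq (seq pt)) : bool :=
  lall (fun X => lall (fun Y => lall (fun y =>
    if lall (fun v => memp (padd v (psub (head p0 X) y)) X) Y then X == Y else true) Y) L) L.

Lemma cube_translation_unique i : (i < 4)%N ->
  uniq (cube_simplices i) && translation_unique (cube_simplices i).
Proof.
have /allP h : all (fun i => uniq (cube_simplices i) && translation_unique (cube_simplices i)) (iota 0 4).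
  by vm_compute.
by move=> i4; apply: h; rewrite mem_iota.
Qed.

Lemma degrees_distinct i j : (i < 4)%N -> (j < 4)%N ->
  degrees (cube_simplices i) =i degrees (cube_simplices j) -> i = j.
Proof.
pose D k := degrees (cube_simplices k).
have /allP h : all (fun i => all (fun j => if i == j then true else
    ~~ (all (fun d => d \in D j) (D i) && all (fun d => d \in D i) (D j))) (iota 0 4)) (iota 0 4).
  by vm_compute.
move=> i4 j4 ij; have := h i; rewrite mem_iota => /(_ i4)/allP/(_ j).
rewrite mem_iota => /(_ j4); case: eqP => // _ /negP[].
apply/andP; split; apply/allP => d dD.
  exact: etrans (esym (ij d)) dD.
exact: etrans (ij d) dD.
Qed.

(** A vector outside [functionals] is no difference of cube points and has degree 0, a value that
    occurs in the list anyway. *)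
Lemma degree_mem i e : (i < 4)%N -> degree (cube_simplices i) e \in degrees (cube_simplices i).
Proof.
move=> i4; rewrite mem_undup.
have [eW|eW] := boolP (e \in functionals); first exact: map_f.
suff -> : degree (cube_simplices i) e = 0%N.
  have /allP h : all (fun i => 0%N \in map (degree (cube_simplices i)) functionals) (iota 0 4).
    by vm_compute.
  by apply: h; rewrite mem_iota.
apply/eqP; rewrite /degree -leqn0 leqNgt -has_count; apply/hasPn => Y YL; apply: contra eW.
have /and5P[_ _ _ _ /and3P[/allP/(_ Y YL)/allP cY _ _]] := cube_triangulates i4.
move=> /lhasP[a aY]; rewrite mempP => /cY; have := cY a aY; move: {aY} (a : pt) => a'.
case: a' e => [[[a1 a2] a3] a4] [[[e1 e2] e3] e4]; rewrite /in_cube /=.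
move=> /and5P[/Z.leb_spec0 ? /Z.leb_spec0 ? /Z.leb_spec0 ? /Z.leb_spec0 ? /and4P[/Z.leb_spec0 ? /Z.leb_spec0 ? /Z.leb_spec0 ? /Z.leb_spec0 ?]].
move=> /and5P[/Z.leb_spec0 ? /Z.leb_spec0 ? /Z.leb_spec0 ? /Z.leb_spec0 ? /and4P[/Z.leb_spec0 ? /Z.leb_spec0 ? /Z.leb_spec0 ? /Z.leb_spec0 ?]].
have S z : (-1 <= z <= 1)%ZZ -> z \in signs.
  move=> hz; have : (z = -1 \/ z = 0 \/ z = 1)%ZZ by lia.
  by rewrite !inE; move=> [->|[->|->]].
by apply: mem_functionals; apply: S; lia.
Qed.

Section Distinctness.
Variable R : realType.
Local Notation vR := (vR R).

(** Send each simplex around [e] to the member of the second list that represents its image modulo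
    translation. Two simplices with the same image are translates of each other, hence equal by
    [translation_unique]. *)
Lemma degree_le i j g e : (i < 4)%N -> (j < 4)%N -> g \in unitmx ->
  linear_image g (@lattice_family R (cube_simplices i)) = lattice_family (cube_simplices j) ->
  (degree (cube_simplices i) e <= degree (cube_simplices j) (act g e))%N.
Proof.
move=> i4 j4 gu gij; have tL := cube_triangulates i4; have tL' := cube_triangulates j4.
have /choice[f fP] Y : exists Z, Y \in cube_simplices i -> Z \in cube_simplices j /\
    exists t, map (act g) Y =i map (padd^~ t) Z.
  have [YL|] := boolP (Y \in cube_simplices i); last by exists [::].
  have e0 : map (padd^~ p0) Y = Y.
    by rewrite -[RHS]map_id; apply: eq_map => z; exact: padd0.
  have : linear_image g (@lattice_family R (cube_simplices i)) (conv (map vR (map (act g) Y))).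
    exists (conv (map vR Y)); last exact: conv_act.
    by exists Y, p0; rewrite e0.
  rewrite gij => -[Z [t [ZL YZ]]]; exists Z => _; split=> //; exists t => v.
  have iY : indep (map vR (map (act g) Y)).
    rewrite map_vR_act; apply: indep_affine; first exact: intr_unitmx.
    by rewrite -e0; exact: (family_indep R tL _ YL).
  have := indep_conv_inj iY (family_indep R tL' t ZL) YZ (vR v).
  by rewrite !(mem_map (@vR_inj R)).
have [/andP[uL /lallP tu] /andP[uL' _]] := (cube_translation_unique i4, cube_translation_unique j4).
rewrite /degree -!size_filter -(size_map f).
apply: uniq_leq_size.
  rewrite map_inj_in_uniq ?filter_uniq // => X Y.
  rewrite !mem_filter => /andP[_ XL] /andP[_ YL] XY.
  have [_ [t Xt]] := fP X XL; have [_ [u Yu]] := fP Y YL; rewrite XY in Xt.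
  have E v : (v \in Y) = (padd v (act (invmx g) (psub t u)) \in X).
    have := Yu (act g v); rewrite (mem_map (can_inj (actK gu))) => ->.
    have := Xt (act g (padd v (act (invmx g) (psub t u)))).
    rewrite (mem_map (can_inj (actK gu))) => ->; rewrite act_add actVK //.
    have -> : padd (act g v) (psub t u) = padd (padd (act g v) (psub p0 u)) t.
      by move: (act g v); clear; pt_lia.
    rewrite (mem_map (@paddI t)).
    have back : act g v = padd (padd (act g v) (psub p0 u)) u by move: (act g v); clear; pt_lia.
    by rewrite {1}back (mem_map (@paddI u)).
  have hX : head p0 X \in X.
    by have /and5P[/allP/(_ X XL) sX _ _ _ _] := tL; case: (X) sX => //= a s _; rewrite mem_head.
  set s := act _ _ in E.
  pose y := psub (head p0 X) s.
  have yY : y \in Y by rewrite E /y psubK.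
  have /lallP/(_ Y YL)/lallP/(_ y yY) := tu X XL.
  have ys : psub (head p0 X) y = s by rewrite /y; move: (head p0 X) (s); clear; pt_lia.
  rewrite ys; case: ifP => [_ /eqP//|/negP[]].
  by apply/lallP => v; rewrite mempP E.
move=> _ /mapP[Y + ->]; rewrite !mem_filter => /andP[eY YL].
have [-> [t Yt]] := fP Y YL; rewrite andbT.
move: eY => /lhasP[a aY]; rewrite mempP => aeY.
have aZ : act g a \in map (padd^~ t) (f Y) by rewrite -Yt map_f.
have aeZ : padd (act g a) (act g e) \in map (padd^~ t) (f Y) by rewrite -act_add -Yt map_f.
apply/lhasP; exists (psub (act g a) t).
  by rewrite -(mem_map (@paddI t)) psubK.
rewrite mempP -(mem_map (@paddI t)).
by have -> : padd (padd (psub (act g a) t) (act g e)) t = padd (act g a) (act g e)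
  by move: (act g a) (act g e); clear; pt_lia.
Qed.

Lemma cube_equivalence i j : (i < 4)%N -> (j < 4)%N ->
  GLZ_equivalent (@lattice_family R (cube_simplices i)) (lattice_family (cube_simplices j)) ->
  i = j.
Proof.
move=> i4 j4 [g gu ji]; have gu' : invmx g \in unitmx by rewrite unitmx_inv.
have ij : linear_image (invmx g) (@lattice_family R (cube_simplices j)) =
    lattice_family (cube_simplices i) by rewrite ji linear_imageK.
have E e : degree (cube_simplices i) e = degree (cube_simplices j) (act g e).
  apply/eqP; rewrite eqn_leq (degree_le e i4 j4 gu (esym ji)).
  by have := degree_le (act g e) j4 i4 gu' ij; rewrite actK.
have E' e : degree (cube_simplices j) e = degree (cube_simplices i) (act (invmx g) e).
  by rewrite E actVK.
apply: (degrees_distinct i4 j4) => d; apply/idP/idP; rewrite {1}mem_undup => /mapP[e _ ->].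
  by rewrite E degree_mem.
by rewrite E' degree_mem.
Qed.
End Distinctness.

End Assembly.

Local Open Scope classical_set_scope.
Local Open Scope ring_scope.

Theorem theorem5p5 (R : realType) :
  (exists T : 'I_4 -> set (set 'cV[R]_4),
     [/\ forall i, triangulation (T i) /\ periodic (T i),
         forall i j, GLZ_equivalent (T i) (T j) -> i = j &
         forall T' : set (set 'cV[R]_4),
           triangulation T' -> periodic T' ->
           exists i, GLZ_equivalent (T i) T'])
  /\
  (forall PT : set (set 'cV[R]_4),
     partial_triangulation PT -> periodic PT ->
     exists T : set (set 'cV[R]_4),
       [/\ triangulation T, periodic T & PT `<=` T]).
Proof.
split.
  exists (fun i => @lattice_family R (cube_simplices i)); split.
  - move=> i; split; last exact: family_periodic.
    by apply: family_triangulation; apply: cube_triangulates; exact: ltn_ord.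
  - by move=> i j h; apply: val_inj; exact: cube_equivalence h.
  - move=> T' tT' perT'; have [pT' _] := tT'.
    have [i [g [i4 gu sub]]] := linear_image_cube pT' perT'.
    have tL := family_triangulation R (cube_triangulates i4).
    exists (Ordinal i4), (invmx g); first by rewrite unitmx_inv.
    by rewrite -(triangulation_maximal (linear_image_triangulation gu tT') tL.1 sub) linear_imageK.
move=> PT pT perT; have [i [g [i4 gu sub]]] := linear_image_cube pT perT.
have gu' : invmx g \in unitmx by rewrite unitmx_inv.
exists (linear_image (invmx g) (@lattice_family R (cube_simplices i))); split.
- by apply: linear_image_triangulation => //; apply: family_triangulation; exact: cube_triangulates.
- by apply: linear_image_periodic => //; exact: family_periodic.
- by rewrite -{1}(linear_imageK PT gu); exact: linear_image_sub.
Qed.
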